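(* For each $n\ge1$ let $L_0^{(n)}$ be a bounded generator of a strongly continuous contraction semigroup in $X_n$ with $\|L_0^{(n)}\|_{X_n\to X_n}\le An(n-1)$ for some $A>0$ independent of $n$, and let $W^{(n)}$ be a bounded operator from $X_{n-1}$ into $X_n$ with $\|W^{(n)}\|_{X_{n-1}\to X_n}\le Bn(n-1)$ for some $B\ge1$ independent of $n$. Let $C_0>0$, $T=\frac1{BC_0}$, and $\{k_{0,V},k_{0,\varepsilon},\varepsilon>0\}\subset\mathcal{K}_{C_0}$. Then, for any $t\in(0,T)$, there exist functions $\{k_{t,V},k_{t,\varepsilon},\varepsilon>0\}\subset\mathcal{K}_{C_t}$, with $C_t=\frac{C_0}{1-BC_0t}$, such that, for any $G\in B_{\mathrm{bs}}(\Gamma_0)$, the functions $t\mapsto\langle\!\langle G,k_{t,\varepsilon}\rangle\!\rangle$ and $t\mapsto\langle\!\langle G,k_{t,V}\rangle\!\rangle$ are continuous on $[0,T)$ (with values $\langle\!\langle G,k_{0,\varepsilon}\rangle\!\rangle$, $\langle\!\langle G,k_{0,V}\rangle\!\rangle$ at $t=0$) and, for $t\in(0,T)$, $$\frac{\partial}{\partial t}\langle\!\langle G,k_{t,\varepsilon}\rangle\!\rangle=\langle\!\langle(\varepsilon L_0+W)G,k_{t,\varepsilon}\rangle\!\rangle,\qquad \frac{\partial}{\partial t}\langle\!\langle G,k_{t,V}\rangle\!\rangle=\langle\!\langle WG,k_{t,V}\rangle\!\rangle .$$ Moreover, $\|k_{t,\varepsilon}\|_{\mathcal{K}_{C_t}}\le\|k_{0,\varepsilon}\|_{\mathcal{K}_{C_0}}$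 and $\|k_{t,V}\|_{\mathcal{K}_{C_t}}\le\|k_{0,V}\|_{\mathcal{K}_{C_0}}$. If, additionally, $$\lim_{\varepsilon\to0}\|k_{0,\varepsilon}-k_{0,V}\|_{\mathcal{K}_{C_0}}=0,$$ then for any $T'\in(0,T)$, $r_0>C_{T'}$, and $G_0\in\mathcal{L}_{r_0}$, $$\sup_{t\in[0,T']}\bigl|\langle\!\langle G_0,k_{t,\varepsilon}-k_{t,V}\rangle\!\rangle\bigr|\to0\quad\text{as }\varepsilon\to0.$$
   Context: $d\in\mathbb{N}$; $X_n:=L^1((\mathbb{R}^d)^n,dx_1\cdots dx_n)$ for $n\ge1$, $X_0:=\mathbb{R}$. $\Gamma_0=\bigsqcup_{n\ge0}\Gamma^{(n)}$ is the set of all finite subsets of $\mathbb{R}^d$ ($\Gamma^{(n)}$ the $n$-point subsets, with the Borel structure of the quotient of the off-diagonal part of $(\mathbb{R}^d)^n$ by permutations), with Lebesgue--Poisson measure $\lambda=\sum_{n\ge0}\frac1{n!}m^{(n)}$, $m^{(n)}$ being the image of Lebesgue measure on $\Gamma^{(n)}$ and $m^{(0)}=\delta_{\{\emptyset\}}$. A function $G$ on $\Gamma_0$ is identified with the sequence $(G^{(n)})_{n\ge0}$ of symmetric functions $G^{(n)}(x_1,\dots,x_n)=G(\{x_1,\dots,x_n\})$. For $G=(G^{(n)})_{n\ge0}$: $(L_0G)^{(n)}=L_0^{(n)}G^{(n)}$ for $n\ge1$, $(WG)^{(n)}=W^{(n)}G^{(n-1)}$ for $n\ge2$, and $(L_0G)^{(0)}=(WG)^{(0)}=(WG)^{(1)}=0$;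 the operators $L_0^{(n)}$, $W^{(n)}$ map symmetric functions to symmetric functions. For $C>0$, $\mathcal{L}_C:=L^1(\Gamma_0,C^{|\eta|}d\lambda(\eta))$, and $\mathcal{K}_C:=\{k:\Gamma_0\to\mathbb{R}\mid k\cdot C^{-|\cdot|}\in L^\infty(\Gamma_0,\lambda)\}$ with norm $\|k\|_{\mathcal{K}_C}=\|k(\cdot)C^{-|\cdot|}\|_{L^\infty(\Gamma_0,\lambda)}$; $\langle\!\langle G,k\rangle\!\rangle:=\int_{\Gamma_0}G\,k\,d\lambda$. $B_{\mathrm{bs}}(\Gamma_0)$ is the set of bounded measurable $G:\Gamma_0\to\mathbb{R}$ vanishing outside $\bigsqcup_{n=0}^N\{\eta\subset\Lambda:|\eta|=n\}$ for some $N\in\mathbb{N}$ and bounded Borel $\Lambda\subset\mathbb{R}^d$. *)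

(* Defs.v *)
From HB Require Import structures.
From mathcomp Require Import all_boot all_order all_algebra perm finmap.
From mathcomp Require Import all_classical all_reals all_analysis.
From mathcomp Require Import measurable_realfun ess_sup_inf.

Set Implicit Arguments.
Unset Strict Implicit.
Unset Printing Implicit Defensive.
Import Order.TTheory GRing.Theory Num.Theory.
Import numFieldNormedType.Exports.
Local Open Scope classical_set_scope.
Local Open Scope ring_scope.

(* The n-fold product of a sigma-finite measure, on n-tuples, obtained from the
   binary product of the library by transport along (x, t) |-> x :: t. *)
Section iterated_product_measure.
Context d (T : measurableType d) (R : realType).
Variable mu : {sigma_finite_measure set T -> \bar R}.
Local Open Scope ereal_scope.

Definition cons_pair n (x : T * n.-tuple T) : n.+1.-tuple T :=
  [tuple of x.1 :: x.2].

Definition uncons_pair n (x : n.+1.-tuple T) : T * n.-tuple T :=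
  (thead x, [tuple of behead x]).

Lemma measurable_cons_pair n : measurable_fun setT (@cons_pair n).
Proof. exact: (@measurable_cons _ _ (T * n.-tuple T)%type T fst n snd). Qed.

Lemma measurable_uncons_pair n : measurable_fun setT (@uncons_pair n).
Proof.
apply/measurable_fun_pairP; split.
- exact: measurable_tnth.
- exact: measurable_behead.
Qed.

Section step.
Context n (m : {sigma_finite_measure set (n.-tuple T) -> \bar R}).

Definition cons_measure : set (n.+1.-tuple T) -> \bar R :=
  pushforward (mu \x m) (@cons_pair n).

Let mcons := @measurable_cons_pair n.

Let cons_measure0 : cons_measure set0 = 0.
Proof. by rewrite /cons_measure /pushforward preimage_set0 measure0. Qed.

Let cons_measure_ge0 A : 0 <= cons_measure A.
Proof. exact: measure_ge0. Qed.

Let cons_measure_sigma_additive : semi_sigma_additive cons_measure.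
Proof.
rewrite /cons_measure => F mF tF mUF; rewrite /pushforward preimage_bigcup.
apply: measure_semi_sigma_additive.
- by move=> i; rewrite -[X in measurable X]setTI; exact: mcons.
- apply/trivIsetP => /= i j _ _ ij; rewrite -preimage_setI.
  by move/trivIsetP : tF => /(_ _ _ _ _ ij) ->//; rewrite preimage_set0.
- by rewrite -preimage_bigcup -[X in measurable X]setTI; exact: mcons.
Qed.

HB.instance Definition _ := isMeasure.Build _ _ _ cons_measure
  cons_measure0 cons_measure_ge0 cons_measure_sigma_additive.

Let cons_measure_sigma_finite : sigma_finite setT cons_measure.
Proof.
have /sigma_finiteP[F [FT ndF Foo]] := sigma_finiteT mu.
have /sigma_finiteP[G [GT ndG Goo]] := sigma_finiteT m.
have mfg i : measurable (F i `*` G i).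
  by apply: measurableX; [exact: (Foo i).1|exact: (Goo i).1].
exists (fun i => @uncons_pair n @^-1` (F i `*` G i)).
  rewrite -preimage_bigcup; apply/esym; rewrite -subTset => t _.
  have [i _ Fi] : (\bigcup_i F i) (thead t) by rewrite -FT.
  have [j _ Gj] : (\bigcup_i G i) [tuple of behead t] by rewrite -GT.
  exists (maxn i j) => //; split.
    by move: Fi; exact/subsetPset/ndF/leq_maxl.
  by move: Gj; exact/subsetPset/ndG/leq_maxr.
move=> i; split.
  by rewrite -[X in measurable X]setTI; exact: measurable_uncons_pair.
rewrite /cons_measure /pushforward -comp_preimage.
have -> : @uncons_pair n \o @cons_pair n = id.
  apply/funext => -[x t]; rewrite /uncons_pair /cons_pair /=; congr (_, _).
  exact/val_inj.
have [mFi Fi] := Foo i; have [mGi Gi] := Goo i.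
by rewrite preimage_id product_measure1E// lte_mul_pinfty// ge0_fin_numE.
Qed.

HB.instance Definition _ := Measure_isSigmaFinite.Build _ _ _ cons_measure
  cons_measure_sigma_finite.

End step.

Fixpoint iter_measure n : {sigma_finite_measure set (n.-tuple T) -> \bar R} :=
  match n with
  | 0%N => [the {sigma_finite_measure set _ -> \bar R} of dirac [tuple]]
  | n.+1 =>
    [the {sigma_finite_measure set _ -> \bar R} of cons_measure (iter_measure n)]
  end.

End iterated_product_measure.

(* The library's type of a.e.-classes of p-integrable functions, made into a
   normed space. *)
Section normed_Lspace.
Context d (T : measurableType d) (R : realType).
Variables (mu : {measure set T -> \bar R}) (p : \bar R) (p1 : (1 <= p)%E).
Local Notation X := (LspaceType mu p1).
Local Notation Y := (LfunType mu p1).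
Local Open Scope quotient_scope.

Lemma ae_eq_Lnorm (f g : T -> R) : measurable_fun setT f ->
  measurable_fun setT g -> ae_eq mu setT f g ->
  'N[mu]_p[EFin \o f]%E = 'N[mu]_p[EFin \o g]%E.
Proof.
move=> mf mg fg; rewrite unlock; case: p p1 => [r r1|_|//].
- congr (_ `^ _)%E; apply: ge0_ae_eq_integral => //.
  + by apply/measurable_EFinP; apply: (measurableT_comp (measurable_powR _)) => //;
    exact: measurableT_comp.
  + by apply/measurable_EFinP; apply: (measurableT_comp (measurable_powR _)) => //;
    exact: measurableT_comp.
  + by move=> x _; exact: poweR_ge0.
  + by move=> x _; exact: poweR_ge0.
  + by apply: filterS fg => x + xT => /(_ xT) /= ->.
- case: ifPn => // _; apply: eq_ess_sup.
  by apply: filterS fg => x /(_ I) /= ->.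
Qed.

Lemma Lspace_in_Lfun (u : X) : (u : T -> R) \in Lfun mu p.
Proof.
rewrite inE; apply/andP; split; rewrite inE/=; last exact: Lebesgue_finite.
exact: (@measurable_funPT _ _ _ _ (repr (u : {mfun_ mu, T >-> measurableTypeR R}))).
Qed.

Definition Lspace_repr (u : X) : Y := Lfun_Sub p1 (Lspace_in_Lfun u).

Section class.
Variable f : Y.

Let to_mTR : T -> measurableTypeR R := f.

Let measurable_to_mTR : measurable_fun setT to_mTR.
Proof. exact: (@measurable_funPT _ _ _ _ f). Qed.

HB.instance Definition _ :=
  isMeasurableFun.Build _ _ _ _ to_mTR measurable_to_mTR.

Definition Lclass_mfun : {mfun_ mu, T >-> measurableTypeR R} :=
  \pi_({mfun_ mu, T >-> measurableTypeR R}) to_mTR.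

Lemma Lclass_mfunE : ae_eq mu setT Lclass_mfun f.
Proof.
have : repr Lclass_mfun = to_mTR %[mod {mfun_ mu, T >-> measurableTypeR R}].
  by rewrite reprK.
by move=> /eqP; rewrite eqmodE => /asboolP.
Qed.

Lemma finite_norm_Lclass : finite_norm mu p Lclass_mfun.
Proof.
rewrite /finite_norm (ae_eq_Lnorm _ _ Lclass_mfunE)//.
- exact: Lfunction_finite.
- exact: (@measurable_funPT _ _ _ _ (repr Lclass_mfun)).
Qed.

HB.instance Definition _ :=
  isFinLebesgue.Build d T R mu p p1 Lclass_mfun finite_norm_Lclass.

Definition Lclass : X := [the LspaceType _ _ of Lclass_mfun].

Lemma LclassE : ae_eq mu setT Lclass f.
Proof. exact: Lclass_mfunE. Qed.

End class.

Lemma LspaceP (u v : X) : ae_eq mu setT u v -> u = v.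
Proof.
move=> uv.
have {}uv : (u : {mfun_ mu, T >-> measurableTypeR R}) = v.
  by rewrite -[LHS]reprK -[RHS]reprK; apply/eqP; rewrite eqmodE; exact/asboolP.
case: u v uv => [u [[hu]]] [v [[hv]]] /= uv.
rewrite uv in hu *; congr LebesgueSpace.Pack; congr LebesgueSpace.Class.
by congr isFinLebesgue.Axioms_; exact: Prop_irrelevance.
Qed.

Lemma Lclass_repr (u : X) : Lclass (Lspace_repr u) = u.
Proof. by apply: LspaceP; exact: LclassE. Qed.

Lemma eq_Lclass (f g : Y) : ae_eq mu setT f g -> Lclass f = Lclass g.
Proof.
move=> fg; apply: LspaceP; apply: (ae_eq_trans (LclassE f)).
by apply: (ae_eq_trans fg); apply: ae_eq_sym; exact: LclassE.
Qed.

HB.instance Definition _ := gen_eqMixin X.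
HB.instance Definition _ := gen_choiceMixin X.

Let zero : X := Lclass 0.
Let add (u v : X) : X := Lclass (Lspace_repr u + Lspace_repr v).
Let opp (u : X) : X := Lclass (- Lspace_repr u).
Let scale (a : R) (u : X) : X := Lclass (a *: Lspace_repr u).

Let add_class (f g : Y) : add (Lclass f) (Lclass g) = Lclass (f + g).
Proof.
apply: eq_Lclass; have := LclassE g; apply: filterS2 (LclassE f) => x.
by move=> /= /(_ I) fx /(_ I) gx _; rewrite /= !fctE /= fx gx.
Qed.

Let opp_class (f : Y) : opp (Lclass f) = Lclass (- f).
Proof.
apply: eq_Lclass; apply: filterS (LclassE f) => x /(_ I) fx _.
by rewrite /= !fctE /= fx.
Qed.

Let scale_class a (f : Y) : scale a (Lclass f) = Lclass (a *: f).
Proof.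
apply: eq_Lclass; apply: filterS (LclassE f) => x /(_ I) fx _.
by rewrite /= !fctE /= fx.
Qed.

Let addA : associative add.
Proof.
move=> u v w; rewrite -(Lclass_repr u) -(Lclass_repr v) -(Lclass_repr w).
by rewrite !add_class addrA.
Qed.

Let addC : commutative add.
Proof. by move=> u v; rewrite /add addrC. Qed.

Let add0 : left_id zero add.
Proof. by move=> u; rewrite -(Lclass_repr u) add_class add0r. Qed.

Let addN : left_inverse zero opp add.
Proof. by move=> u; rewrite -(Lclass_repr u) opp_class add_class addNr. Qed.

HB.instance Definition _ := GRing.isZmodule.Build X addA addC add0 addN.

Let scaleA a b u : scale a (scale b u) = scale (a * b) u.
Proof. by rewrite -(Lclass_repr u) !scale_class scalerA. Qed.

Let scale1 : left_id 1 scale.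
Proof. by move=> u; rewrite -(Lclass_repr u) scale_class scale1r. Qed.

Let scaleDr : right_distributive scale +%R.
Proof.
move=> a u v; rewrite -(Lclass_repr u) -(Lclass_repr v).
by rewrite [X in scale _ X]add_class !scale_class [RHS]add_class scalerDr.
Qed.

Let scaleDl u : {morph scale^~ u : a b / a + b}.
Proof.
by move=> a b; rewrite -(Lclass_repr u) !scale_class [RHS]add_class scalerDl.
Qed.

HB.instance Definition _ :=
  GRing.Zmodule_isLmodule.Build R X scaleA scale1 scaleDr scaleDl.

Let norm (u : X) : R := fine 'N[mu]_p[EFin \o u]%E.

Let norm_class (f : Y) : norm (Lclass f) = fine 'N[mu]_p[EFin \o f]%E.
Proof.
congr fine; apply: ae_eq_Lnorm => //; last exact: LclassE.
exact: (@measurable_funPT _ _ _ _ (Lspace_repr (Lclass f))).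
Qed.

Let ler_normD u v : norm (u + v) <= norm u + norm v.
Proof.
rewrite -(Lclass_repr u) -(Lclass_repr v) [X in norm X]add_class !norm_class.
exact: ler_LnormD.
Qed.

Let normrZ a u : norm (a *: u) = `|a| * norm u.
Proof.
rewrite -(Lclass_repr u) [X in norm X]scale_class !norm_class.
apply: EFin_inj; rewrite EFinM !finite_norm_fine; exact: LnormZ.
Qed.

Let normr0_eq0 u : norm u = 0 -> u = 0.
Proof.
rewrite -(Lclass_repr u) norm_class => /fine_Lnormr_eq0 u0.
exact: eq_Lclass.
Qed.

HB.instance Definition _ :=
  Lmodule_isNormed.Build R X ler_normD normrZ normr0_eq0.

Lemma Lspace_normE (u : X) : `|u| = fine 'N[mu]_p[EFin \o u]%E.
Proof. by []. Qed.

End normed_Lspace.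

Notation Rd R d := (d.-tuple (measurableTypeR R)).

Definition lebesgue_Rd (R : realType) (d : nat) :
    {sigma_finite_measure set (Rd R d) -> \bar R} :=
  iter_measure (lebesgue_measure : {sigma_finite_measure set _ -> \bar R}) d.

Definition lebesgue_Rdn (R : realType) (d n : nat) :
    {sigma_finite_measure set (n.-tuple (Rd R d)) -> \bar R} :=
  iter_measure (lebesgue_Rd R d) n.

(* For n = 0 the underlying measure is the Dirac mass on the one-point space
   (R^d)^0, so that Xn R d 0 is the space of constants R. *)
Notation Xn R d n := (LspaceType1 (lebesgue_Rdn R d n)).

Section symmetric.
Context (R : realType) (d n : nat).

Definition symmetric_fun (f : n.-tuple (Rd R d) -> R) :=
  forall (s : 'S_n) x, f [tuple tnth x (s i) | i < n] = f x.

(* u is the a.e.-class of a symmetric function. *)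
Definition symmetric_class (u : Xn R d n) :=
  exists2 f : LfunType (lebesgue_Rdn R d n) (lexx 1%E),
    symmetric_fun f & u = Lclass f.

End symmetric.

(* Gamma_0: the finite subsets of R^d. *)
Definition conf (R : realType) (d : nat) : Type := {fset Rd R d}.

HB.instance Definition _ R d := Choice.on (conf R d).
HB.instance Definition _ R d := isPointed.Build (conf R d) fset0.

Definition offdiag (R : realType) (d n : nat) : set (n.-tuple (Rd R d)) :=
  [set x | uniq x].

Definition to_conf (R : realType) (d n : nat) (x : n.-tuple (Rd R d)) :
  conf R d := [fset y in tval x]%fset.

Lemma measurable_offdiag (R : realType) (d n : nat) :
  measurable (@offdiag R d n).
Proof.
rewrite (_ : @offdiag R d n = \bigcap_(ij in [set ij : 'I_n * 'I_n | ij.1 != ij.2])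
   \bigcup_(k in [set: 'I_d]) [set x : n.-tuple (Rd R d) |
      tnth (tnth x ij.1) k != tnth (tnth x ij.2) k :> R]).
  apply: fin_bigcap_measurable; first exact: finite_finset.
  move=> [i j] /= _; apply: fin_bigcup_measurable; first exact: finite_finset.
  move=> k _.
  have mk l : measurable_fun setT
      (fun x : n.-tuple (Rd R d) => tnth (tnth x l) k : R).
    have mT : measurable_fun setT
        ((fun y : Rd R d => tnth y k) \o
         (fun x : n.-tuple (Rd R d) => tnth x l)).
      by apply: measurableT_comp; exact: measurable_tnth.
    exact: mT.
  have /(_ measurableT [set false]) := measurable_fun_eqr (mk i) (mk j).
  rewrite setTI => /(_ I); congr measurable.
  by apply/seteqP; split=> x /= => [->//|/negbTE].
apply/seteqP; split=> x /=.
- move=> /tuple_uniqP ux [i j] /= ij; apply: contrapT => nk.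
  move/eqP: ij; apply; apply: ux; apply: eq_from_tnth => k.
  by apply: contrapT => /eqP xk; apply: nk; exists k.
- move=> xP; apply/tuple_uniqP => i j xij; apply/eqP/negPn/negP => ij.
  by have [k _ /=] := xP (i, j) ij; rewrite xij eqxx.
Qed.

Section measurable_conf.
Context (R : realType) (d : nat).

(* The disjoint union over n of the quotient sigma-algebras on the n-point
   configurations. *)
Definition conf_measurable : set (set (conf R d)) :=
  [set A | forall n, measurable (@offdiag R d n `&` @to_conf R d n @^-1` A)].

Let conf_measurable0 : conf_measurable set0.
Proof. by move=> n; rewrite preimage_set0 setI0. Qed.

Let conf_measurableC A : conf_measurable A -> conf_measurable (~` A).
Proof.
move=> mA n.
rewrite (_ : _ `&` _ = @offdiag R d n `\`
    (@offdiag R d n `&` @to_conf R d n @^-1` A)).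
  by apply: measurableD; [exact: measurable_offdiag|exact: mA].
by apply/seteqP; split=> x /= [ux]; [move=> nA; split=> // -[]|
  move=> /not_andP[]].
Qed.

Let conf_bigcup (F : (set (conf R d))^nat) :
  (forall i, conf_measurable (F i)) -> conf_measurable (\bigcup_i F i).
Proof.
move=> mF n; rewrite preimage_bigcup setI_bigcupr.
by apply: bigcup_measurable => i _; exact: mF.
Qed.

HB.instance Definition _ := @isMeasurable.Build default_measure_display
  (conf R d) conf_measurable conf_measurable0 conf_measurableC conf_bigcup.

End measurable_conf.

Section lebesgue_poisson.
Context (R : realType) (d : nat).
Local Open Scope ereal_scope.

Section npoint.
Variable n : nat.

(* Image of the restriction of Lebesgue measure to the off-diagonal part. *)
Definition conf_measure (A : set (conf R d)) : \bar R :=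
  lebesgue_Rdn R d n (@offdiag R d n `&` @to_conf R d n @^-1` A).

Let conf_measure0 : conf_measure set0 = 0.
Proof. by rewrite /conf_measure preimage_set0 setI0 measure0. Qed.

Let conf_measure_ge0 A : 0 <= conf_measure A.
Proof. exact: measure_ge0. Qed.

Let conf_measure_sigma_additive : semi_sigma_additive conf_measure.
Proof.
move=> F mF tF mUF; rewrite /conf_measure preimage_bigcup setI_bigcupr.
apply: measure_semi_sigma_additive.
- by move=> i; exact: mF.
- apply/trivIsetP => i j _ _ ij; rewrite -subset0 => x [[_ Fix] [_ Fjx]].
  move/trivIsetP : tF => /(_ i j I I ij) Fij.
  by have : set0 (to_conf x) by rewrite -Fij; split.
- by apply: bigcup_measurable => i _; exact: mF.
Qed.

HB.instance Definition _ := isMeasure.Build _ _ _ conf_measure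
  conf_measure0 conf_measure_ge0 conf_measure_sigma_additive.

End npoint.

Definition lebesgue_poisson : {measure set (conf R d) -> \bar R} :=
  mseries (fun n => mscale ((n`!%:R : R)^-1)%:nng%R (conf_measure n)) 0.

End lebesgue_poisson.

Section functions_on_conf.
Context (R : realType) (d : nat).
Implicit Types (G k H : conf R d -> R) (C : R).

(* The symmetric function G^(n), extended by 0 to the (null) diagonals. *)
Definition component G n : n.-tuple (Rd R d) -> R :=
  (G \o @to_conf R d n) \_ (@offdiag R d n).
Arguments component G n : clear implicits.

(* The class is 0 when G^(n) is not integrable, which does not happen for G in
   Bbs. *)
Definition component_class G n : Xn R d n :=
  if insub (component G n) is Some f then Lclass f else 0.

(* H is a function on Gamma_0 whose n-th component is (a.e.) u n. Since elements
   of L^1 are classes, H is determined by u up to a Lebesgue-Poisson null set. *)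
Definition has_components (u : forall n, Xn R d n) H :=
  measurable_fun setT H /\
  forall n, ae_eq (lebesgue_Rdn R d n) (@offdiag R d n)
              (H \o @to_conf R d n) (u n).

(* A choice of such a function; it exists for symmetric u, see
   of_componentsP. *)
Definition of_components (u : forall n, Xn R d n) : conf R d -> R :=
  xget (cst 0) [set H | has_components u H].

Lemma size_to_conf n (x : n.-tuple (Rd R d)) : offdiag x ->
  perm_eq (to_conf x) x.
Proof.
move=> ux; apply: uniq_perm => //.
by move=> y; rewrite !inE.
Qed.

Lemma of_componentsP (u : forall n, Xn R d n) :
  (forall n, symmetric_class (u n)) -> has_components u (of_components u).
Proof.
move=> su; suff [H uH] : exists H, has_components u H by apply: xgetPex; exists H.
pose f n := s2val (cid2 (su n)).
have fs n : symmetric_fun (f n) := s2valP (cid2 (su n)).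
have fu n : u n = Lclass (f n) := s2valP' (cid2 (su n)).
pose g n (s : seq (Rd R d)) : R :=
  if insub s is Some t then f n t else 0.
pose H (eta : conf R d) : R := g #|` eta| (enum_fset eta).
have HE n x : @offdiag R d n x -> H (to_conf x) = f n x.
  move=> /size_to_conf px; rewrite /H /g (perm_size px) size_tuple.
  have szx : size (enum_fset (to_conf x)) == n by rewrite (perm_size px) size_tuple.
  rewrite insubT; case/tuple_permP: px => s xs.
  by rewrite -(fs n s x); congr (f n _); exact/val_inj.
exists H; split.
- move=> _ A mA; rewrite setTI.
  suff : conf_measurable (H @^-1` A) by [].
  move=> n.
  rewrite (_ : _ `&` _ = @offdiag R d n `&` f n @^-1` A).
    apply: measurableI; first exact: measurable_offdiag.
    by rewrite -[X in measurable X]setTI; exact: (@measurable_funPT _ _ _ _ (f n)).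
  by apply/seteqP; split=> x /= [ux]; rewrite HE.
- move=> n; rewrite fu; apply: filterS (LclassE (f n)) => x /(_ I) -> ux.
  by rewrite /= HE.
Qed.

End functions_on_conf.
Arguments component {R d} G n.
Arguments component_class {R d} G n.

Section function_spaces.
Context (R : realType) (d : nat).
Implicit Types (G k : conf R d -> R) (C : R).

Definition weighted_L1 C : {pred conf R d -> R} :=
  [pred G | (fun eta => G eta * C ^+ #|` eta|) \in Lfun (lebesgue_poisson R d) 1].

Definition weighted_Linfty C : {pred conf R d -> R} :=
  [pred k | (fun eta => k eta * C ^- #|` eta|) \in Lfun (lebesgue_poisson R d) +oo].

Definition weighted_Linfty_norm C k : \bar R :=
  'N[lebesgue_poisson R d]_+oo[EFin \o (fun eta => (k eta * C ^- #|` eta|)%R)]%E.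

Definition pairing G k : R := \int[lebesgue_poisson R d]_eta (G eta * k eta).

Definition bounded_Rd (Lambda : set (Rd R d)) :=
  exists M : R, forall x, Lambda x -> forall i, `|tnth x i : R| <= M.

Definition Bbs G :=
  [/\ measurable_fun setT G,
      exists M : R, forall eta, `|G eta| <= M &
      exists N (Lambda : set (Rd R d)),
        [/\ measurable Lambda, bounded_Rd Lambda &
            forall eta, ~ ((#|` eta| <= N)%N /\
                           forall x, x \in eta -> Lambda x) -> G eta = 0]].

End function_spaces.

Section semigroups.
Context (R : realType) (V : normedModType R).

(* Strongly continuous contraction semigroup; only S t for 0 <= t matters. *)
Record contraction_semigroup (S : R -> V -> V) : Prop := {
  semigroup_linear : forall t, 0 <= t -> linear (S t) ;
  semigroup0 : forall u, S 0 u = u ;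
  semigroupD : forall s t u, 0 <= s -> 0 <= t -> S (s + t) u = S s (S t u) ;
  semigroup_continuous : forall u, S t u @[t --> 0^'+] --> u ;
  semigroup_contraction : forall t u, 0 <= t -> `|S t u| <= `|u| }.

(* An everywhere defined generator. *)
Definition generates (L : V -> V) (S : R -> V -> V) :=
  forall u, h^-1 *: (S h u - u) @[h --> 0^'+] --> L u.

Definition contraction_generator (L : V -> V) :=
  exists2 S, contraction_semigroup S & generates L S.

End semigroups.

Definition operator_norm (R : realType) (V W : normedModType R) (f : V -> W) :=
  ereal_sup [set `|f u|%:E | u in [set u | `|u| <= 1]].

(* L n and W n are the operators L_0^(n) on X_n and W^(n) : X_(n-1) -> X_n; only
   n >= 1 matters. *)
Section operators.
Context (R : realType) (d : nat).
Variables (L : forall n, Xn R d n -> Xn R d n)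
          (W : forall n, Xn R d n.-1 -> Xn R d n).

Definition opL0 (G : conf R d -> R) : conf R d -> R :=
  of_components (fun n => match n return Xn R d n with
    | 0 => 0
    | m.+1 => L (component_class G m.+1)
    end).

Definition opW (G : conf R d -> R) : conf R d -> R :=
  of_components (fun n => match n return Xn R d n with
    | m.+2 => W (n := m.+2) (component_class G m.+1)
    | _ => 0
    end).

End operators.

(* Main.v *)
(** On a state [y = (y_n)] let [D = e L_0 + W], i.e.
    [(D y)_n = e L_n y_n + W_n y_(n-1)]. Since [D] is triangular with bounded
    entries, each [t |-> phi_n ((exp (t D) y)_n)], with [phi_n] a bounded
    functional on [X_n], is an entire power series, so that neither completeness
    of [X_n] nor vector-valued integrals are needed. Dissipativity of [L_n]
    gives [|1 + h e L_n| <= 1 + O(h^2)]; hence, for the weighted norms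
    [|y|_C = sum C^n / n! |y_n|], one Euler step satisfies
    [|(1 + h D) y|_C <= (1 + O(h^2)) |y|_(C (1 + h B C))], and iterating this
    [N] times with [h = t / N] and [N -> oo] yields
    [|exp (t D) y|_C0 <= |y|_(C_t)]. Therefore [G |-> <<exp (t D) G, k_0>>] is
    a bounded functional on [L_(C_t)], represented by [k_t] through the duality
    of L^1 and L^oo. Starting from a base larger than [C_0] makes all series
    over [n] geometric, uniformly in [t] and [e], which gives the derivative in
    [t] and the limit [e -> 0] term by term. *)

Require Import Defs.
From HB Require Import structures.
From mathcomp Require Import all_boot all_order all_algebra perm finmap.
From mathcomp Require Import all_classical all_reals all_analysis.
From mathcomp Require Import measurable_realfun ess_sup_inf ring lra.

Set Implicit Arguments.
Unset Strict Implicit.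
Unset Printing Implicit Defensive.
Import Order.TTheory GRing.Theory Num.Theory.
Import numFieldNormedType.Exports HBSimple.
Local Open Scope classical_set_scope.
Local Open Scope ring_scope.

(** The bounds on $L_n$ grow with $n$, so the $O(h^2)$ lost in an Euler step is not uniform over all
    components. Hence the weighted norms are cut off at a level $M$: the system being triangular,
    the components below $M$ evolve among themselves; for fixed $M$ the accumulated factor
    $(1+O(h^2))^N$ tends to 1, and the bound that remains holds for every $M$ with the same
    constant.

    The change of base is due to $W$ alone. Shifting the weight $C^{n+1}/(n+1)!$ down one level
    cancels the factor $n+1$ of $B(n+1)n$; the remaining factor $n$ is that of $C\,\partial_C C^n =
    nC^n$, so $W$ acts as a small increase of $C$. The map $C \mapsto C(1+hBC)$ is the Euler step of
    $C' = BC^2$, whose solution from $C_0$ is $C_t$ and blows up at $T$; both constants come from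
    there. *)

Section dominated_series.
Context (R : realType).
Implicit Types u v : R^nat.

(** * Series with a summable majorant or with bounded absolute partial sums *)

Lemma dominated_is_cvg_series u v :
  (forall n, `|u n| <= v n) -> cvgn (series v) -> cvgn (series u).
Proof.
move=> uv cv; apply: normed_cvg; apply: (@series_le_cvg _ _ v) => //= n.
by rewrite (le_trans _ (uv n)).
Qed.

Lemma dominated_lim_series u v :
  (forall n, `|u n| <= v n) -> cvgn (series v) ->
  `|limn (series u)| <= limn (series v).
Proof.
move=> uv cv; have cnu : cvgn [normed series u].
  by apply: (@series_le_cvg _ _ v) => //= n; rewrite (le_trans _ (uv n)).
by apply: (le_trans (lim_series_norm cnu)); exact: lim_series_le.
Qed.

Lemma bounded_is_cvg_series u (M : R) :
  (forall N, \sum_(n < N) `|u n| <= M) -> cvgn (series u).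
Proof.
move=> uM; apply: normed_cvg; apply: nondecreasing_is_cvgn.
  by apply: nondecreasing_series => n _; rewrite normr_ge0.
by exists M => _ [N _ <-]; rewrite /= /series/= big_mkord.
Qed.

Lemma bounded_lim_series u (M : R) :
  (forall N, \sum_(n < N) `|u n| <= M) -> `|limn (series u)| <= M.
Proof.
move=> uM; have cu := bounded_is_cvg_series uM.
have cnu : cvgn (fun n => `|series u n|) by exact: is_cvg_norm.
rewrite -lim_norm//; apply: limr_le => //; apply: nearW => N.
by rewrite (le_trans _ (uM N))// seriesEord ler_norm_sum.
Qed.

End dominated_series.

(** * Euler's limit $(1 + t/N)^N \to e^t$ for exponential series with geometrically bounded
    coefficients *)

Section exp_limit.
Context (R : realType).

(** The ratio of the coefficient of $x^j$ in $(1 + x/N)^N$ to its limit $1/j!$. *)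
Definition euler_coef N j : R := (N ^_ j)%:R / N%:R ^+ j.

Lemma euler_coef0 N : euler_coef N 0 = 1.
Proof. by rewrite /euler_coef ffactn0 expr0 divr1. Qed.

Lemma euler_coefS N j : (0 < N)%N ->
  euler_coef N j.+1 = euler_coef N j * ((N - j)%:R / N%:R).
Proof. by move=> N0; rewrite /euler_coef ffactnSr natrM exprSr invfM mulrACA. Qed.

Lemma euler_coef_ge0 N j : 0 <= euler_coef N j.
Proof. by rewrite divr_ge0// exprn_ge0. Qed.

Lemma euler_coef_le1 N j : (0 < N)%N -> euler_coef N j <= 1.
Proof.
move=> N0; elim: j => [|j IH]; first by rewrite euler_coef0.
rewrite euler_coefS// -[leRHS]mulr1 ler_pM// ?euler_coef_ge0// ?divr_ge0//.
by rewrite ler_pdivrMr ?ltr0n// mul1r ler_nat leq_subr.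
Qed.

Lemma euler_coef_ge N j : (0 < N)%N ->
  1 - j%:R ^+ 2 / N%:R <= euler_coef N j.
Proof.
move=> N0; have N0' : 0 < N%:R :> R by rewrite ltr0n.
elim: j => [|j IH]; first by rewrite euler_coef0 expr0n/= mul0r subr0.
rewrite euler_coefS//.
(* The natural subtraction is truncated: for [j > N] the right side is 0 and the left side is
   negative. *)
have h : 1 - j%:R / N%:R <= (N - j)%:R / N%:R :> R.
  case: (leqP j N) => jN; first by rewrite natrB// mulrBl divff// gt_eqF.
  rewrite (@le_trans _ _ 0) ?divr_ge0// subr_le0 ler_pdivlMr// mul1r ler_nat.
  exact: ltnW.
have e1 := euler_coef_le1 j N0; have e0 := euler_coef_ge0 N j.
have k0 : 0 <= j%:R / N%:R :> R by rewrite divr_ge0.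
have n0 : 0 <= N%:R^-1 :> R by rewrite invr_ge0.
have -> : 1 - j.+1%:R ^+ 2 / N%:R = 1 - j%:R ^+ 2 / N%:R - j%:R / N%:R
    - (j%:R / N%:R + N%:R^-1) :> R.
  by rewrite -natr1; field; rewrite gt_eqF.
nra.
Qed.

Variables (g : R^nat) (K c t : R).
Hypotheses (K0 : 0 <= K) (c0 : 0 <= c)
  (gc : forall j, `|g j| <= K * c ^+ j).

Lemma exp_term_le j :
  `|g j / j`!%:R * t ^+ j| <= K * exp_coeff (c * `|t|) j.
Proof.
rewrite /exp_coeff/= !normrM normfV normr_nat normrX.
rewrite exprMn mulrAC mulrA.
by rewrite ler_wpM2r// ?invr_ge0// mulrA ler_wpM2r// exprn_ge0.
Qed.

Lemma is_cvg_series_expM x (L : R) : cvgn (series (fun j => L * exp_coeff x j)).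
Proof. exact: (@is_cvg_seriesZ _ _ L (is_cvg_series_exp_coeff x)). Qed.

Lemma is_cvg_exp_series : cvgn (series (fun j => g j / j`!%:R * t ^+ j)).
Proof. by apply: dominated_is_cvg_series exp_term_le _; exact: is_cvg_series_expM. Qed.

(** Since $j < 2^j$, the factor $j^2$ lost in [euler_coef_ge] only multiplies the argument of the
    exponential by 4. *)
Lemma exp_coeff_sq (x : R) j : 0 <= x -> j%:R ^+ 2 * exp_coeff x j <= exp_coeff (4 * x) j.
Proof.
move=> x0; rewrite /exp_coeff/= exprMn [leLHS]mulrA ler_wpM2r ?invr_ge0//.
rewrite ler_wpM2r ?exprn_ge0// (_ : 4 = 2 ^+ 2 :> R); last by rewrite -natrX.
rewrite -exprM mulnC exprM lerXn2r ?nnegrE ?exprn_ge0//.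
by rewrite -natrX ler_nat ltnW// ltn_expl.
Qed.

(* Tannery's theorem, with rate [euler_coef_ge]. *)
Lemma euler_cvg :
  (fun N => \sum_(j < N.+2) 'C(N.+1, j)%:R * (t / N.+1%:R) ^+ j * g j) @ \oo -->
  limn (series (fun j => g j / j`!%:R * t ^+ j)).
Proof.
pose u j := g j / j`!%:R * t ^+ j; rewrite -/u.
pose E : R := limn (series (fun j => K * exp_coeff (4 * (c * `|t|)) j)).
have ct0 : 0 <= c * `|t| by rewrite mulr_ge0.
have key N : `|\sum_(j < N.+2) 'C(N.+1, j)%:R * (t / N.+1%:R) ^+ j * g j
    - limn (series u)| <= harmonic N * E.
  pose v j : R := euler_coef N.+1 j * u j.
  have vE j : v j = 'C(N.+1, j)%:R * (t / N.+1%:R) ^+ j * g j.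
    rewrite /v /u /euler_coef -bin_ffact natrM exprMn exprVn.
    by field; rewrite !pnatr_eq0 -lt0n fact_gt0 expf_neq0//= addr_eq0.
  have dv j : `|v j - u j| <= harmonic N * (K * exp_coeff (4 * (c * `|t|)) j).
    have e1 := euler_coef_le1 j (ltn0Sn N).
    have a1 : `|v j - u j| <= (1 - euler_coef N.+1 j) * (K * exp_coeff (c * `|t|) j).
      have -> : v j - u j = - ((1 - euler_coef N.+1 j) * u j).
        by rewrite /v mulrBl mul1r opprB.
      rewrite normrN normrM (ger0_norm (x := 1 - _)) ?subr_ge0//.
      by rewrite ler_wpM2l ?subr_ge0//; exact: exp_term_le.
    have a2 : 1 - euler_coef N.+1 j <= j%:R ^+ 2 / N.+1%:R.
      by rewrite lerBlDr -lerBlDl euler_coef_ge.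
    have a3 : 0 <= K * exp_coeff (c * `|t|) j by rewrite mulr_ge0// exp_coeff_ge0.
    have := ler_wpM2r a3 a2; move/(le_trans a1)/le_trans; apply.
    rewrite mulrAC mulrC ler_wpM2l ?invr_ge0// mulrCA ler_wpM2l//.
    exact: exp_coeff_sq.
  have cE := @is_cvg_series_expM (4 * (c * `|t|)) K.
  have cvu : cvgn (series (v \- u)).
    exact: dominated_is_cvg_series dv (@is_cvg_seriesZ _ _ (harmonic N) cE).
  have cu : cvgn (series u) := is_cvg_exp_series.
  have cv : cvgn (series v).
    have -> : v = (v \- u) + u by apply/funext => j; rewrite /= !fctE subrK.
    exact: is_cvg_seriesD.
  (* The binomial coefficients vanish beyond [N.+1], so the finite sum is the whole series of
     [v]. *)
  have -> : \sum_(j < N.+2) 'C(N.+1, j)%:R * (t / N.+1%:R) ^+ j * g j =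
      limn (series v).
    apply/esym/cvg_lim => //; apply: cvg_near_cst.
    exists N.+2 => //= n /= Nn.
    rewrite /series/= (big_cat_nat (n := N.+2))//= big_mkord [X in _ + X]big1_seq.
      by rewrite addr0; apply: eq_bigr => j _; rewrite vE.
    move=> j; rewrite mem_index_iota => /andP[_ /andP[Nj _]].
    by rewrite vE bin_small// !mul0r.
  have := dominated_lim_series dv (@is_cvg_seriesZ _ _ (harmonic N) cE).
  by rewrite (lim_seriesZ _ cE) lim_seriesB.
apply/cvgrPdist_le => e e0.
have /cvgrPdist_le/(_ e e0) : (fun N => harmonic N * E) @ \oo --> (0 : R).
  by rewrite -[0](mul0r E); apply: cvgM; [exact: cvg_harmonic|exact: cvg_cst].
apply: filterS => N; rewrite sub0r normrN => h.
by rewrite distrC; apply: le_trans (key N) _; exact: le_trans (ler_norm _) h.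
Qed.

End exp_limit.

(** * The triangular generator and its Euler steps in weighted norms *)

Section hierarchy.
Context (R : realType) (X : nat -> normedModType R)
  (l : forall n, {linear X n -> X n}) (w : forall n, {linear X n -> X n.+1}).
Implicit Types (y z : forall n, X n) (e h t C : R) (m n j M N : nat).

Definition hgen e y : forall n, X n := fun n =>
  match n return X n with
  | 0 => e *: l 0%N (y 0%N)
  | m.+1 => e *: l m.+1 (y m.+1) + w m (y m)
  end.

Definition hstep e h y : forall n, X n := fun n => h *: hgen e y n + y n.

Lemma hgenP e (k : R) y z :
  hgen e (fun n => k *: y n + z n) = fun n => k *: hgen e y n + hgen e z n.
Proof.
apply: functional_extensionality_dep => -[|n] /=.
  by rewrite linearP scalerDr !scalerA mulrC.
rewrite (linearP (l n.+1)) (linearP (w n)) !scalerDr !scalerA mulrC -!addrA.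
congr (_ + _).
by rewrite addrCA.
Qed.

Lemma iter_hgenP e j (k : R) y z :
  iter j (hgen e) (fun n => k *: y n + z n) =
  fun n => k *: iter j (hgen e) y n + iter j (hgen e) z n.
Proof. by elim: j => // j IH; rewrite iterS IH hgenP. Qed.

(** Pascal's rule, after peeling off the innermost step, where linearity of the powers of [hgen e]
    applies. *)
Lemma iter_hstep e h N y n : iter N (hstep e h) y n =
  \sum_(j < N.+1) ('C(N, j)%:R * h ^+ j) *: iter j (hgen e) y n.
Proof.
elim: N y => [|N IH] y.
  by rewrite big_ord1/= bin0 expr0 mulr1 scale1r.
rewrite iterSr IH.
under eq_bigr do rewrite iter_hgenP -iterSr scalerDr scalerA.
rewrite big_split/= [RHS]big_ord_recl/= bin0 expr0 mulr1 scale1r.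
under [in RHS]eq_bigr do rewrite binS natrD mulrDl scalerDl.
rewrite big_split/= [RHS]addrA addrC; congr (_ + _).
  rewrite [in LHS]big_ord_recl/= bin0 expr0 mulr1 scale1r; congr (_ + _).
  by rewrite [RHS]big_ord_recr/= bin_small// mul0r scale0r addr0.
by apply: eq_bigr => j _; rewrite exprSr mulrA.
Qed.

Definition wnorm C M y : R := \sum_(m < M) C ^+ m / m`!%:R * `|y m|.

(** Unweighted: it serves for crude bounds on the powers of [hgen], which must be geometric in the
    power but may depend on [M] in any way. *)
Definition nsum M y : R := \sum_(m < M) `|y m|.

Lemma wnorm_ge0 C M y : 0 <= C -> 0 <= wnorm C M y.
Proof. by move=> C0; apply: sumr_ge0 => m _; rewrite !mulr_ge0 ?exprn_ge0 ?invr_ge0. Qed.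

Lemma wnorm_le C C' M y : 0 <= C -> C <= C' -> wnorm C M y <= wnorm C' M y.
Proof.
move=> C0 CC'; apply: ler_sum => m _; rewrite ler_wpM2r// ler_wpM2r ?invr_ge0//.
by rewrite lerXn2r// nnegrE// (le_trans C0).
Qed.

Variables (a : R^nat) (B : R).
Hypotheses (a_ge0 : forall n, 0 <= a n) (a_nd : {homo a : m n / (m <= n)%N >-> m <= n})
  (B_ge0 : 0 <= B)
  (l_le : forall n u, `|l n u| <= a n * `|u|)
  (w_le : forall n u, `|w n u| <= B * n.+1%:R * n%:R * `|u|)
  (l_dissipative : forall n h (u : X n), 0 <= h -> `|u| <= `|u - h *: l n u|).

(** Dissipativity applied to $v = u + hLu$ gives $|v| \le |v - hLv| = |u - h^2L^2u|$: the
    first-order terms cancel. *)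
Lemma dissipative_step n h (u : X n) : 0 <= h ->
  `|h *: l n u + u| <= (1 + (h * a n) ^+ 2) * `|u|.
Proof.
move=> h0; apply: le_trans (l_dissipative _ h0) _.
rewrite linearP scalerDr scalerA opprD addrA addrAC [_ + u]addrC addrK.
apply: le_trans (ler_normB _ _) _; rewrite mulrDl mul1r lerD2l normrZ.
rewrite ger0_norm ?mulr_ge0// exprMn -mulrA [h ^+ 2]expr2.
rewrite -!mulrA ler_wpM2l// ler_wpM2l//; apply: le_trans (l_le _) _.
by rewrite ler_wpM2l.
Qed.

(** The identity $\frac{C^{m+1}}{(m+1)!}\,hB(m+1)m = \frac{C^m}{m!}\,m\,hBC$ turns the contribution
    of [w] into a relative increase $1 + m\,hBC$ of the weight of level $m$, and Bernoulli's
    inequality bounds it by $(1+hBC)^m$. *)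
Lemma wnorm_step e h C M y : 0 <= e -> 0 <= h -> 0 <= C ->
  wnorm C M (hstep e h y) <=
    (1 + (h * e * a M) ^+ 2) * wnorm (C * (1 + h * B * C)) M y.
Proof.
move=> e0 h0 C0; set k := 1 + _.
have he0 : 0 <= h * e by rewrite mulr_ge0.
have k1 : 1 <= k by rewrite lerDl sqr_ge0.
have hBC : 0 <= h * B * C by rewrite !mulr_ge0.
have lk m (u : X m) : (m <= M)%N -> `|(h * e) *: l m u + u| <= k * `|u|.
  move=> mM; apply: le_trans (dissipative_step _ he0) _.
  rewrite ler_wpM2r// lerD2l lerXn2r ?nnegrE ?mulr_ge0//.
  by rewrite ler_wpM2l// a_nd.
have bernoulli m : C ^+ m * (1 + m%:R * (h * B * C)) <= (C * (1 + h * B * C)) ^+ m.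
  rewrite exprMn ler_wpM2l ?exprn_ge0//; elim: m => [|m IH].
    by rewrite mul0r addr0 expr0.
  rewrite exprS; apply: (@le_trans _ _ ((1 + h * B * C) * (1 + m%:R * (h * B * C)))).
    rewrite -natr1; have : 0 <= m%:R * (h * B * C) * (h * B * C) by rewrite !mulr_ge0.
    by nra.
  by rewrite ler_wpM2l// addr_ge0.
suff h1 : wnorm C M (hstep e h y) <= k *
    \sum_(m < M) C ^+ m * (1 + m%:R * (h * B * C)) / m`!%:R * `|y m|.
  apply: (le_trans h1); rewrite ler_wpM2l ?(le_trans ler01)//.
  by apply: ler_sum => m _; rewrite ler_wpM2r// ler_wpM2r// invr_ge0.
have fact0 m : (m`!%:R : R) != 0 by rewrite pnatr_eq0 -lt0n fact_gt0.
pose f m := C ^+ m / m`!%:R * (k * `|y m|).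
(* What [w] adds to level [m.+1], written with the weight of level [m]. *)
pose g m := C ^+ m / m`!%:R * (m%:R * (h * B * C)) * `|y m|.
have g0 m : 0 <= g m by rewrite !mulr_ge0 ?exprn_ge0 ?invr_ge0.
have h2 : wnorm C M (hstep e h y) <= \sum_(m < M) f m + \sum_(m < M.-1) g m.
  rewrite /wnorm; case: (M) lk => [|M'] lk /=; first by rewrite !big_ord0 addr0.
  rewrite 2!big_ord_recl -addrA; apply: lerD.
    rewrite /f ler_wpM2l ?mulr_ge0 ?exprn_ge0 ?invr_ge0// /hstep/= scalerA.
    exact: lk.
  rewrite -big_split/=; apply: ler_sum => m _; rewrite /bump/= add1n.
  have -> : hstep e h y m.+1 = (h * e) *: l m.+1 (y m.+1) + y m.+1 + h *: w m (y m).
    by rewrite /hstep/= scalerDr scalerA addrAC.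
  apply: (@le_trans _ _ (C ^+ m.+1 / m.+1`!%:R *
      (k * `|y m.+1| + h * (B * m.+1%:R * m%:R * `|y m|)))).
    rewrite ler_wpM2l ?mulr_ge0 ?exprn_ge0 ?invr_ge0//.
    apply: le_trans (ler_normD _ _) _; apply: lerD.
      exact: (lk _ _ (leqW (ltn_ord m))).
    by rewrite normrZ ger0_norm// ler_wpM2l//; exact: w_le.
  rewrite mulrDr lerD2l /g factS natrM le_eqVlt; apply/orP; left; apply/eqP.
  rewrite exprSr; field.
  by rewrite fact0 nat1r pnatr_eq0.
apply: (le_trans h2); rewrite mulr_sumr.
have : \sum_(m < M.-1) g m <= \sum_(m < M) g m.
  by case: (M) => //= M'; rewrite [leRHS]big_ord_recr/= lerDl.
move=> /(lerD (lexx (\sum_(m < M) f m)))/le_trans; apply.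
rewrite -big_split/=; apply: ler_sum => m _.
(* Only the diagonal part carries [k]; as [k >= 1], the part from [w] is enlarged to share it. *)
have : g m <= k * g m by rewrite ler_peMl.
move=> /(lerD (lexx (f m)))/le_trans; apply.
rewrite /f /g le_eqVlt; apply/orP; left; apply/eqP; field.
exact: fact0.
Qed.

(** The Euler iterates of $C' = BC^2$ stay below its exact solution $C/(1-sBC)$. With $b = hBC$ and
    $q = jb$ this is $(1+b)(1-q-b) = 1 - q(1+b) - b^2 \le 1 - q(1+b)$. *)
Lemma wnorm_iter e h C M j y : 0 <= e -> 0 <= h -> 0 < C -> j%:R * h * B * C < 1 ->
  wnorm C M (iter j (hstep e h) y) <=
    (1 + (h * e * a M) ^+ 2) ^+ j * wnorm (C / (1 - j%:R * h * B * C)) M y.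
Proof.
move=> e0 h0; elim: j C => [|j IH] C C0 jC.
  by rewrite expr0 mul1r !mul0r subr0 divr1.
have k0 : 0 <= 1 + (h * e * a M) ^+ 2 by rewrite addr_ge0// sqr_ge0.
have hB0 : 0 <= h * B by rewrite mulr_ge0.
have hBC0 : 0 <= h * B * C by rewrite mulr_ge0// ltW.
have D0 : 0 < 1 - j.+1%:R * h * B * C by rewrite subr_gt0.
have jBC0 : 0 <= j%:R * h * B * C by rewrite !mulr_ge0// ltW.
have jS : j.+1%:R * h * B * C = j%:R * h * B * C + h * B * C.
  by rewrite -natr1; ring.
rewrite jS in jC D0 *; set b := h * B * C in jC D0 hBC0 jS *.
set q := j%:R * h * B * C in jC D0 jBC0 jS *.
have C'0 : 0 < C * (1 + b) by rewrite mulr_gt0// ltr_wpDr.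
have qE : j%:R * h * B * (C * (1 + b)) = q * (1 + b) by rewrite /q; ring.
have jC' : q * (1 + b) < 1.
  have h1 : q * (1 + b) < (1 - b) * (1 + b) by rewrite ltr_pM2r; lra.
  by rewrite (lt_le_trans h1)//; nra.
rewrite iterS; apply: le_trans (wnorm_step _ _ e0 h0 (ltW C0)) _.
rewrite [in leRHS]exprS -[leRHS]mulrA ler_wpM2l// -/b.
apply: le_trans (IH _ C'0 _) _; first by rewrite qE.
rewrite ler_wpM2l ?exprn_ge0// qE.
apply: wnorm_le; first by rewrite divr_ge0 ?ltW// subr_gt0.
rewrite ler_pdivrMr ?subr_gt0// mulrAC ler_pdivlMr//.
rewrite -!mulrA ler_pM2l//.
by nra.
Qed.

End hierarchy.

(** * The exponential of the generator, seen through bounded functionals *)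

Section evolution.
Context (R : realType) (X : nat -> normedModType R)
  (l : forall n, {linear X n -> X n}) (w : forall n, {linear X n -> X n.+1}).
Implicit Types (y z : forall n, X n) (e h s t c d C P Q : R) (m n j M N : nat).
Local Notation hgen := (hgen l w).
Local Notation hstep := (hstep l w).
Variables (a : R^nat) (B : R).
Hypotheses (a_ge0 : forall n, 0 <= a n) (a_nd : {homo a : m n / (m <= n)%N >-> m <= n})
  (B_ge0 : 0 <= B)
  (l_le : forall n u, `|l n u| <= a n * `|u|)
  (w_le : forall n u, `|w n u| <= B * n.+1%:R * n%:R * `|u|)
  (l_dissipative : forall n h (u : X n), 0 <= h -> `|u| <= `|u - h *: l n u|).

Definition hbound e M : R := e * a M + B * M.+1%:R * M%:R.

Lemma hbound_ge0 e M : 0 <= e -> 0 <= hbound e M.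
Proof. by move=> e0; rewrite addr_ge0// !mulr_ge0. Qed.

Lemma nsum_ge0 M y : 0 <= nsum M y.
Proof. by apply: sumr_ge0. Qed.

Lemma le_nsum m M y : (m < M)%N -> `|y m| <= nsum M y.
Proof. by move=> mM; rewrite /nsum (bigD1 (Ordinal mM))//= lerDl sumr_ge0. Qed.

(** Triangularity: the entries of [hgen e y] below level [M] involve only entries of [y] below level
    [M], each at most twice, on its own level and on the next one. *)
Lemma nsum_hgen e M y : 0 <= e -> nsum M (hgen e y) <= hbound e M * nsum M y.
Proof.
move=> e0; case: M => [|M]; first by rewrite /nsum !big_ord0 mulr0.
have la m (u : X m) : (m <= M.+1)%N -> `|e *: l m u| <= e * a M.+1 * `|u|.
  move=> mM; rewrite normrZ ger0_norm// -mulrA ler_wpM2l//.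
  by apply: le_trans (l_le _) _; rewrite ler_wpM2r// a_nd.
have wb m (u : X m) : (m <= M)%N -> `|w m u| <= B * M.+2%:R * M.+1%:R * `|u|.
  move=> mM; apply: le_trans (w_le _) _; rewrite ler_wpM2r//.
  by rewrite -!mulrA ler_wpM2l// ler_pM ?ler_nat// leqW.
rewrite mulrDl {1 2}/nsum 2!big_ord_recl/= mulrDr -addrA; apply: lerD.
  exact: la.
apply: (@le_trans _ _ (\sum_(i < M) (e * a M.+1 * `|y i.+1| +
    B * M.+2%:R * M.+1%:R * `|y i|))).
  apply: ler_sum => i _ /=; apply: le_trans (ler_normD _ _) _; apply: lerD.
    by apply: la; rewrite /bump/= leqW.
  by apply: wb; rewrite ltnW.
rewrite big_split/= -!mulr_sumr lerD2l /nsum.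
by rewrite ler_wpM2l ?mulr_ge0// [leRHS]big_ord_recr/= lerDl.
Qed.

Lemma nsum_iter e M j y : 0 <= e ->
  nsum M (iter j (hgen e) y) <= hbound e M ^+ j * nsum M y.
Proof.
move=> e0; elim: j => [|j IH]; first by rewrite expr0 mul1r.
rewrite iterS; apply: le_trans (nsum_hgen _ _ e0) _.
by rewrite exprS -mulrA ler_wpM2l// hbound_ge0.
Qed.

Section functional.
(** The bounds on [phi] are those satisfied by the pairing with a function of norm [K] in
    $\mathcal{K}_{C_0}$, restricted to level $m$. *)
Variables (C0 K : R) (phi : forall m, {scalar X m}).
Hypotheses (C0_gt0 : 0 < C0) (K_ge0 : 0 <= K)
  (phi_le : forall m (u : X m), `|phi m u| <= K * (C0 ^+ m / m`!%:R) * `|u|).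

Definition ecoef e m y j : R := phi m (iter j (hgen e) y m) / j`!%:R.

(* The component [m] of [exp (t (e L0 + W)) y], paired with [phi m]. *)
Definition evo e m t y : R := limn (pseries (ecoef e m y) t).

Let phiK m := K * (C0 ^+ m / m`!%:R).

Let phiK_ge0 m : 0 <= phiK m.
Proof. by rewrite !mulr_ge0 ?exprn_ge0 ?invr_ge0// ltW. Qed.

(** Growth at most geometric in [j]: this is what makes the power series of [evo] entire. *)
Lemma phi_iter_le e m y j : 0 <= e -> `|phi m (iter j (hgen e) y m)| <=
  phiK m * nsum m.+1 y * hbound e m.+1 ^+ j.
Proof.
move=> e0; apply: le_trans (phi_le _) _; rewrite -[leRHS]mulrA ler_wpM2l ?phiK_ge0//.
by apply: le_trans (le_nsum (iter j (hgen e) y) (ltnSn m)) _; rewrite mulrC; exact: nsum_iter.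
Qed.

Lemma is_cvg_evo e m t y : 0 <= e -> cvgn (pseries (ecoef e m y) t).
Proof.
move=> e0; exact: is_cvg_exp_series (fun j => phi_iter_le m y j e0).
Qed.

Lemma evo0 e m y : evo e m 0 y = phi m (y m).
Proof.
apply/cvg_lim => //; apply: cvg_near_cst; exists 1%N => //= -[//|n] _.
rewrite /pseries/series/= big_nat_recl//= big1 => [|i _].
  by rewrite /ecoef/= fact0 expr0 addr0 divr1 mulr1.
by rewrite exprS mul0r mulr0.
Qed.

Lemma evoP e m t k y z : 0 <= e ->
  evo e m t (fun n => k *: y n + z n) = k * evo e m t y + evo e m t z.
Proof.
move=> e0; have cy := @is_cvg_evo e m t y e0; have cz := @is_cvg_evo e m t z e0.
rewrite /evo -[k * _](lim_seriesZ _ cy) -lim_seriesD//; last exact: is_cvg_seriesZ.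
congr (limn (series _)); apply/funext => j /=.
rewrite !fctE /ecoef iter_hgenP linearP/= /GRing.scale/=; ring.
Qed.

(** Termwise differentiation shifts the coefficients, and the coefficients of [hgen e y] are exactly
    the shifted ones. *)
Lemma evo_is_derive e m t y : 0 <= e ->
  is_derive t 1 (fun s => evo e m s y) (evo e m t (hgen e y)).
Proof.
move=> e0.
have dE z : pseries_diffs (ecoef e m z) = ecoef e m (hgen e z).
  apply/funext => j; rewrite /pseries_diffs /ecoef -iterSr factS natrM.
  by field; rewrite nat1r !pnatr_eq0 -lt0n fact_gt0.
rewrite /evo -dE; apply: (@pseries_snd_diffs _ _ (`|t| + 1)).
- exact: is_cvg_evo.
- by rewrite dE; exact: is_cvg_evo.
- by rewrite !dE; exact: is_cvg_evo.
- by rewrite [ltRHS]ger0_norm ?ltrDl// addr_ge0.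
Qed.

Lemma euler_cvg_evo e m t y : 0 <= e ->
  (fun N => phi m (iter N.+1 (hstep e (t / N.+1%:R)) y m)) @ \oo --> evo e m t y.
Proof.
move=> e0; apply: cvg_trans (euler_cvg (t := t) _ _ (fun j => phi_iter_le m y j e0)); last 2 first.
- by rewrite mulr_ge0// nsum_ge0.
- exact: hbound_ge0.
apply: near_eq_cvg; apply: nearW => N.
rewrite iter_hstep linear_sum/=; apply: eq_bigr => j _.
by rewrite linearZ.
Qed.

(** Limit of [wnorm_iter] along $h = t/N$. The base [C] is free, and the weights $(C/C_0)^m$
    compensate for the bounds on [phi]: the choice $C = C_0$ gives boundedness, a larger [C] gives
    geometric decay in $m$. *)
Lemma evo_sum_le e t C M y : 0 <= e -> 0 <= t -> 0 < C -> B * C * t < 1 ->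
  \sum_(m < M) (C / C0) ^+ m * `|evo e m t y| <=
    K * wnorm (C / (1 - B * C * t)) M y.
Proof.
move=> e0 t0 C_gt0 BCt.
set D := C / (1 - _).
have D0 : 0 <= D by rewrite divr_ge0 ?ltW// subr_gt0.
pose z N := iter N.+1 (hstep e (t / N.+1%:R)) y.
have lhs : (fun N => \sum_(m < M) (C / C0) ^+ m * `|phi m (z N m)|) @ \oo -->
    \sum_(m < M) (C / C0) ^+ m * `|evo e m t y|.
  apply: cvg_big => [|m _]; first exact: add_continuous.
  by apply: cvgM; [exact: cvg_cst|apply: cvg_norm; exact: euler_cvg_evo].
(* The accumulated factor $(1 + (x/N)^2)^N$ is at most $\exp(x^2/N)$, which tends to 1 since [M] is
   fixed. *)
have rhs : (fun N => K * (expR ((t * e * a M) ^+ 2 * harmonic N) * wnorm D M y)) @ \oo -->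
    K * wnorm D M y.
  rewrite -[wnorm D M y in X in _ --> X]mul1r -(@expR0 R); apply: cvgM; first exact: cvg_cst.
  apply: cvgM; last exact: cvg_cst.
  apply: (@cvg_comp _ _ _ (fun N => (t * e * a M) ^+ 2 * harmonic N) expR _ (nbhs (0 : R))); last exact: continuous_expR.
  rewrite -[0](mulr0 ((t * e * a M) ^+ 2)); apply: cvgM; first exact: cvg_cst.
  exact: cvg_harmonic.
apply: (ler_cvg_to lhs rhs); apply: nearW => N.
have tE : N.+1%:R * (t / N.+1%:R) * B * C = B * C * t by field; rewrite nat1r.
have h0 : 0 <= t / N.+1%:R by rewrite divr_ge0.
apply: (@le_trans _ _ (K * wnorm C M (z N))).
  rewrite mulr_sumr; apply: ler_sum => m _.
  apply: le_trans (ler_wpM2l _ (phi_le _)) _; first by rewrite exprn_ge0// divr_ge0// ltW.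
  rewrite le_eqVlt; apply/orP; left; apply/eqP; rewrite exprMn exprVn; field.
  by rewrite pnatr_eq0 -lt0n fact_gt0 expf_neq0// gt_eqF.
rewrite ler_wpM2l//.
have := @wnorm_iter R X l w a B a_ge0 a_nd B_ge0 l_le w_le l_dissipative
  e _ C M N.+1 y e0 h0 C_gt0.
rewrite tE => /(_ BCt) /le_trans; apply; rewrite ler_wpM2r ?wnorm_ge0//.
have -> : (t * e * a M) ^+ 2 * harmonic N = N.+1%:R * (t / N.+1%:R * e * a M) ^+ 2.
  by rewrite /harmonic/=; field; rewrite nat1r.
by rewrite expRM_natl lerXn2r ?nnegrE ?addr_ge0 ?sqr_ge0 ?expR_ge0// expR_ge1Dx.
Qed.

(** Stands for $|y|_C \le P$ with the full sum over the levels, its convergence included. *)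
Definition wbound C y P := forall M, wnorm C M y <= P.

Lemma wbound_ge0 C y P : wbound C y P -> 0 <= P.
Proof. by move/(_ 0%N); rewrite /wnorm big_ord0. Qed.

(** When [phi] is the pairing with $k_0$, this is $\langle\!\langle e^{tD}y,
    k_0\rangle\!\rangle$. *)
Definition evolution e t y : R := limn (series (fun m => evo e m t y)).

Lemma evo_bounded e t y P : 0 <= e -> 0 <= t -> B * C0 * t < 1 ->
  wbound (C0 / (1 - B * C0 * t)) y P ->
  forall N, \sum_(m < N) `|evo e m t y| <= K * P.
Proof.
move=> e0 t0 BCt yP N; have := evo_sum_le N y e0 t0 C0_gt0 BCt.
under eq_bigr do rewrite divff ?gt_eqF// expr1n mul1r.
by move/le_trans; apply; rewrite ler_wpM2l.
Qed.

Lemma is_cvg_evolution e t y P : 0 <= e -> 0 <= t -> B * C0 * t < 1 ->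
  wbound (C0 / (1 - B * C0 * t)) y P -> cvgn (series (fun m => evo e m t y)).
Proof. by move=> e0 t0 BCt yP; exact: bounded_is_cvg_series (evo_bounded e0 t0 BCt yP). Qed.

Lemma evolution_le e t y P : 0 <= e -> 0 <= t -> B * C0 * t < 1 ->
  wbound (C0 / (1 - B * C0 * t)) y P -> `|evolution e t y| <= K * P.
Proof. by move=> e0 t0 BCt yP; exact: bounded_lim_series (evo_bounded e0 t0 BCt yP). Qed.

Lemma evolutionP e t k y z P Q : 0 <= e -> 0 <= t -> B * C0 * t < 1 ->
  wbound (C0 / (1 - B * C0 * t)) y P -> wbound (C0 / (1 - B * C0 * t)) z Q ->
  evolution e t (fun n => k *: y n + z n) = k * evolution e t y + evolution e t z.
Proof.
move=> e0 t0 BCt yP zQ.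
have cy := is_cvg_evolution e0 t0 BCt yP; have cz := is_cvg_evolution e0 t0 BCt zQ.
rewrite /evolution -[k * _](lim_seriesZ _ cy) -lim_seriesD//; last exact: is_cvg_seriesZ.
by congr (limn (series _)); apply/funext => m /=; rewrite evoP.
Qed.

(* A base [C] larger than [C0] makes the bounds below geometric in [m]. *)
Section uniform.
Variables (C T1 e : R).
Hypotheses (C0C : C0 < C) (T1_ge0 : 0 <= T1) (BCT1 : B * C * T1 < 1) (e_ge0 : 0 <= e).
Let D := C / (1 - B * C * T1).
Let th := C0 / C.

Let C_gt0 : 0 < C. Proof. exact: lt_trans C0C. Qed.

Let th_ge0 : 0 <= th. Proof. by rewrite divr_ge0// ltW. Qed.

Let th_lt1 : th < 1. Proof. by rewrite ltr_pdivrMr// mul1r. Qed.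

(** A single term of [evo_sum_le] in base [C], whose weight is [th] to the power $-m$; all bases
    reached up to time [T1] are at most [D]. *)
Lemma evo_le m t y P : 0 <= t <= T1 -> wbound D y P ->
  `|evo e m t y| <= K * P * th ^+ m.
Proof.
move=> /andP[t0 tT] yP.
have BCt : B * C * t <= B * C * T1 by rewrite ler_wpM2l// mulr_ge0// ltW.
have h := evo_sum_le m.+1 y e_ge0 t0 C_gt0 (le_lt_trans BCt BCT1).
rewrite -(ler_pM2l (x := (C / C0) ^+ m)) ?exprn_gt0 ?divr_gt0//.
apply: (@le_trans _ _ (K * P)); last first.
  by rewrite mulrCA -exprMn /th mulrA divfK ?divff ?gt_eqF// expr1n mulr1.
apply: le_trans (le_trans h _).
  by rewrite big_ord_recr/= lerDr sumr_ge0// => i _; rewrite mulr_ge0// exprn_ge0// divr_ge0// ltW.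
rewrite ler_wpM2l//; apply: le_trans (yP m.+1).
apply: wnorm_le; first by rewrite divr_ge0 ?ltW// subr_gt0 (le_lt_trans BCt).
rewrite ler_pdivrMr ?subr_gt0 ?(le_lt_trans BCt)// /D mulrAC ler_pdivlMr ?subr_gt0//.
by rewrite ler_pM2l// lerB.
Qed.

Lemma evo_mvt m s t y : 0 <= s <= T1 -> 0 <= t <= T1 -> exists2 c,
  0 <= c <= T1 /\ `|c - s| <= `|t - s| &
  evo e m t y - evo e m s y = (t - s) * evo e m c (hgen e y).
Proof.
have D1 x := evo_is_derive m x y e_ge0.
have cf (x : R) : {for x, continuous (fun s => evo e m s y)}.
  apply: differentiable_continuous; apply/derivable1_diffP.
  exact: @ex_derive _ _ _ _ _ _ _ (D1 x).
have mvt (x z : R) : x <= z -> exists2 c, x <= c <= z &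
    evo e m z y - evo e m x y = (z - x) * evo e m c (hgen e y).
  move=> xz; have [|c] := @MVT_segment _ (fun s => evo e m s y)
    (fun s => evo e m s (hgen e y)) _ _ xz (fun x _ => D1 x).
    by apply: continuous_subspaceT.
  by rewrite in_itv/= => cx ->; exists c => //; rewrite mulrC.
move=> /andP[s0 sT] /andP[t0 tT]; have [st|/ltW ts] := leP s t.
  have [c /andP[sc ct] E] := mvt _ _ st; exists c => //; split; first by lra.
  by rewrite !ger0_norm ?subr_ge0// lerB.
have [c /andP[tc cs] E] := mvt _ _ ts; exists c; first split; first by lra.
  by rewrite !ler0_norm ?subr_le0// !opprB lerB.
by rewrite -opprB E -mulNr opprB.
Qed.

Lemma evo_lipschitz m s t y P : 0 <= s <= T1 -> 0 <= t <= T1 ->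
  wbound D (hgen e y) P ->
  `|evo e m t y - evo e m s y| <= `|t - s| * (K * P * th ^+ m).
Proof.
move=> sT tT yP; have [c [cT _] ->] := evo_mvt m y sT tT.
by rewrite normrM ler_wpM2l//; exact: evo_le.
Qed.

(** The mean value theorem followed by the Lipschitz bound for [hgen e y]; the location of the
    intermediate point kept in [evo_mvt] supplies the second factor [t - s]. *)
Lemma evo_taylor m s t y P : 0 <= s <= T1 -> 0 <= t <= T1 ->
  wbound D (hgen e (hgen e y)) P ->
  `|evo e m t y - evo e m s y - (t - s) * evo e m s (hgen e y)| <=
    (t - s) ^+ 2 * (K * P * th ^+ m).
Proof.
move=> sT tT yP; have [c [cT ct] ->] := evo_mvt m y sT tT.
rewrite -mulrBr normrM -[in leRHS]real_normK ?num_real// expr2 -[leRHS]mulrA ler_wpM2l//.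
apply: le_trans (evo_lipschitz _ sT cT yP) _; rewrite ler_wpM2r//.
by rewrite !mulr_ge0 ?exprn_ge0//; exact: wbound_ge0 yP.
Qed.

Let is_cvg_geom (L : R) : cvgn (series (fun m => L * th ^+ m)).
Proof. by apply: is_cvg_geometric_series; rewrite ger0_norm. Qed.

Let geom_lim (L : R) : limn (series (fun m => L * th ^+ m)) = L * (1 - th)^-1.
Proof. by apply/cvg_lim => //; apply: cvg_geometric_series; rewrite ger0_norm. Qed.

Lemma is_cvg_evolution_unif t y P : 0 <= t <= T1 -> wbound D y P ->
  cvgn (series (fun m => evo e m t y)).
Proof.
move=> tT yP; apply: dominated_is_cvg_series (fun m => evo_le m tT yP) _.
exact: is_cvg_geom.
Qed.

Lemma evolution_lipschitz s t y P Q : 0 <= s <= T1 -> 0 <= t <= T1 ->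
  wbound D y Q -> wbound D (hgen e y) P ->
  `|evolution e t y - evolution e s y| <= `|t - s| * (K * P / (1 - th)).
Proof.
move=> sT tT yQ yP; rewrite /evolution -lim_seriesB; last 2 first.
- exact: is_cvg_evolution_unif yQ.
- exact: is_cvg_evolution_unif yQ.
rewrite mulrA -geom_lim; apply: dominated_lim_series; last exact: is_cvg_geom.
by move=> m; rewrite -mulrA; exact: evo_lipschitz.
Qed.

Lemma evolution_taylor s t y P Q S : 0 <= s <= T1 -> 0 <= t <= T1 ->
  wbound D y Q -> wbound D (hgen e y) S -> wbound D (hgen e (hgen e y)) P ->
  `|evolution e t y - evolution e s y - (t - s) * evolution e s (hgen e y)| <=
    (t - s) ^+ 2 * (K * P / (1 - th)).
Proof.
move=> sT tT yQ yS yP.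
have c1 := is_cvg_evolution_unif tT yQ; have c2 := is_cvg_evolution_unif sT yQ.
have c3 := is_cvg_evolution_unif sT yS.
rewrite /evolution -lim_seriesB// -[(t - s) * _](lim_seriesZ _ c3) -lim_seriesB; last 2 first.
- exact: is_cvg_seriesB.
- exact: is_cvg_seriesZ.
rewrite mulrA -geom_lim; apply: dominated_lim_series; last exact: is_cvg_geom.
by move=> m; rewrite -mulrA; exact: evo_taylor.
Qed.

End uniform.

(** * Comparison of the hierarchy for small [e] with the one for [e = 0] *)

Section perturbation.
Variables (e : R).
Hypotheses (e_ge0 : 0 <= e) (e_le1 : e <= 1).

Lemma hbound_le1 f M : f <= 1 -> hbound f M <= hbound 1 M.
Proof. by move=> f1; rewrite lerD2r ler_wpM2r. Qed.

(** Telescoping: $D_e^{j+1} - D_0^{j+1} = D_e(D_e^j - D_0^j) + (D_e - D_0)D_0^j$ with $D_e - D_0 =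
    eL$. Since $e \le 1$, the bound for $e = 1$ serves for both generators. *)
Lemma nsum_iter_sub M j y :
  nsum M (fun n => iter j (hgen e) y n - iter j (hgen 0) y n) <=
    j%:R * e * hbound 1 M ^+ j * nsum M y.
Proof.
elim: j => [|j IH].
  by rewrite !mul0r /nsum big1// => m _; rewrite subrr normr0.
set z := fun n => _ in IH; set u := iter j (hgen 0) y in z IH *.
have -> : (fun n => iter j.+1 (hgen e) y n - iter j.+1 (hgen 0) y n) =
    fun n => hgen e z n + e *: l n (u n).
  apply: functional_extensionality_dep => n; rewrite !iterS -/u.
  have -> : iter j (hgen e) y = fun n => 1 *: z n + u n.
    by apply: functional_extensionality_dep => k; rewrite scale1r /z subrK.
  rewrite hgenP scale1r -addrA; congr (_ + _).
  by case: n => [|n] /=; rewrite scale0r ?subr0// add0r addrK.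
apply: (@le_trans _ _ (nsum M (hgen e z) + e * a M * nsum M u)).
  rewrite mulr_sumr -big_split/=; apply: ler_sum => m _.
  apply: le_trans (ler_normD _ _) _; rewrite lerD2l normrZ ger0_norm//.
  rewrite -mulrA ler_wpM2l//; apply: le_trans (l_le _) _.
  by rewrite ler_wpM2r// a_nd// ltnW.
have h1 : nsum M (hgen e z) <= hbound 1 M * (j%:R * e * hbound 1 M ^+ j * nsum M y).
  apply: le_trans (nsum_hgen _ _ e_ge0) _; apply: ler_pM => //.
  - exact: hbound_ge0.
  - exact: nsum_ge0.
  - exact: hbound_le1.
have h2 : nsum M u <= hbound 1 M ^+ j * nsum M y.
  apply: le_trans (nsum_iter _ _ _ (lexx 0)) _; rewrite ler_wpM2r ?nsum_ge0//.
  by rewrite lerXn2r ?nnegrE ?hbound_ge0// hbound_le1.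
have h3 : a M <= hbound 1 M by rewrite /hbound mul1r lerDl !mulr_ge0.
have h4 : e * a M * nsum M u <= e * hbound 1 M * (hbound 1 M ^+ j * nsum M y).
  by rewrite ler_pM ?mulr_ge0 ?nsum_ge0// ler_wpM2l.
apply: le_trans (lerD h1 h4) _; rewrite exprS -natr1 le_eqVlt; apply/orP; left.
by apply/eqP; ring.
Qed.

(** The factor [j] of [nsum_iter_sub] is absorbed by $2^j$, whence the 2 in the exponential. The
    bound is linear in [e], with a constant that may grow fast with the level. *)
Lemma evo_sub_le m t T1 y : 0 <= t <= T1 ->
  `|evo e m t y - evo 0 m t y| <=
    e * (phiK m * nsum m.+1 y * expR (2 * hbound 1 m.+1 * T1)).
Proof.
move=> /andP[t0 tT]; set c := hbound 1 m.+1; set s := nsum m.+1 y.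
have c0 : 0 <= c by exact: hbound_ge0.
rewrite mulrA /evo -lim_seriesB; last 2 first.
- exact: is_cvg_evo.
- exact: is_cvg_evo.
have E : cvgn (series (exp_coeff (2 * c * T1))) by exact: is_cvg_series_exp_coeff.
rewrite /expR -[leRHS](@lim_seriesZ _ _ (e * (phiK m * s)) E).
apply: dominated_lim_series; last exact: is_cvg_seriesZ.
move=> j; rewrite /= !fctE -mulrBl /ecoef -mulrBl -linearB/= normrM normrM.
rewrite normfV normr_nat normrX (ger0_norm t0) /exp_coeff/=.
rewrite /GRing.scale/= mulrAC [leRHS]mulrA ler_wpM2r ?invr_ge0// !exprMn.
have h1 := nsum_iter_sub m.+1 j y.
have h2 := le_nsum (fun n => iter j (hgen e) y n - iter j (hgen 0) y n) (ltnSn m).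
have h3 := ler_wpM2l (phiK_ge0 m) (le_trans h2 h1).
have h4 := le_trans (phi_le _) h3.
apply: le_trans (ler_pM _ _ h4 (lerXn2r j _ _ tT)) _ => //.
- by rewrite exprn_ge0.
- by rewrite nnegrE (le_trans t0).
rewrite -/c -/s.
have T0 : 0 <= T1 by rewrite (le_trans t0).
have h5 : 0 <= phiK m * (e * c ^+ j * s) * T1 ^+ j.
  by rewrite !mulr_ge0 ?exprn_ge0 ?invr_ge0 ?nsum_ge0// ltW.
have h6 : j%:R <= 2 ^+ j :> R by rewrite -natrX ler_nat ltnW// ltn_expl.
have := ler_wpM2r h5 h6.
have -> : phiK m * (j%:R * e * c ^+ j * s) * T1 ^+ j =
  j%:R * (phiK m * (e * c ^+ j * s) * T1 ^+ j) by ring.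
move/le_trans; apply; rewrite le_eqVlt; apply/orP; left; apply/eqP; ring.
Qed.

End perturbation.

(** The constants of [evo_sub_le] need not be summable over the levels, so they are used only below
    some [M]; above [M] both evolutions are small by the geometric bound [evo_le], uniformly in [e]
    and [t]. *)
Lemma evolution_cvg0 C T1 y P d : C0 < C -> 0 <= T1 -> B * C * T1 < 1 ->
  wbound (C / (1 - B * C * T1)) y P -> 0 < d ->
  exists2 e0, 0 < e0 & forall e t, 0 <= e <= e0 -> 0 <= t <= T1 ->
    `|evolution e t y - evolution 0 t y| <= d.
Proof.
move=> C0C T10 BCT yP d0.
have C_gt0 := lt_trans C0_gt0 C0C.
have P0 := wbound_ge0 yP.
pose th := C0 / C.
have th0 : 0 <= th by rewrite divr_ge0// ltW.
have th1 : th < 1 by rewrite ltr_pdivrMr// mul1r.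
pose G := (1 - th)^-1.
have geomle N : \sum_(n < N) th ^+ n <= G.
  rewrite -[leRHS]mul1r ler_pdivlMr ?subr_gt0// mulrC -opprB mulNr -subrX1.
  by rewrite opprB gerBl exprn_ge0.
have [M tailM] : exists M, 2 * K * P * th ^+ M * G <= d / 2.
  have : (fun M => 2 * K * P * G * th ^+ M) @ \oo --> 2 * K * P * G * 0.
    by apply: cvgM; [exact: cvg_cst|apply: cvg_expr; rewrite ger0_norm].
  rewrite mulr0 => /cvgrPdist_le/(_ _ (divr_gt0 d0 (@ltr0n R 2)))[M _ /(_ M (leqnn M))].
  rewrite sub0r normrN => h; exists M; rewrite mulrAC.
  exact: le_trans (ler_norm _) h.
pose c m := phiK m * nsum m.+1 y * expR (2 * hbound 1 m.+1 * T1).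
have c0 m : 0 <= c m by rewrite !mulr_ge0 ?exprn_ge0 ?invr_ge0 ?expR_ge0 ?nsum_ge0// ltW.
pose S := \sum_(m < M) c m.
have S0 : 0 <= S by apply: sumr_ge0.
(* The 1 is required by the perturbation bounds; [S + 1] replaces [S], which may vanish. *)
exists (Num.min 1 (d / 2 / (S + 1))).
  by rewrite lt_min ltr01 !divr_gt0// ltr_wpDl.
move=> e t /andP[e0]; rewrite le_min => /andP[e1 eS] tT.
have tT' : B * C0 * t < 1.
  case/andP: tT => t0 tT; apply: le_lt_trans BCT.
  by rewrite ler_pM// ?mulr_ge0// ?ler_wpM2l// ltW.
rewrite /evolution -lim_seriesB; last 2 first.
- exact: is_cvg_evolution_unif yP.
- exact: is_cvg_evolution_unif yP.
apply: bounded_lim_series => N.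
have E1 m : `|evo e m t y - evo 0 m t y| <= e * c m by exact: evo_sub_le.
have E2 m : `|evo e m t y - evo 0 m t y| <= 2 * K * P * th ^+ m.
  apply: le_trans (ler_normB _ _) _.
  have -> : 2 * K * P * th ^+ m = K * P * th ^+ m + K * P * th ^+ m by ring.
  apply: lerD; first exact: (evo_le C0C BCT e0 m tT yP).
  exact: (evo_le C0C BCT (lexx 0) m tT yP).
(* Lengthening the partial sum to [M + N] terms lets it be split at [M] whatever [N] is. *)
apply: (@le_trans _ _ (\sum_(m < M + N) `|evo e m t y - evo 0 m t y|)).
  by rewrite addnC big_split_ord/= lerDl sumr_ge0.
rewrite big_split_ord/= [leRHS](splitr d); apply: lerD.
  apply: (@le_trans _ _ (e * S)).
    by rewrite mulr_sumr; apply: ler_sum => m _; exact: E1.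
  apply: (@le_trans _ _ (e * (S + 1))); first by rewrite ler_wpM2l// lerDl.
  by rewrite -ler_pdivlMr// ltr_wpDl.
apply: le_trans tailM.
apply: (@le_trans _ _ (2 * K * P * th ^+ M * \sum_(n < N) th ^+ n)); last first.
  by rewrite ler_wpM2l// !mulr_ge0// exprn_ge0.
rewrite mulr_sumr; apply: ler_sum => m _; apply: le_trans (E2 _) _.
by rewrite exprD mulrA.
Qed.

End functional.
End evolution.

(** * Bounded functionals on integrable functions *)

Section L1_functional.
Context d (T : measurableType d) (R : realType) (mu : {measure set T -> \bar R}).
Implicit Types (f g : T -> R) (A B E : set T) (K : R).

Local Notation intg f := (mu.-integrable setT (EFin \o f)).

(** Defined on functions rather than on classes; linearity and the bound together force equal values
    on a.e. equal integrable functions. *)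
Definition L1_functional K (Psi : (T -> R) -> R) :=
  (forall (a : R) f g, intg f -> intg g ->
    Psi (fun x => a * f x + g x) = a * Psi f + Psi g) /\
  (forall f, intg f -> `|Psi f| <= K * \int[mu]_x `|f x|).

Lemma integrable_lincomb (a : R) f g : intg f -> intg g ->
  intg (fun x => a * f x + g x).
Proof.
move=> If Ig; rewrite (_ : _ \o _ = (fun x => a%:E * (f x)%:E) \+ (EFin \o g))%E.
  by apply: integrableD => //; exact: integrableZl.
by apply/funext => x /=; rewrite EFinD EFinM.
Qed.

Lemma integrable_indicI A f : measurable A -> intg f -> intg (fun x => f x * \1_A x).
Proof.
move=> mA If; apply: (le_integrable measurableT _ _ If) => /=.
  apply/measurable_EFinP; apply: measurable_funM => //.
  by apply/measurable_EFinP; exact: measurable_int If.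
move=> x _; rewrite lee_fin normrM ler_piMr// indicE.
by case: (_ \in _); rewrite ?normr1 ?normr0.
Qed.

Lemma integrable_indic_fin A : measurable A -> (mu A < +oo)%E -> intg (\1_A).
Proof.
move=> mA Aoo; apply/integrableP; split; first exact/measurable_EFinP.
under eq_integral do rewrite gee0_abs ?lee_fin//.
by rewrite integral_indic// setIT.
Qed.

Section properties.
Variables (K : R) (Psi : (T -> R) -> R).
Hypotheses (K0 : 0 <= K) (PsiL : L1_functional K Psi).

Let PsiP a f g := PsiL.1 a f g.
Let Psi_le f := PsiL.2 f.

Lemma L1_functional0 : Psi (fun=> 0) = 0.
Proof.
have I0 : intg (fun=> 0 : R) by exact: integrable0.
suff : `|Psi (fun=> 0)| <= 0 by rewrite normr_le0 => /eqP.
apply: le_trans (Psi_le I0) _; rewrite /Rintegral; under eq_integral do rewrite normr0.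
by rewrite integral0 mulr0.
Qed.

Lemma L1_functionalB f g : intg f -> intg g ->
  Psi (fun x => f x - g x) = Psi f - Psi g.
Proof.
move=> If Ig; have := PsiP (-1) Ig If; rewrite mulN1r addrC => <-.
by congr Psi; apply/funext => x; rewrite mulN1r addrC.
Qed.

Lemma L1_functional_sum I (s : seq I) (c : I -> R) (F : I -> T -> R) :
  (forall i, intg (F i)) ->
  Psi (fun x => \sum_(i <- s) c i * F i x) = \sum_(i <- s) c i * Psi (F i).
Proof.
move=> IF; elim: s => [|i s IH].
  rewrite big_nil -[RHS]L1_functional0; congr Psi.
  by apply/funext => x; rewrite big_nil.
rewrite big_cons -IH -PsiP//.
  by congr Psi; apply/funext => x; rewrite big_cons.
rewrite (_ : _ \o _ = fun x => \sum_(i <- s) (c i * F i x)%:E)%E; last first.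
  by apply/funext => x /=; rewrite sumEFin.
apply: integrable_sum => // j _.
exact: (integrableZl measurableT (c j) (IF j)).
Qed.

Lemma L1_functional_indic A : measurable A -> (mu A < +oo)%E ->
  `|Psi (\1_A)| <= K * fine (mu A).
Proof.
move=> mA Aoo; apply: le_trans (Psi_le (integrable_indic_fin mA Aoo)) _.
rewrite ler_wpM2l// /Rintegral (_ : (fun x => _) = fun x => (\1_A x)%:E).
  by rewrite integral_indic// setIT.
by apply/funext => x; rewrite ger0_norm.
Qed.

Lemma L1_functional_closed f (g : nat -> T -> R) : intg f ->
  (forall n, intg (g n)) -> (forall n, Psi (g n) = 0) ->
  (\int[mu]_x `|(f x)%:E - (g n x)%:E| @[n --> \oo] --> 0)%E -> Psi f = 0.
Proof.
move=> If Ig Pg cg.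
have fg n : intg (fun x => f x - g n x).
  have := integrable_lincomb (-1) (Ig n) If.
  by congr (mu.-integrable _ _); apply/funext => x /=; rewrite mulN1r addrC.
have H : (fun n => K * fine (\int[mu]_x `|(f x)%:E - (g n x)%:E|)%E) @ \oo --> K * 0.
  by apply: cvgM; [exact: cvg_cst|exact: fine_cvg].
rewrite mulr0 in H.
suff : `|Psi f| <= 0 by rewrite normr_le0 => /eqP.
apply: (ler_cvg_to (cvg_cst _) H); apply: nearW => n.
by rewrite -[Psi f]subr0 -(Pg n) -L1_functionalB//; exact: Psi_le.
Qed.

Variable (F : (set T)^nat).
Hypotheses (FT : \bigcup_n F n = setT) (ndF : nondecreasing_seq F)
  (mF : forall n, measurable (F n)) (Foo : forall n, (mu (F n) < +oo)%E).

Lemma cvg_indicI f : intg f ->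
  (\int[mu]_x `|(f x)%:E - (f x * \1_(F n) x)%:E| @[n --> \oo] --> 0)%E.
Proof.
move=> If; have mf : measurable_fun setT f by apply/measurable_EFinP; exact: measurable_int If.
have If' : mu.-integrable setT (abse \o (EFin \o f)) by exact: integrable_abse.
have [] // := @dominated_convergence _ _ _ mu setT measurableT
  (fun n x => (f x * \1_(F n) x)%:E) (EFin \o f) (abse \o (EFin \o f)).
- by move=> n; apply/measurable_EFinP; exact: measurable_funM.
- exact/measurable_EFinP.
- apply: aeW => x _ /=; apply: cvg_near_cst.
  have [n _ Fnx] : (\bigcup_n F n) x by rewrite FT.
  exists n => // m /= nm; rewrite indicE mem_set ?mulr1//.
  by move/subsetPset: (ndF nm); exact.
- apply: aeW => x n _ /=; rewrite lee_fin normrM ler_piMr// indicE.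
  by case: (_ \in _); rewrite ?normr1 ?normr0.
move=> _ + _; apply: cvg_trans; apply: near_eq_cvg; apply: nearW => n /=.
by apply: eq_integral => x _; rewrite distrC.
Qed.

(** Two density steps: an integrable function is an $L^1$ limit of simple functions, and each of
    these of its restrictions to the sets [F n], which are combinations of the given indicators. *)
Lemma L1_functional_eq0 : (forall n A, measurable A -> Psi (\1_(A `&` F n)) = 0) ->
  forall f, intg f -> Psi f = 0.
Proof.
move=> PF f If.
have simple n (g : {sfun T >-> R}) : Psi (fun x => g x * \1_(F n) x) = 0.
  pose A y := g @^-1` [set y] `&` F n.
  have mA y : measurable (A y) by apply: measurableI.
  have IA y : intg (\1_(A y)).
    apply: integrable_indic_fin => //; apply: le_lt_trans (Foo n).
    by apply: le_measure; rewrite ?inE//; exact: subIsetr.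
  rewrite (_ : (fun x => _) = fun x => \sum_(y <- fset_set (range g)) y * \1_(A y) x).
    by rewrite L1_functional_sum// big1// => y _; rewrite PF// mulr0.
  apply/funext => x; rewrite fimfunE fsbig_finite//= mulr_suml; apply: eq_bigr => y _.
  by rewrite -mulrA /A indicI.
have [g [Ig _ cg]] := approximation_sfun_integrable measurableT If.
apply: (L1_functional_closed If Ig _ cg) => n.
apply: (L1_functional_closed (Ig n) _ _ (cvg_indicI (Ig n))) => // m.
exact: integrable_indicI.
Qed.

End properties.

End L1_functional.

(** * Radon-Nikodym density of a functional on a set of finite measure *)

Section dual_charge.
Context d (T : measurableType d) (R : realType)
  (mu : {sigma_finite_measure set T -> \bar R}).
Variables (K : R) (Psi : (T -> R) -> R) (E : set T).
Hypotheses (K0 : 0 <= K) (PsiL : L1_functional mu K Psi)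
  (mE : measurable E) (Eoo : (mu E < +oo)%E).
Local Notation intg f := (mu.-integrable setT (EFin \o f)).

(** Intersecting with [E], of finite measure, makes every indicator integrable. *)
Definition dual_charge A : \bar R := (Psi (\1_(A `&` E)))%:E.

Let muI_fin A : measurable A -> (mu (A `&` E) < +oo)%E.
Proof.
move=> mA; apply: le_lt_trans Eoo.
by apply: le_measure; rewrite ?inE//; exact: measurableI.
Qed.

Let intI A : measurable A -> intg (\1_(A `&` E)).
Proof. by move=> mA; apply: integrable_indic_fin; [exact: measurableI|exact: muI_fin]. Qed.

Let dual_charge0 : dual_charge set0 = 0%E.
Proof.
rewrite /dual_charge set0I (_ : \1_set0 = fun=> 0) ?(L1_functional0 PsiL)//.
by apply/funext => x; rewrite indic0.
Qed.

Let dual_charge_fin A : measurable A -> dual_charge A \is a fin_num.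
Proof. by []. Qed.

Let dual_chargeU A B : measurable A -> measurable B -> A `&` B = set0 ->
  Psi (\1_((A `|` B) `&` E)) = Psi (\1_(A `&` E)) + Psi (\1_(B `&` E)).
Proof.
move=> mA mB AB; rewrite -[X in X + _]mul1r -(PsiL.1 1 _ _ (intI mA) (intI mB)).
congr Psi; apply/funext => x; rewrite mul1r !indicE -natrD; congr (_%:R).
rewrite !in_setI in_setU; case xA : (x \in A); case xB : (x \in B) => //=.
- by have : (x \in A `&` B); [rewrite in_setI xA xB|rewrite AB in_set0].
- by rewrite addn0.
Qed.

(** The remainders [W n] decrease to the empty set, so their measures within [E] tend to 0, and
    these control [Psi] on the corresponding indicators. *)
Let dual_charge_sigma_additive : semi_sigma_additive dual_charge.
Proof.
move=> A mA tA mUA.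
pose V n := \big[setU/set0]_(i < n) A i.
have mV n : measurable (V n) by apply: bigsetU_measurable.
have VE n : (\sum_(0 <= i < n) dual_charge (A i) = (Psi (\1_(V n `&` E)))%:E)%E.
  elim: n => [|n IH].
    by rewrite big_geq// /V big_ord0 -[0%E]dual_charge0.
  rewrite big_nat_recr//= IH /V big_ord_recr/= dual_chargeU//; first exact: mV.
  rewrite -subset0 => x [Vx Anx].
  move: Vx; rewrite /V -bigcup_mkord => -[i /= iltn Aix].
  have : set0 x; last by [].
  move/trivIsetP : tA => /(_ i n I I); rewrite (ltn_eqF iltn) => /(_ isT) <-.
  by split.
pose U := \bigcup_n A n; pose W n := U `\` V n.
have mW n : measurable (W n) by apply: measurableD.
have VU n : V n `<=` U.
  by rewrite /V -bigcup_mkord; apply: bigcup_sub => i _; exact: bigcup_sup.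
have UE n : Psi (\1_(U `&` E)) = Psi (\1_(V n `&` E)) + Psi (\1_(W n `&` E)).
  rewrite -dual_chargeU//; last by rewrite setDIK.
  by rewrite setDUK.
have cW : (mu (W n `&` E) @[n --> \oo] --> mu (\bigcap_n (W n `&` E)))%E.
  apply: nonincreasing_cvg_mu.
  - exact: muI_fin.
  - by move=> n; exact: measurableI.
  - by apply: bigcap_measurable => // n _; exact: measurableI.
  - move=> m n mn; apply/subsetPset; apply: setSI; apply: setDS.
    by rewrite /V -!bigcup_mkord => x [i /= im Aix]; exists i => //=; exact: leq_trans mn.
have W0 : \bigcap_n (W n `&` E) = set0.
  rewrite -subset0 => x Wx; have [[[n _ Anx] _] _] := Wx 0%N I.
  have [[_ +] _] := Wx n.+1 I; apply; rewrite /V -bigcup_mkord.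
  by exists n => //=.
rewrite W0 measure0 in cW.
rewrite (_ : (fun n => _) = fun n => (Psi (\1_(V n `&` E)))%:E); last exact/funext.
apply: cvg_EFin; first exact: nearW.
apply/cvgrPdist_le => e e0.
have : (fun n => K * fine (mu (W n `&` E))) @ \oo --> K * 0.
  by apply: cvgM; [exact: cvg_cst|exact: fine_cvg].
rewrite mulr0 => /cvgrPdist_le/(_ e e0); apply: filterS => n /=.
rewrite sub0r normrN => h; rewrite -/U (UE n) addrAC subrr add0r.
apply: le_trans (L1_functional_indic K0 PsiL _ (muI_fin (mW n))) _.
  exact: measurableI.
exact: le_trans (ler_norm _) h.
Qed.

HB.instance Definition _ := isCharge.Build _ _ _ dual_charge
  dual_charge0 dual_charge_fin dual_charge_sigma_additive.

Lemma dual_charge_dominated : dual_charge `<< mu.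
Proof.
apply/null_content_dominatesP => A mA A0.
have AE0 : mu (A `&` E) = 0%E.
  by apply/eqP; rewrite eq_le measure_ge0 andbT -A0 le_measure ?inE//; exact: measurableI.
congr EFin; suff : `|Psi (\1_(A `&` E))| <= 0 by rewrite normr_le0 => /eqP.
apply: le_trans (L1_functional_indic K0 PsiL _ (muI_fin mA)) _.
  exact: measurableI.
by rewrite [X in fine X](_ : _ = 0%E) ?mulr0.
Qed.

Lemma dual_density : exists2 h : T -> R, intg h &
  forall A, measurable A -> Psi (\1_(A `&` E)) = \int[mu]_(x in A) h x.
Proof.
pose nu : {charge set T -> \bar R} := dual_charge.
have numu : nu `<< mu := dual_charge_dominated.
exists (fine \o Radon_Nikodym nu mu).
  rewrite (_ : _ \o _ = Radon_Nikodym nu mu); first exact: Radon_Nikodym_integrable.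
  by apply/funext => x /=; rewrite fineK// Radon_Nikodym_fin_num.
move=> A mA; have := Radon_Nikodym_integral numu mA.
move=> /(congr1 fine) nuA; transitivity (fine (nu A)) => //; rewrite nuA.
by congr fine; apply: eq_integral => x _; rewrite fineK// Radon_Nikodym_fin_num.
Qed.

End dual_charge.

(** * Representation of functionals on $L^1$ by bounded functions, for a sigma-finite measure *)

Section L1_dual.
Context d (T : measurableType d) (R : realType)
  (mu : {sigma_finite_measure set T -> \bar R}).
Local Notation intg f := (mu.-integrable setT (EFin \o f)).

Lemma L1_functionalN K (Psi : (T -> R) -> R) :
  L1_functional mu K Psi -> L1_functional mu K (fun f => - Psi f).
Proof.
move=> [lin bnd]; split=> [a f g If Ig|f If]; last by rewrite normrN bnd.
by rewrite lin// opprD mulrN.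
Qed.

(** On $A = \{h > K\} \cap E$ the integral of $h - K$ is $\Psi(1_A) - K\mu(A) \le 0$ although the
    integrand is positive, so $A$ is null. The lower bound for $h$ follows by applying this to
    $-\Psi$. *)
Lemma dual_density_le (K : R) (Psi : (T -> R) -> R) (E : set T) (h : T -> R) :
  0 <= K -> L1_functional mu K Psi -> measurable E -> (mu E < +oo)%E -> intg h ->
  (forall A, measurable A -> Psi (\1_(A `&` E)) = \int[mu]_(x in A) h x) ->
  {ae mu, forall x, E x -> h x <= K}.
Proof.
move=> K0 PsiL mE Eoo Ih Ph.
have mh : measurable_fun setT h by apply/measurable_EFinP; exact: measurable_int Ih.
pose A := [set x | K < h x] `&` E.
have mA : measurable A.
  apply: measurableI => //; rewrite -[X in measurable X]setTI.
  have /(_ measurableT [set true]) := measurable_fun_ltr (measurable_cst K) mh.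
  move=> /(_ I).
  by congr measurable; apply/seteqP; split=> x [].
have Aoo : (mu A < +oo)%E.
  by apply: le_lt_trans Eoo; apply: le_measure; rewrite ?inE//; exact: subIsetr.
have IhA : mu.-integrable A (EFin \o h) by exact: integrableS Ih.
have IKA : mu.-integrable A (EFin \o cst K).
  apply: measurable_bounded_integrable => //.
  by exists `|K|; split=> // r Kr x _; exact: ltW.
have le0 : \int[mu]_(x in A) (h x - K) <= 0.
  rewrite RintegralB// -Ph// (_ : A `&` E = A); last first.
    by rewrite /A -setIA setIid.
  rewrite Rintegral_cst// subr_le0.
  exact: le_trans (ler_norm _) (L1_functional_indic K0 PsiL mA Aoo).
have IhK : mu.-integrable A (EFin \o (fun x => h x - K)) by exact: (integrableB mA IhA IKA).
have mhK : measurable_fun A (EFin \o (fun x => h x - K)) by exact: measurable_int IhK.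
have : (\int[mu]_(x in A) `|(h x - K)%:E| = 0)%E.
  apply/eqP; rewrite eq_le integral_ge0// andbT.
  rewrite (eq_integral (fun x => (h x - K)%:E)); last first.
    by move=> x; rewrite inE => -[Kh _]; rewrite gee0_abs// lee_fin subr_ge0 ltW.
  have Ifin : (\int[mu]_(x in A) (h x - K)%:E)%E \is a fin_num.
    exact: integrable_fin_num.
  by rewrite -(fineK Ifin) lee_fin.
move=> /(ae_eq_integral_abs mu mA mhK); apply: filterS => x /= hx Ex.
rewrite leNgt; apply/negP => Kh.
by have /eqP := hx (conj Kh Ex); rewrite eqe subr_eq0 => /eqP hK; rewrite hK ltxx in Kh.
Qed.

(** Densities on disjoint pieces [D j] of finite measure are glued together; that the result
    represents [Psi] need only be checked on indicators inside finitely many pieces. *)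
Theorem L1_dual (K : R) (Psi : (T -> R) -> R) : 0 <= K -> L1_functional mu K Psi ->
  exists k : T -> R, [/\ measurable_fun setT k, forall x, `|k x| <= K &
    forall f, intg f -> Psi f = \int[mu]_x (f x * k x)].
Proof.
move=> K0 PsiL.
have /sigma_finiteP[F [FT ndF Foo]] := sigma_finiteT mu.
pose D := seqD F.
have mD j : measurable (D j).
  by case: j => [|j]; [exact: (Foo 0%N).1|apply: measurableD; apply: (Foo _).1].
have DF j : D j `<=` F j by case: j => // j; exact: subDsetl.
have Doo j : (mu (D j) < +oo)%E.
  apply: le_lt_trans (Foo j).2; apply: le_measure; rewrite ?inE//.
  exact: (Foo j).1.
have tD : trivIset setT D by exact: trivIset_seqD.
have DT : \bigcup_j D j = setT by rewrite eq_bigcup_seqD -FT.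
have dens j : {h : T -> R | intg h /\
    forall A, measurable A -> Psi (\1_(A `&` D j)) = \int[mu]_(x in A) h x}.
  by apply: cid; have [h] := dual_density K0 PsiL (mD j) (Doo j); exists h.
pose h j := sval (dens j).
have Ih j : intg (h j) := (svalP (dens j)).1.
have hE j A : measurable A -> Psi (\1_(A `&` D j)) = \int[mu]_(x in A) h j x :=
  (svalP (dens j)).2 A.
have mh j : measurable_fun setT (h j).
  by apply/measurable_EFinP; exact: measurable_int (Ih j).
(* Clamping to $[-K, K]$ changes the density on a null set of its piece only, and makes the bound
   hold at every point. *)
pose hK j x := Num.max (- K) (Num.min K (h j x)).
have mhK j : measurable_fun setT (hK j).
  by apply: measurable_maxr => //; exact: measurable_minr.
have hK_le j x : `|hK j x| <= K.
  have NK : - K <= K by rewrite (le_trans _ K0)// oppr_le0.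
  by rewrite ler_norml /hK le_max lexx/= ge_max ge_min lexx/= NK.
have hKE j : {ae mu, forall x, D j x -> hK j x = h j x}.
  have h1 := dual_density_le K0 PsiL (mD j) (Doo j) (Ih j) (hE j).
  have IN : intg (fun x => - h j x).
    by have := integrableN (Ih j); congr (mu.-integrable _ _).
  have h2 := dual_density_le K0 (L1_functionalN PsiL) (mD j) (Doo j) IN.
  have {}h2 := h2 _; apply: filterS2 h1 (h2 _) => [x u v Dx|A mA].
    by rewrite /hK min_r ?u// max_r// lerNl v.
  rewrite hE// -mulN1r -RintegralZl//; last exact: integrableS (Ih j).
  by apply: eq_Rintegral => x _; rewrite mulN1r.
(* The pieces cover the space, so the default 0 is never taken. *)
pose idx x := xget 0%N [set j | D j x].
have idxE j x : D j x -> idx x = j.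
  move=> Djx; rewrite /idx; case: xgetP => [i _ /= Dix|/(_ j)//].
  by apply: (tD i j I I); exists x.
pose k x := hK (idx x) x.
have mk : measurable_fun setT k.
  move=> _ B mB; rewrite setTI.
  rewrite (_ : k @^-1` B = \bigcup_j (D j `&` hK j @^-1` B)).
    apply: bigcupT_measurable => j; apply: measurableI => //.
    by rewrite -[X in measurable X]setTI; exact: mhK.
  apply/seteqP; split=> x /=.
    have [j _ Djx] : (\bigcup_j D j) x by rewrite DT.
    by rewrite /k (idxE _ _ Djx) => Bx; exists j.
  by move=> [j _ [Djx Bx]]; rewrite /preimage/= /k (idxE _ _ Djx).
have k_le x : `|k x| <= K by exact: hK_le.
exists k; split=> //.
have Ifk f : intg f -> intg (fun x => f x * k x).
  move=> If; apply: (@le_integrable _ _ _ mu setT measurableT _ (fun x => K%:E * (f x)%:E)%E) => /=.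
  - apply/measurable_EFinP; apply: measurable_funM => //.
    by apply/measurable_EFinP; exact: measurable_int If.
  - move=> x _; rewrite lee_fin !normrM mulrC ler_wpM2r// (le_trans (k_le x))//.
    exact: ler_norm.
  - exact: integrableZl.
(* The defect [L] is itself a bounded functional, so vanishing on indicators is enough for it to
   vanish. *)
pose L f := Psi f - \int[mu]_x (f x * k x).
have LL : L1_functional mu (K + K) L.
  split=> [a f g If Ig|f If]; rewrite /L.
    rewrite PsiL.1//; rewrite (_ : \int[mu]_x ((a * f x + g x) * k x) =
        a * \int[mu]_x (f x * k x) + \int[mu]_x (g x * k x)); first ring.
    rewrite -RintegralZl//; last exact: Ifk.
    rewrite -RintegralD//; [|exact: (integrableZl measurableT a (Ifk _ If))|exact: Ifk].
    by apply: eq_Rintegral => x _; ring.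
  apply: le_trans (ler_normB _ _) _; rewrite mulrDl lerD ?PsiL.2//.
  apply: le_trans (le_normr_Rintegral measurableT (Ifk _ If)) _.
  rewrite -RintegralZl//; last exact: integrable_abse If.
  apply: le_Rintegral => //.
  - exact: integrable_abse (Ifk _ If).
  - exact: (integrableZl measurableT K (integrable_abse If)).
  - by move=> x _; rewrite normrM mulrC ler_wpM2r.
suff L0 : forall f, intg f -> L f = 0 by move=> f /L0 /eqP; rewrite subr_eq0 => /eqP.
have mF n : measurable (F n) := (Foo n).1.
have Fo n : (mu (F n) < +oo)%E := (Foo n).2.
apply: (L1_functional_eq0 LL (esym FT) ndF mF Fo) => n A mA.
have LD j : L (\1_(A `&` D j)) = 0.
  rewrite /L hE//; apply/eqP; rewrite subr_eq0; apply/eqP.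
  have -> : \int[mu]_(x in A) h j x = \int[mu]_(x in A `&` D j) h j x.
    by rewrite -(hE j _ mA) -(hE j _ (measurableI _ _ mA (mD j))) -setIA setIid.
  under [RHS]eq_Rintegral do rewrite mulrC.
  rewrite (_ : \int[mu]_x (k x * \1_(A `&` D j) x) = \int[mu]_(x in A `&` D j) k x).
    congr fine; apply: ae_eq_integral.
    - exact: measurableI.
    - by apply/measurable_EFinP; exact: measurable_funTS.
    - by apply/measurable_EFinP; exact: measurable_funTS.
    - apply: filterS (hKE j) => x /= E [_ Djx].
      by rewrite /k (idxE _ _ Djx) E.
  by rewrite [RHS]Rintegral_mkcond; apply: eq_Rintegral => x _; rewrite patchE indicE; case: ifP => _; rewrite ?mulr1 ?mulr0.
have ID j : intg (\1_(A `&` D j)).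
  apply: integrable_indic_fin; first exact: measurableI.
  by apply: le_lt_trans (Doo j); apply: le_measure; rewrite ?inE//; exact: measurableI.
(* [F n] is the disjoint union of [D 0], ..., [D n], hence the [n.+1] terms; the coefficients 1
   match [L1_functional_sum]. *)
rewrite (_ : \1_(A `&` F n) = fun x => \sum_(j <- iota 0 n.+1) 1 * \1_(A `&` D j) x).
  by rewrite (L1_functional_sum LL _ _ ID) big1// => j _; rewrite LD mulr0.
apply/funext => x; rewrite indicE in_setI.
have -> : F n = \bigcup_(j in `I_n.+1) D j.
  rewrite bigcup_mkord /D -bigsetU_seqD -bigcup_mkord; apply/seteqP.
  split=> y; first by exists n => //=.
  move=> [i /= ilen]; have /subsetPset : (F i <= F n)%O by apply: ndF; rewrite -ltnS.
  exact.
have [j _ Djx] : (\bigcup_j D j) x by rewrite DT.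
have DE i : (x \in A `&` D i) = (x \in A) && (i == j).
  rewrite in_setI; congr andb; apply/idP/eqP => [|->]; rewrite inE// => Dix.
  by rewrite -(idxE _ _ Dix) (idxE _ _ Djx).
under eq_bigr do rewrite mul1r indicE DE.
have [jn|nj] := ltnP j n.+1.
  rewrite (_ : x \in \bigcup_(_ in _) _ = true); last by apply/mem_set; exists j.
  have jI : j \in iota 0 n.+1 by rewrite mem_iota.
  rewrite andbT (bigD1_seq j jI (iota_uniq _ _)) eqxx andbT big1; first by rewrite [RHS]addr0.
  by move=> i /negbTE ->; rewrite andbF.
rewrite (_ : x \in \bigcup_(_ in _) _ = false); last first.
  apply/negP; rewrite inE => -[i /= ilen Dix].
  by move: nj; rewrite -(idxE _ _ Djx) (idxE _ _ Dix) leqNgt ilen.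
rewrite andbF big1_seq// => i; rewrite mem_iota add0n => /andP[_ ilen].
by rewrite (ltn_eqF (leq_trans ilen nj)) andbF.
Qed.

End L1_dual.

(** * Null sets of Lebesgue measure on $\mathbb{R}^d$ and on products *)

Section lebesgue_diagonal.
Context (R : realType) (d : nat).
Local Open Scope ereal_scope.

(** The product measure integrates the sections over the first factor; its uniqueness permits
    integrating over the second one instead. *)
Lemma product_measure_ysection0 d1 d2 (T1 : measurableType d1) (T2 : measurableType d2)
    (m1 : {sigma_finite_measure set T1 -> \bar R})
    (m2 : {sigma_finite_measure set T2 -> \bar R}) (A : set (T1 * T2)) :
  measurable A -> {ae m2, forall y, m1 (ysection A y) = 0} -> (m1 \x m2) A = 0.
Proof.
move=> mA A0.
have -> : (m1 \x m2) A = (m1 \x^ m2) A.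
  by apply: product_measure_unique => // B C mB mC; exact: product_measure2E.
rewrite /= /product_measure2; under eq_integral do rewrite /=.
rewrite -[RHS](integral0 m2 setT); apply: ge0_ae_eq_integral => //.
- exact: measurable_fun_ysection.
- by apply: filterS A0 => y + _.
Qed.

Lemma lebesgue_Rd_hyperplane (c : R) :
  lebesgue_Rd R d.+1 [set x | tnth x ord0 = c :> R] = 0.
Proof.
rewrite /lebesgue_Rd/= /cons_measure /pushforward.
have -> : @cons_pair _ (measurableTypeR R) d @^-1` [set x | tnth x ord0 = c :> R] =
    [set c] `*` setT.
  by apply/seteqP; split=> -[x t] /=; [move=> <-|move=> [-> _]].
rewrite product_measure1E// [X in X * _](_ : _ = 0) ?mul0e//.
exact: lebesgue_measure_set1.
Qed.

Lemma measurable_hyperplane (c : R) :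
  measurable [set x : Rd R d.+1 | tnth x ord0 = c :> R].
Proof.
rewrite -[X in measurable X]setTI.
exact: (measurable_tnth (ord0 : 'I_d.+1) measurableT (measurable_set1 c)).
Qed.

Lemma offdiag_cons n (x : Rd R d) (t : n.-tuple (Rd R d)) :
  offdiag (cons_pair (x, t)) = (x \notin t /\ offdiag t) :> Prop.
Proof. by rewrite /offdiag/=; apply/propext; split=> [/andP[]|[-> ->]]. Qed.

End lebesgue_diagonal.

(** * Integration on the space of finite configurations *)

Section conf.
Context (R : realType) (d : nat).
Local Open Scope ereal_scope.
Local Notation m n := (lebesgue_Rdn R d n).
Local Notation lambda := (lebesgue_poisson R d).

(** For fixed distinct points [t], a further point creates a coincidence only if it is one of [t],
    hence lies in one of [n] hyperplanes prescribing its first coordinate. For $d = 0$ all points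
    coincide and the claim fails from $n = 2$ on. *)
Lemma diagonal_null n : (0 < d)%N -> m n (~` @offdiag R d n) = 0.
Proof.
move=> d0; elim: n => [|n IH].
  rewrite (_ : ~` _ = set0) ?measure0//.
  by rewrite -subset0 => t; apply; rewrite /offdiag/= (tuple0 t).
have mA : measurable (@cons_pair _ (Rd R d) n @^-1` (~` @offdiag R d n.+1)).
  rewrite -[X in measurable X]setTI; apply: measurable_cons_pair => //.
  by apply: measurableC; exact: measurable_offdiag.
rewrite /lebesgue_Rdn/= /cons_measure /pushforward.
apply: product_measure_ysection0 => //.
have nd : {ae m n, forall t, @offdiag R d n t}.
  by exists (~` @offdiag R d n); split => //; apply: measurableC; exact: measurable_offdiag.
apply: filterS nd => t ut.
have mA' : measurable (ysection (@cons_pair _ (Rd R d) n @^-1` (~` @offdiag R d n.+1)) t).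
  exact: measurable_ysection.
case: d d0 t ut mA mA' => // d' _ t ut mA mA'.
apply/eqP; rewrite eq_le measure_ge0 andbT.
pose c i : R := tnth (nth (thead (cons_pair (point : Rd R d'.+1, t))) t i) ord0.
pose H := \big[setU/set0]_(i < n) [set x : Rd R d'.+1 | tnth x ord0 = c i :> R].
have mH : measurable H.
  by apply: bigsetU_measurable => i _; exact: measurable_hyperplane.
have H0 : lebesgue_Rd R d'.+1 H = 0.
  apply/eqP; rewrite eq_le measure_ge0 andbT.
  have Hle := @Boole_inequality _ _ _ (lebesgue_Rd R d'.+1)
    (fun i => [set x | tnth x ord0 = c i :> R]) n (fun i _ => measurable_hyperplane (c i)).
  apply: le_trans Hle _; rewrite big1// => i _; exact: lebesgue_Rd_hyperplane.
rewrite -H0; apply: le_measure; rewrite ?inE// => x.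
rewrite ysectionE/= => /= xt.
have : x \in t.
  by apply: contrapT => /negP nxt; apply: xt; rewrite offdiag_cons.
move=> /(nthP (thead (cons_pair (point : Rd R d'.+1, t))))[i].
rewrite size_tuple => ilen xi; rewrite /H.
rewrite -(bigcup_mkord n (fun i => [set x : Rd R d'.+1 | tnth x ord0 = c i :> R])).
exists i => //=.
by rewrite /c xi.
Qed.

(* [to_conf] is only known to be measurable off the diagonal, hence the junk value there. *)
Definition tuple_conf n (x : n.-tuple (Rd R d)) : conf R d :=
  if uniq x then to_conf x else fset0.

Lemma tuple_confE n (x : n.-tuple (Rd R d)) : offdiag x -> tuple_conf x = to_conf x.
Proof. by rewrite /offdiag/= /tuple_conf => ->. Qed.

Lemma card_tuple_conf n (x : n.-tuple (Rd R d)) : offdiag x -> #|` tuple_conf x| = n.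
Proof. by move=> ux; rewrite tuple_confE// (perm_size (size_to_conf ux)) size_tuple. Qed.

Lemma tuple_conf_preimage n (A : set (conf R d)) :
  @offdiag R d n `&` @tuple_conf n @^-1` A = @offdiag R d n `&` @to_conf R d n @^-1` A.
Proof. by apply/seteqP; split=> x /= [ux]; rewrite tuple_confE. Qed.

Lemma measurable_tuple_conf n : measurable_fun setT (@tuple_conf n).
Proof.
move=> _ A mA; rewrite setTI.
rewrite -[X in measurable X]setTI -(setUv (@offdiag R d n)) setIUl.
apply: measurableU; first by rewrite tuple_conf_preimage; exact: mA.
have mD : measurable (~` @offdiag R d n).
  by apply: measurableC; exact: measurable_offdiag.
have [A0|A0] := pselect (A fset0).
  rewrite (_ : _ `&` _ = ~` @offdiag R d n)//.
  apply/seteqP; split=> x; first by case.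
  by move=> ux; split=> //; move: ux => /negP; rewrite /tuple_conf/= => /negbTE ->.
rewrite (_ : _ `&` _ = set0)//; rewrite -subset0 => x [/negP ux].
by rewrite /tuple_conf/= (negbTE ux).
Qed.

(** The diagonals are null, so the junk value of [tuple_conf] there is invisible: the measure is a
    push-forward along a measurable map, and change of variables is available. *)
Lemma conf_measureE n (A : set (conf R d)) : (0 < d)%N -> measurable A ->
  conf_measure n A = m n (@tuple_conf n @^-1` A).
Proof.
move=> d0 mA; have mP : measurable (@tuple_conf n @^-1` A).
  by rewrite -[X in measurable X]setTI; exact: measurable_tuple_conf.
have mD := @measurable_offdiag R d n.
rewrite /conf_measure -tuple_conf_preimage.
rewrite -[in RHS](setTI (_ @^-1` _)) -(setUv (@offdiag R d n)) setIUl measureU0//.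
- exact: measurableI.
- by apply: measurableI => //; exact: measurableC.
- apply: (@subset_measure0 _ _ _ _ _ (~` @offdiag R d n)).
  + by apply: measurableI => //; exact: measurableC.
  + exact: measurableC.
  + exact: subIsetl.
  + exact: diagonal_null.
Qed.

Lemma ge0_integral_lambda (f : conf R d -> \bar R) : (0 < d)%N ->
  measurable_fun setT f -> (forall x, 0 <= f x) ->
  \int[lambda]_x f x = \sum_(n <oo) ((n`!%:R : R)^-1)%:E * \int[m n]_x f (tuple_conf x).
Proof.
move=> d0 mf f0; rewrite ge0_integral_measure_series//.
apply: eq_eseriesr => n _.
rewrite ge0_integral_mscale//=; congr (_ * _).
have mtc := @measurable_tuple_conf n.
rewrite -(ge0_integral_pushforward mtc (m n) measurableT)//.
by apply: eq_measure_integral => A mA _; exact: (conf_measureE n d0 mA).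
Qed.

Lemma ae_offdiag n : (0 < d)%N -> {ae m n, forall x, @offdiag R d n x}.
Proof.
move=> d0; exists (~` @offdiag R d n); split => //; last exact: diagonal_null.
by apply: measurableC; exact: measurable_offdiag.
Qed.

Hypothesis d_gt0 : (0 < d)%N.

Lemma integrable_tuple_conf (f : conf R d -> R) n :
  lambda.-integrable setT (EFin \o f) ->
  (m n).-integrable setT (EFin \o (f \o @tuple_conf n)).
Proof.
move=> /integrableP[mf foo]; apply/integrableP; split.
  by apply: measurableT_comp mf _; exact: measurable_tuple_conf.
move: foo; rewrite ge0_integral_lambda//; last exact: measurableT_comp.
pose a n := ((n`!%:R : R)^-1)%:E * \int[m n]_x `|(f (tuple_conf x))%:E|.
have a0 k : 0 <= a k by rewrite mule_ge0 ?lee_fin ?invr_ge0// integral_ge0.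
move=> h; have : a n < +oo.
  apply: le_lt_trans h; apply: le_trans (nneseries_lim_ge n.+1 _).
    by rewrite big_nat_recr//=; apply: leeDr; apply: sume_ge0 => i _; exact: a0.
  by move=> i _ _; exact: a0.
rewrite /a muleC; set I := \int[_]_x _; case: I => [r _||_].
- exact: ltry.
- by rewrite mulyr gtr0_sg ?mul1e// invr_gt0 ltr0n fact_gt0.
- by [].
Qed.

Local Open Scope ring_scope.

Definition component_integral n (f : conf R d -> R) : R :=
  n`!%:R^-1 * \int[m n]_x f (tuple_conf x).

Lemma ge0_cvg_Rintegral_lambda (f : conf R d -> R) :
  lambda.-integrable setT (EFin \o f) -> (forall x, 0 <= f x) ->
  series (fun n => component_integral n f) @ \oo --> \int[lambda]_x f x.
Proof.
move=> If f0.
pose a n := (((n`!%:R : R)^-1)%:E * \int[m n]_x (f (tuple_conf x))%:E)%E.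
have Ifn n := integrable_fin_num measurableT (integrable_tuple_conf n If).
have aE n : a n = (component_integral n f)%:E.
  by rewrite /a /component_integral EFinM fineK.
have a0 n : (0 <= a n)%E.
  rewrite mule_ge0 ?lee_fin ?invr_ge0//; apply: integral_ge0 => x _.
  by rewrite lee_fin.
have sE : (\int[lambda]_x (f x)%:E = \sum_(n <oo) a n)%E.
  by rewrite ge0_integral_lambda//; exact: measurable_int If.
have cv : (\sum_(0 <= i < n) a i @[n --> \oo] --> \sum_(n <oo) a n)%E.
  by apply: is_cvg_nneseries => n _ _.
rewrite -sE -(fineK (integrable_fin_num measurableT If)) in cv.
move/fine_cvg : cv => cv; apply: cvg_trans cv.
apply: near_eq_cvg; apply: nearW => n /=; rewrite /series/=.
by under eq_bigr do rewrite aE; rewrite sumEFin.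
Qed.

Lemma component_integralD n (f g : conf R d -> R) :
  lambda.-integrable setT (EFin \o f) -> lambda.-integrable setT (EFin \o g) ->
  component_integral n (fun x => f x + g x) =
    component_integral n f + component_integral n g.
Proof.
move=> If Ig; rewrite /component_integral RintegralD ?mulrDr//.
- exact: integrable_tuple_conf If.
- exact: integrable_tuple_conf Ig.
Qed.

(** Writing [f] as the difference of the nonnegative functions $f + |f|$ and $|f|$ reduces to the
    nonnegative case. *)
Lemma cvg_Rintegral_lambda (f : conf R d -> R) :
  lambda.-integrable setT (EFin \o f) ->
  series (fun n => component_integral n f) @ \oo --> \int[lambda]_x f x.
Proof.
move=> If; have Iaf : lambda.-integrable setT (EFin \o (fun x => `|f x|)).
  exact: integrable_abse If.
have Ig : lambda.-integrable setT (EFin \o (fun x => f x + `|f x|)).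
  by have := integrableD measurableT If Iaf; congr (_.-integrable _ _).
have g0 x : 0 <= f x + `|f x| by rewrite -lerBlDl sub0r -normrN ler_norm.
have c1 := ge0_cvg_Rintegral_lambda Ig g0.
have c2 := ge0_cvg_Rintegral_lambda Iaf (fun x => normr_ge0 (f x)).
have c3 := cvgB c1 c2; rewrite RintegralD// addrK in c3.
suff -> : series (component_integral^~ f) =
    series (component_integral^~ (fun x => f x + `|f x|)) -
    series (component_integral^~ (fun x => `|f x|)) by exact: c3.
apply/funext => N; rewrite !fctE /series/= -sumrB.
by apply: eq_bigr => n _; rewrite component_integralD// addrK.
Qed.

Lemma measurable_card (g : nat -> R) :
  measurable_fun setT (fun eta : conf R d => g #|` eta|).
Proof.
move=> _ A mA; rewrite setTI.
suff : conf_measurable ((fun eta : conf R d => g #|` eta|) @^-1` A) by [].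
move=> n; have gE x : @offdiag R d n x -> g #|` to_conf x| = g n.
  by move=> ux; rewrite -(tuple_confE ux) card_tuple_conf.
have [An|nAn] := pselect (A (g n)).
  rewrite (_ : _ `&` _ = @offdiag R d n); first exact: measurable_offdiag.
  by apply/seteqP; split=> x /= [] //; move=> ux; split=> //; rewrite gE.
rewrite (_ : _ `&` _ = set0)//; rewrite -subset0 => x /= [ux].
by rewrite gE.
Qed.

Lemma componentE (G : conf R d -> R) n x :
  component G n x = if uniq x then G (tuple_conf x) else 0.
Proof.
rewrite /component patchE; case: ifPn => ux.
  by rewrite inE/= in ux; rewrite ux /= tuple_confE.
by rewrite notin_setE in ux; rewrite (negbTE (introN idP ux)).
Qed.

Lemma component_ae (G : conf R d -> R) n :
  ae_eq (m n) setT (component G n) (G \o @tuple_conf n).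
Proof.
apply: filterS (ae_offdiag n d_gt0) => x ux _; rewrite componentE.
by rewrite /offdiag/= in ux; rewrite ux.
Qed.

Lemma measurable_component (G : conf R d -> R) n :
  measurable_fun setT G -> measurable_fun setT (component G n).
Proof.
move=> mG; rewrite (_ : component G n = (G \o @tuple_conf n) \_ (@offdiag R d n)).
  apply/(measurable_restrictT _ (@measurable_offdiag R d n)).
  apply: measurable_funTS; apply: measurableT_comp => //.
  exact: measurable_tuple_conf.
apply/funext => x; rewrite componentE patchE; case: ifPn => ux; last first.
  by rewrite memNset//; exact/negP.
by rewrite mem_set.
Qed.

Lemma component_Lfun (G : conf R d -> R) n : measurable_fun setT G ->
  (m n).-integrable setT (EFin \o (G \o @tuple_conf n)) ->
  component G n \in Lfun (m n) 1.
Proof.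
move=> mG IG; apply/Lfun1_integrable.
have mc : measurable_fun setT (EFin \o component G n).
  by apply/measurable_EFinP; exact: measurable_component.
apply/integrableP; split=> //; have /integrableP[mtc] := IG; apply: le_lt_trans.
apply: ae_ge0_le_integral => //.
- exact: measurableT_comp.
- exact: measurableT_comp.
- by apply: filterS (component_ae G n) => x /= /(_ I) ->.
Qed.

Lemma component_classE (G : conf R d -> R) n : measurable_fun setT G ->
  (m n).-integrable setT (EFin \o (G \o @tuple_conf n)) ->
  ae_eq (m n) setT (component_class G n) (G \o @tuple_conf n).
Proof.
move=> mG IG; apply: ae_eq_trans (component_ae G n).
rewrite /component_class insubT; first exact: component_Lfun.
by move=> cL; exact: LclassE.
Qed.

Lemma Xn_normE n (u : Xn R d n) (f : n.-tuple (Rd R d) -> R) :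
  measurable_fun setT f -> ae_eq (m n) setT u f -> `|u| = \int[m n]_x `|f x|.
Proof.
move=> mf uf; rewrite Lspace_normE (ae_eq_Lnorm _ _ _ uf)//; last first.
  exact: (@measurable_funPT _ _ _ _ (Lspace_repr u)).
by rewrite Lnorm1.
Qed.

End conf.

(** * Almost everywhere comparison of integrals *)

Section ae_integrable.
Context d (T : measurableType d) (R : realType) (mu : {measure set T -> \bar R}).

Lemma ae_le_integrable (f g : T -> R) : measurable_fun setT f ->
  {ae mu, forall x, `|f x| <= g x} -> mu.-integrable setT (EFin \o g) ->
  mu.-integrable setT (EFin \o f).
Proof.
move=> mf fg Ig; apply/integrableP; split; first exact/measurable_EFinP.
have /integrableP[mg] := Ig; apply: le_lt_trans; apply: ae_ge0_le_integral => //.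
- by apply: measurableT_comp => //; exact/measurable_EFinP.
- exact: measurableT_comp.
- by apply: filterS fg => x fgx _ /=; rewrite lee_fin (le_trans fgx)// ler_norm.
Qed.

Lemma ae_eq_Rintegral (f g : T -> R) : measurable_fun setT f -> measurable_fun setT g ->
  ae_eq mu setT f g -> \int[mu]_x f x = \int[mu]_x g x.
Proof.
move=> mf mg fg; congr fine; apply: ae_eq_integral => //.
- exact/measurable_EFinP.
- exact/measurable_EFinP.
- by apply: filterS fg => x /= + xT => /(_ xT) ->.
Qed.

(** Replacing [g] by the maximum of [f] and [g], a.e. equal to it, makes the inequality hold
    everywhere. *)
Lemma ae_le_Rintegral (f g : T -> R) : mu.-integrable setT (EFin \o f) ->
  mu.-integrable setT (EFin \o g) ->
  {ae mu, forall x, f x <= g x} -> \int[mu]_x f x <= \int[mu]_x g x.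
Proof.
move=> If Ig fg.
have mf : measurable_fun setT f by apply/measurable_EFinP; exact: measurable_int If.
have mg : measurable_fun setT g by apply/measurable_EFinP; exact: measurable_int Ig.
have mh : measurable_fun setT (fun x => Num.max (f x) (g x)) by exact: measurable_maxr.
have hg : ae_eq mu setT (fun x => Num.max (f x) (g x)) g.
  by apply: filterS fg => x fgx _; rewrite max_r.
rewrite -(ae_eq_Rintegral mh mg hg); apply: le_Rintegral => //.
  apply: ae_le_integrable (integrable_abse Ig) => //.
  by apply: filterS hg => x /(_ I) ->.
by move=> x _; rewrite le_max lexx.
Qed.

End ae_integrable.

Section Xn_ae.
Context (R : realType) (d n : nat).
Local Notation mu := (lebesgue_Rdn R d n).

Lemma measurable_Xn (u : Xn R d n) : measurable_fun setT (u : _ -> R).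
Proof. exact: (@measurable_funPT _ _ _ _ (Lspace_repr u)). Qed.

Lemma integrable_Xn (u : Xn R d n) : mu.-integrable setT (EFin \o u).
Proof. by apply/Lfun1_integrable; exact: Lspace_in_Lfun. Qed.

Lemma Xn_lincomb_ae (a : R) (u v : Xn R d n) :
  ae_eq mu setT (a *: u + v : Xn R d n) (fun x => a * u x + v x).
Proof.
have h1 := LclassE (Lspace_repr (Lclass (a *: Lspace_repr u)) + Lspace_repr v).
have h2 := LclassE (a *: Lspace_repr u).
apply: filterS2 h1 h2 => x /= /(_ I) e1 /(_ I) e2 _.
have -> : (a *: u + v : Xn R d n) x =
    Lclass (Lspace_repr (Lclass (a *: Lspace_repr u)) + Lspace_repr v) x by [].
by rewrite e1 /= !fctE /= e2.
Qed.

End Xn_ae.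

(** * Weighted spaces on configurations and their components *)

Section weighted.
Context (R : realType) (d : nat).
Hypothesis d_gt0 : (0 < d)%N.
Local Notation m n := (lebesgue_Rdn R d n).
Local Notation lambda := (lebesgue_poisson R d).
Local Notation tc := (@tuple_conf R d _).
Implicit Types (G H k : conf R d -> R) (C K P : R).

Local Notation intl f := (lambda.-integrable setT (EFin \o f)).

Lemma measurable_tuple_conf_comp G n :
  measurable_fun setT G -> measurable_fun setT (G \o @tuple_conf R d n).
Proof. by move=> mG; apply: measurableT_comp => //; exact: measurable_tuple_conf. Qed.

Lemma weighted_L1P C G : 0 < C -> G \in weighted_L1 C <->
  measurable_fun setT G /\ intl (fun eta => `|G eta| * C ^+ #|` eta|).
Proof.
move=> C0; rewrite /weighted_L1 inE/=.
have mC : measurable_fun setT (fun eta : conf R d => C ^+ #|` eta|).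
  exact: (@measurable_card R d (fun n => C ^+ n)).
have mC' : measurable_fun setT (fun eta : conf R d => C ^- #|` eta|).
  exact: (@measurable_card R d (fun n => C ^- n)).
have Ce (eta : conf R d) : 0 < C ^+ #|` eta| by rewrite exprn_gt0.
split=> [/Lfun1_integrable IG|[mG IG]].
  have mw : measurable_fun setT (fun eta : conf R d => G eta * C ^+ #|` eta|).
    by apply/measurable_EFinP; exact: measurable_int IG.
  split.
    have := measurable_funM mw mC'; congr (measurable_fun _ _); apply/funext => eta /=.
    by rewrite mulfK// gt_eqF.
  have := integrable_abse IG; congr (_.-integrable _ _); apply/funext => eta /=.
  by rewrite normrM (gtr0_norm (Ce eta)).
apply/Lfun1_integrable; apply: ae_le_integrable IG.
  exact: measurable_funM.
by apply: aeW => eta; rewrite normrM (gtr0_norm (Ce eta)).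
Qed.

Lemma weighted_L1_tuple_conf C G n : 0 < C -> G \in weighted_L1 C ->
  (m n).-integrable setT (EFin \o (G \o @tuple_conf R d n)).
Proof.
move=> C0 /(weighted_L1P _ C0)[mG IG].
have C' := exprn_gt0 n C0.
have I1 := integrable_tuple_conf d_gt0 n IG.
apply: ae_le_integrable (integrableZl measurableT (C ^- n) I1).
  exact: measurable_tuple_conf_comp.
apply: filterS (@ae_offdiag R d n d_gt0) => x ux /=.
by rewrite card_tuple_conf// mulrC mulfK// gt_eqF.
Qed.

Lemma component_integral_norm C G n : 0 < C -> measurable_fun setT G ->
  (m n).-integrable setT (EFin \o (G \o @tuple_conf R d n)) ->
  component_integral n (fun eta => `|G eta| * C ^+ #|` eta|) =
    C ^+ n / n`!%:R * `|component_class G n|.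
Proof.
move=> C0 mG IG; have mGt := @measurable_tuple_conf_comp G n mG.
rewrite (Xn_normE mGt (component_classE d_gt0 mG IG)).
rewrite -mulrA mulrCA /component_integral; congr (_ * _).
rewrite -RintegralZl//; last exact: integrable_abse IG.
apply: ae_eq_Rintegral.
- apply: (@measurable_tuple_conf_comp (fun eta => `|G eta| * C ^+ #|` eta|)).
  apply: measurable_funM; first exact: measurableT_comp.
  exact: (@measurable_card R d (fun n => C ^+ n)).
- by apply: measurable_funM => //; exact: measurableT_comp.
- apply: filterS (@ae_offdiag R d n d_gt0) => x ux _ /=.
  by rewrite card_tuple_conf// mulrC.
Qed.

Definition components G : forall n, Xn R d n := component_class G.

Lemma weighted_L1_wbound C G : 0 < C -> G \in weighted_L1 C ->
  wbound C (components G) (\int[lambda]_eta (`|G eta| * C ^+ #|` eta|)).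
Proof.
move=> C0 GC M; have [mG IG] := (weighted_L1P _ C0).1 GC.
have cv := cvg_Rintegral_lambda d_gt0 IG.
rewrite -(cvg_lim _ cv)//.
have nd : nondecreasing_seq
    (series (fun n => component_integral n (fun eta => `|G eta| * C ^+ #|` eta|))).
  apply: nondecreasing_series => n _ _.
  rewrite component_integral_norm//; last exact: weighted_L1_tuple_conf GC.
  by rewrite !mulr_ge0 ?exprn_ge0 ?invr_ge0// ltW.
have := nondecreasing_cvgn_le nd (cvgP _ cv) M; apply: le_trans.
rewrite /series/= big_mkord /wnorm; apply: ler_sum => n _.
rewrite component_integral_norm//; exact: weighted_L1_tuple_conf GC.
Qed.

(** Converse of [weighted_L1_wbound]. Each level of [H] is integrable because [u n] is, so
    [component_class] does not fall back on its default 0; summing the levels bounds the weighted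
    integral by [P]. *)
Lemma has_components_weighted (u : forall n, Xn R d n) H C P : 0 < C ->
  has_components u H -> wbound C u P ->
  H \in weighted_L1 C /\ components H = u.
Proof.
move=> C0 [mH uH] uP.
have Hu n : ae_eq (m n) setT (H \o @tuple_conf R d n) (u n).
  apply: filterS2 (uH n) (@ae_offdiag R d n d_gt0) => x /= + ux _ => /(_ ux) <-.
  by rewrite tuple_confE.
have IH n : (m n).-integrable setT (EFin \o (H \o @tuple_conf R d n)).
  apply: ae_le_integrable (integrable_abse (integrable_Xn (u n))).
    exact: measurable_tuple_conf_comp.
  by apply: filterS (Hu n) => x /(_ I) /= ->.
have cH n : component_class H n = u n.
  apply: LspaceP; apply: ae_eq_trans (Hu n); exact: component_classE.
split; last by apply: functional_extensionality_dep.
apply/weighted_L1P => //; split=> //.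
have mw : measurable_fun setT (fun eta : conf R d => `|H eta| * C ^+ #|` eta|).
  apply: measurable_funM; first exact: measurableT_comp.
  exact: (@measurable_card R d (fun n => C ^+ n)).
have w0 (eta : conf R d) : 0 <= `|H eta| * C ^+ #|` eta|.
  by rewrite mulr_ge0// exprn_ge0// ltW.
apply/integrableP; split; first exact/measurable_EFinP.
rewrite ge0_integral_lambda//; last first.
  by apply: measurableT_comp => //; exact/measurable_EFinP.
apply: (@le_lt_trans _ _ P%:E); last exact: ltry.
apply: lime_le.
  by apply: is_cvg_nneseries => n _ _; rewrite mule_ge0 ?lee_fin ?invr_ge0// integral_ge0.
apply: nearW => M /=; apply: le_trans (_ : (wnorm C M u)%:E <= _)%E; last first.
  by rewrite lee_fin; exact: uP.
rewrite big_mkord /wnorm -sumEFin; apply: lee_sum => n _.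
rewrite -cH -component_integral_norm// /component_integral EFinM fineK.
  rewrite le_eqVlt; apply/orP; left; apply/eqP; congr (_ * _)%E.
  by apply: eq_integral => x _; rewrite ger0_norm ?w0.
have mwt : measurable_fun setT (fun x : n.-tuple (Rd R d) => `|H (tc x)| * C ^+ #|` tc x|).
  exact: (@measurable_tuple_conf_comp _ n mw).
apply: integrable_fin_num => //.
apply: ae_le_integrable (integrableZl measurableT (C ^+ n) (integrable_abse (IH n))) => //.
apply: filterS (@ae_offdiag R d n d_gt0) => x ux /=.
by rewrite ger0_norm ?w0// card_tuple_conf// mulrC.
Qed.

Lemma componentsP C (a : R) G H : 0 < C -> G \in weighted_L1 C -> H \in weighted_L1 C ->
  components (fun eta => a * G eta + H eta) =
    fun n => a *: components G n + components H n.
Proof.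
move=> C0 GC HC.
have [mG _] := (weighted_L1P _ C0).1 GC; have [mH _] := (weighted_L1P _ C0).1 HC.
apply: functional_extensionality_dep => n; apply: LspaceP.
have IG := weighted_L1_tuple_conf n C0 GC; have IH := weighted_L1_tuple_conf n C0 HC.
have mS : measurable_fun setT (fun eta : conf R d => a * G eta + H eta).
  by apply: measurable_funD => //; exact: measurable_funM.
have IS : (m n).-integrable setT (EFin \o ((fun eta => a * G eta + H eta) \o @tuple_conf R d n)).
  have := integrable_lincomb a IG IH; congr (_.-integrable _ _).
apply: ae_eq_trans (component_classE d_gt0 mS IS) _; apply: ae_eq_sym.
apply: ae_eq_trans (Xn_lincomb_ae _ _ _) _.
apply: filterS2 (component_classE d_gt0 mG IG) (component_classE d_gt0 mH IH) => x.
by move=> /(_ I) /= E1 /(_ I) /= E2 _; rewrite /components E1 E2.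
Qed.

Lemma lebesgue_poissonE (A : set (conf R d)) : measurable A ->
  lambda A = (\sum_(n <oo) ((n`!%:R : R)^-1)%:E * m n (@tuple_conf R d n @^-1` A))%E.
Proof.
move=> mA; rewrite /lebesgue_poisson/= /mseries; apply: eq_eseriesr => n _.
transitivity ((n`!%:R^-1)%:E * conf_measure n A)%E => //.
by rewrite conf_measureE.
Qed.

(** Each level enters the Lebesgue-Poisson measure with the positive weight $1/n!$, so a null set is
    null on every level. *)
Lemma ae_tuple_conf n (P : conf R d -> Prop) :
  {ae lambda, forall eta, P eta} -> {ae m n, forall x, P (@tuple_conf R d n x)}.
Proof.
move=> [N [mN N0 PN]]; exists (@tuple_conf R d n @^-1` N); split.
- by rewrite -[X in measurable X]setTI; exact: measurable_tuple_conf.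
- pose a n := (((n`!%:R : R)^-1)%:E * m n (@tuple_conf R d n @^-1` N))%E.
  have a0 i : (0 <= a i)%E by rewrite mule_ge0 ?lee_fin ?invr_ge0.
  have : (a n <= 0)%E.
    rewrite -N0 lebesgue_poissonE//; apply: le_trans (nneseries_lim_ge n.+1 _).
      by rewrite big_nat_recr//=; apply: leeDr; apply: sume_ge0 => i _; exact: a0.
    by move=> i _ _; exact: a0.
  rewrite /a pmule_rle0 ?lte_fin ?invr_gt0 ?ltr0n ?fact_gt0// => h.
  by apply/eqP; rewrite eq_le h measure_ge0.
- by move=> x /= nP; exact: PN.
Qed.

Lemma weighted_Linfty_measurable C k : 0 < C -> k \in weighted_Linfty C ->
  measurable_fun setT k.
Proof.
move=> C0 /andP[]; rewrite inE/= => mw _.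
have := measurable_funM mw (@measurable_card R d (fun n => C ^+ n)).
congr (measurable_fun _ _); apply/funext => eta /=.
by rewrite mulfVK// gt_eqF// exprn_gt0.
Qed.

Lemma weighted_Linfty_norm_fin C k : k \in weighted_Linfty C ->
  weighted_Linfty_norm C k \is a fin_num.
Proof.
move=> /andP[_]; rewrite inE/= /finite_norm => h.
by rewrite ge0_fin_numE ?Lnorm_ge0.
Qed.

Lemma weighted_Linfty_norm_ge0 C k : 0 <= fine (weighted_Linfty_norm C k).
Proof. by rewrite fine_ge0// Lnorm_ge0. Qed.

Lemma weighted_Linfty_ae C k : 0 < C -> k \in weighted_Linfty C ->
  {ae lambda, forall eta, `|k eta| <= fine (weighted_Linfty_norm C k) * C ^+ #|` eta|}.
Proof.
move=> C0 kC; have nfin := weighted_Linfty_norm_fin kC.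
have Ce (eta : conf R d) : 0 < C ^+ #|` eta| by rewrite exprn_gt0.
(* The $L^\infty$ norm is 0 by convention when the whole space is null, a case split off here. *)
case: (ltP 0%E (lambda setT)) => [l0|l0]; last first.
  exists setT; split => //; apply/eqP; rewrite eq_le measure_ge0 andbT.
  exact: l0.
have h := ess_sup_ge lambda (abse \o (EFin \o (fun eta => (k eta * C ^- #|` eta|)))).
apply: filterS h => eta /=.
have -> : ess_sup lambda (abse \o (EFin \o (fun eta => (k eta * C ^- #|` eta|)))) =
    weighted_Linfty_norm C k.
  by rewrite /weighted_Linfty_norm unlock l0.
rewrite -(fineK nfin) lee_fin normrM normfV (gtr0_norm (Ce eta)).
by rewrite ler_pdivrMr.
Qed.

Lemma weighted_Linfty_le C k K : 0 < C -> 0 <= K -> measurable_fun setT k ->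
  (forall eta, `|k eta| <= K * C ^+ #|` eta|) ->
  k \in weighted_Linfty C /\ (weighted_Linfty_norm C k <= K%:E)%E.
Proof.
move=> C0 K0 mk kK.
have Ce (eta : conf R d) : 0 < C ^+ #|` eta| by rewrite exprn_gt0.
have nK : (weighted_Linfty_norm C k <= K%:E)%E.
  rewrite /weighted_Linfty_norm unlock; case: ifPn => _; last by rewrite lee_fin.
  apply/ess_supP; apply: aeW => eta /=.
  by rewrite lee_fin normrM normfV (gtr0_norm (Ce eta)) ler_pdivrMr.
split=> //; apply/andP; split; rewrite inE/=.
  by apply: measurable_funM => //; exact: (@measurable_card R d (fun n => C ^- n)).
exact: le_lt_trans nK (ltry _).
Qed.

Section functional.
Variables (C0 : R) (k : conf R d -> R).
Hypotheses (C0_gt0 : 0 < C0) (kC : k \in weighted_Linfty C0).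
Let K := fine (weighted_Linfty_norm C0 k).

Let mk : measurable_fun setT k. Proof. exact: weighted_Linfty_measurable kC. Qed.

Lemma integrable_XnM n (u : Xn R d n) :
  (m n).-integrable setT (EFin \o (fun x => u x * k (@tuple_conf R d n x))).
Proof.
apply: ae_le_integrable (integrableZl measurableT (K * C0 ^+ n)
    (integrable_abse (integrable_Xn u))) => /=.
  by apply: measurable_funM; [exact: measurable_Xn|exact: measurable_tuple_conf_comp].
apply: filterS2 (ae_tuple_conf n (weighted_Linfty_ae C0_gt0 kC)) (@ae_offdiag R d n d_gt0).
move=> x + ux; rewrite card_tuple_conf// => h.
by rewrite normrM mulrC ler_wpM2r.
Qed.

Definition dual_component n (u : Xn R d n) : R :=
  n`!%:R^-1 * \int[m n]_x (u x * k (@tuple_conf R d n x)).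

Lemma dual_component_is_linear n :
  GRing.linear_for *%R (@dual_component n : Xn R d n -> R).
Proof.
move=> a u v; rewrite /dual_component mulrCA -mulrDr; congr (_ * _).
rewrite -RintegralZl//; last exact: integrable_XnM.
rewrite -RintegralD//; last 2 first.
- exact: (integrableZl measurableT a (integrable_XnM u)).
- exact: integrable_XnM.
have mkt := @measurable_tuple_conf_comp k n mk.
apply: ae_eq_Rintegral.
- by apply: measurable_funM => //; exact: measurable_Xn.
- apply: measurable_funD; last by apply: measurable_funM => //; exact: measurable_Xn.
  apply: measurable_funM => //.
  by apply: measurable_funM => //; exact: measurable_Xn.
- by apply: filterS (Xn_lincomb_ae a u v) => x /(_ I) /= -> _; rewrite mulrDl mulrA.
Qed.

HB.instance Definition _ n := GRing.isLinear.Build R (Xn R d n) R *%R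
  (@dual_component n) (@dual_component_is_linear n).

Definition dual_functional n : {scalar Xn R d n} := @dual_component n.

Lemma dual_functional_le n (u : Xn R d n) :
  `|dual_functional n u| <= K * (C0 ^+ n / n`!%:R) * `|u|.
Proof.
rewrite /dual_functional/= /dual_component normrM normfV normr_nat.
rewrite mulrA [leRHS]mulrAC [leRHS]mulrC ler_wpM2l ?invr_ge0//.
apply: le_trans (le_normr_Rintegral measurableT (integrable_XnM u)) _.
rewrite (Xn_normE (measurable_Xn u)); last exact: ae_eq_refl.
rewrite -RintegralZl//; last exact: integrable_abse (integrable_Xn u).
apply: ae_le_Rintegral.
- exact: integrable_abse (integrable_XnM u).
- exact: (integrableZl measurableT _ (integrable_abse (integrable_Xn u))).
apply: filterS2 (ae_tuple_conf n (weighted_Linfty_ae C0_gt0 kC)) (@ae_offdiag R d n d_gt0).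
move=> x + ux; rewrite card_tuple_conf// => h.
by rewrite normrM mulrC ler_wpM2r.
Qed.

Lemma integrable_pairing G : G \in weighted_L1 C0 -> intl (fun eta => G eta * k eta).
Proof.
move=> GC; have [mG IG] := (weighted_L1P _ C0_gt0).1 GC.
apply: ae_le_integrable (integrableZl measurableT K IG).
  exact: measurable_funM.
apply: filterS (weighted_Linfty_ae C0_gt0 kC) => eta h /=.
by rewrite normrM mulrCA ler_wpM2l.
Qed.

Lemma pairingE G : G \in weighted_L1 C0 ->
  pairing G k = limn (series (fun n => dual_functional n (components G n))).
Proof.
move=> GC; have [mG _] := (weighted_L1P _ C0_gt0).1 GC.
have cv := cvg_Rintegral_lambda d_gt0 (integrable_pairing GC).
rewrite /pairing -(cvg_lim _ cv)//; congr (limn (series _)); apply/funext => n.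
rewrite /component_integral /dual_functional/= /dual_component; congr (_ * _).
have IG := weighted_L1_tuple_conf n C0_gt0 GC.
have mkt := @measurable_tuple_conf_comp k n mk.
have mGt := @measurable_tuple_conf_comp G n mG.
apply: ae_eq_Rintegral.
- exact: measurable_funM.
- by apply: measurable_funM => //; exact: measurable_Xn.
- by apply: filterS (component_classE d_gt0 mG IG) => x /(_ I) /= E _; rewrite /components E.
Qed.

End functional.

End weighted.

(** * Powers of a set of finite measure *)

Section iter_measure_power.
Context d (T : measurableType d) (R : realType).
Variable mu : {sigma_finite_measure set T -> \bar R}.

Lemma measurable_tuple_all n (S : set T) : measurable S ->
  measurable [set t : n.-tuple T | forall i, S (tnth t i)].
Proof.
move=> mS; rewrite (_ : [set t | _] =
    \bigcap_(i in [set: 'I_n]) ((fun t : n.-tuple T => tnth t i) @^-1` S)).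
  apply: fin_bigcap_measurable; first exact: finite_finset.
  by move=> i _; rewrite -[X in measurable X]setTI; exact: measurable_tnth.
by apply/seteqP; split=> t /= h i; [move=> _; exact: h|exact: h].
Qed.

Lemma iter_measure_power_fin n (S : set T) : measurable S -> (mu S < +oo)%E ->
  (iter_measure mu n [set t : n.-tuple T | forall i, S (tnth t i)] < +oo)%E.
Proof.
move=> mS Soo; elim: n => [|n IH] /=; first by rewrite diracE ltry.
rewrite /cons_measure /pushforward.
rewrite (_ : _ @^-1` _ = S `*` [set t : n.-tuple T | forall i, S (tnth t i)]).
  rewrite product_measure1E//; last exact: measurable_tuple_all.
  by apply: lte_mul_pinfty => //; rewrite ge0_fin_numE.
apply/seteqP; split=> -[x t] /= h.
  split=> [|i]; first exact: (h ord0).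
  by have := h (lift ord0 i); rewrite tnthS.
case: h => Sx St i; case: (unliftP ord0 i) => [j ->|->]; last exact: Sx.
by rewrite tnthS; exact: St.
Qed.

End iter_measure_power.

(** * Test functions, sigma-finiteness, and duality of the weighted spaces *)

Section conf_duality.
Context (R : realType) (d : nat).
Hypothesis d_gt0 : (0 < d)%N.
Local Notation m n := (lebesgue_Rdn R d n).
Local Notation lambda := (lebesgue_poisson R d).
Local Notation tc := (@tuple_conf R d _).
Implicit Types (G H k : conf R d -> R) (C K P : R).

Definition box (M : R) : set (Rd R d) := [set x | forall i, `|tnth x i : R| <= M].

Let ball_itv (M : R) : [set x : measurableTypeR R | `|x : R| <= M] = `[- M, M]%classic.
Proof. by apply/seteqP; split=> x /=; rewrite in_itv/= ler_norml. Qed.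

Lemma measurable_box M : measurable (box M).
Proof.
apply: (measurable_tuple_all (S := [set x : measurableTypeR R | `|x : R| <= M])).
by rewrite ball_itv; exact: measurable_itv.
Qed.

Lemma lebesgue_box_fin M : (lebesgue_Rd R d (box M) < +oo)%E.
Proof.
apply: (@iter_measure_power_fin _ _ _ _ d [set x : measurableTypeR R | `|x : R| <= M]).
  by rewrite ball_itv; exact: measurable_itv.
rewrite ball_itv [X in (X < _)%E](lebesgue_measure_itv `[- M, M]) /=.
by case: ifP => _; rewrite ltry.
Qed.

Lemma measurable_conf_all (N : nat) (S : set (Rd R d)) : measurable S ->
  measurable [set eta : conf R d | (#|` eta| <= N)%N /\ forall x, x \in eta -> S x].
Proof.
move=> mS; set A := [set eta | _]; suff : conf_measurable A by [].
move=> n; have [nN|Nn] := leqP n N; last first.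
  rewrite (_ : _ `&` _ = set0)//; rewrite -subset0 => x /= [ux [+ _]].
  by rewrite -(tuple_confE ux) card_tuple_conf// leqNgt Nn.
rewrite (_ : _ `&` _ = @offdiag R d n `&` [set x | forall i, S (tnth x i)]).
  by apply: measurableI; [exact: measurable_offdiag|exact: measurable_tuple_all].
apply/seteqP; split=> x /= [ux].
  by move=> [_ h]; split=> // i; apply: h; rewrite !inE/= mem_tnth.
move=> h; split=> //; split.
  by rewrite -(tuple_confE ux) card_tuple_conf.
by move=> y; rewrite !inE/= => /tnthP[i ->].
Qed.

Lemma component0 n (G : conf R d -> R) : measurable_fun setT G ->
  (forall x, @offdiag R d n x -> G (tc x) = 0) -> component_class G n = 0.
Proof.
move=> mG G0; have G0' : ae_eq (m n) setT (G \o tc) (cst 0).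
  by apply: filterS (@ae_offdiag R d n d_gt0) => x /G0.
have IG : (m n).-integrable setT (EFin \o (G \o @tuple_conf R d n)).
  apply: ae_le_integrable (integrable0 _ _) => //.
    exact: measurable_tuple_conf_comp.
  by apply: filterS G0' => x /(_ I) /= ->; rewrite normr0.
apply: LspaceP; apply: ae_eq_trans (component_classE d_gt0 mG IG) _.
by apply: ae_eq_trans G0' _; apply: ae_eq_sym; exact: (@LclassE _ _ _ _ _ _ 0).
Qed.

Lemma wbound_support (C : R) (y : forall n, Xn R d n) N : 0 <= C ->
  (forall n, (N < n)%N -> y n = 0) -> wbound C y (wnorm C N.+1 y).
Proof.
move=> C0 y0 M; apply: (@le_trans _ _ (wnorm C (N.+1 + M) y)).
  rewrite /wnorm addnC big_split_ord/= lerDl sumr_ge0// => i _.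
  by rewrite !mulr_ge0 ?exprn_ge0 ?invr_ge0.
rewrite /wnorm big_split_ord/= [X in _ + X]big1 ?addr0// => i _.
by rewrite y0 ?normr0 ?mulr0// ltnS leq_addr.
Qed.

(** Boundedness of [G] and the finite measure of the powers of a box containing [Lambda] make every
    level integrable, so that the classes really describe [G]. *)
Lemma Bbs_components G : Bbs G -> exists2 N,
  (forall n, (N < n)%N -> components G n = 0) & has_components (components G) G.
Proof.
move=> [mG [M GM] [N [Lambda [mL [r bL] G0]]]]; exists N.
  move=> n Nn; apply: component0 => // x ux; apply: G0 => -[].
  by rewrite card_tuple_conf// leqNgt Nn.
split=> // n.
pose S := [set x : n.-tuple (Rd R d) | forall i, box r (tnth x i)].
have mS : measurable S by apply: measurable_tuple_all; exact: measurable_box.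
have Soo : (m n S < +oo)%E.
  by apply: iter_measure_power_fin; [exact: measurable_box|exact: lebesgue_box_fin].
have IS : (m n).-integrable setT (EFin \o (fun x => `|M| * \1_S x)).
  exact: (integrableZl measurableT `|M| (integrable_indic_fin mS Soo)).
have IG : (m n).-integrable setT (EFin \o (G \o @tuple_conf R d n)).
  apply: ae_le_integrable IS; first exact: measurable_tuple_conf_comp.
  apply: filterS (@ae_offdiag R d n d_gt0) => x ux /=.
  have [Sx|nSx] := pselect (S x).
    by rewrite indicE mem_set// mulr1 (le_trans (GM _))// ler_norm.
  rewrite G0 ?normr0 ?mulr_ge0// => -[_ h]; apply: nSx => i.
  by apply: bL; apply: h; rewrite tuple_confE// !inE/= mem_tnth.
apply: filterS (component_classE d_gt0 mG IG) => x /(_ I) E ux.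
by rewrite /components E /= tuple_confE.
Qed.

Lemma Bbs_weighted_L1 G C : 0 < C -> Bbs G -> G \in weighted_L1 C.
Proof.
move=> C0 /Bbs_components[N G0 hG].
by have [] := has_components_weighted d_gt0 C0 hG (wbound_support (ltW C0) G0).
Qed.

(** The exhausting sets allow at most [N] points, all in a box of half-side [N]; their indicators
    belong to [Bbs], hence are integrable. *)
Lemma lebesgue_poisson_sigma_finite : sigma_finite setT lambda.
Proof.
exists (fun N => [set eta : conf R d |
    (#|` eta| <= N)%N /\ forall x, x \in eta -> box N%:R x]).
  apply/esym; rewrite -subTset => eta _.
  (* The sum of all absolute coordinates dominates each of them. *)
  pose s := \sum_(x <- eta) \sum_(i < d) `|tnth x i : R|.
  pose N := maxn #|` eta| (Num.truncn s).+1.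
  exists N => //; split; first exact: leq_maxl.
  move=> x xeta i; apply: (@le_trans _ _ s).
    rewrite /s (big_rem x)//=; rewrite (bigD1 i)//= -addrA lerDl addr_ge0//.
      exact: sumr_ge0.
    by apply: sumr_ge0 => y _; exact: sumr_ge0.
  apply: (@le_trans _ _ (Num.truncn s).+1%:R); first exact/ltW/truncnS_gt.
  by rewrite ler_nat leq_maxr.
move=> N; set A := [set eta | _].
have mA : measurable A by apply: measurable_conf_all; exact: measurable_box.
split=> //.
have BA : Bbs (\1_A : conf R d -> R).
  split=> //.
    by exists 1 => eta; rewrite indicE; case: (_ \in _); rewrite ?normr1 ?normr0.
  exists N, (box N%:R); split.
  - exact: measurable_box.
  - by exists N%:R.
  - by move=> eta h; rewrite indicE memNset.
have /(weighted_L1P _ ltr01)[_ /integrableP[_]] := Bbs_weighted_L1 ltr01 BA.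
rewrite (eq_integral (fun eta => (\1_A eta)%:E)); last first.
  by move=> eta _ /=; rewrite expr1n mulr1 normr_id ger0_norm.
by rewrite integral_indic// setIT.
Qed.

(** A copy under a new name, to carry the sigma-finite structure on which [L1_dual] relies. *)
Definition lebesgue_poisson_fun : set (conf R d) -> \bar R := lebesgue_poisson R d.

HB.instance Definition _ := Measure.copy lebesgue_poisson_fun (lebesgue_poisson R d).

HB.instance Definition _ := Measure_isSigmaFinite.Build _ _ _ lebesgue_poisson_fun
  lebesgue_poisson_sigma_finite.

(** Multiplication by $C^{|\eta|}$ is an isometry of $\mathcal{L}_C$ onto $L^1(\lambda)$, with
    inverse [scale]. The density [h] of the transported functional gives $k = h\,C^{|\eta|}$. *)
Lemma conf_dual C K (Psi : (forall n, Xn R d n) -> R) : 0 < C -> 0 <= K ->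
  (forall (a : R) y z P Q, wbound C y P -> wbound C z Q ->
    Psi (fun n => a *: y n + z n) = a * Psi y + Psi z) ->
  (forall y P, wbound C y P -> `|Psi y| <= K * P) ->
  exists k, [/\ k \in weighted_Linfty C, (weighted_Linfty_norm C k <= K%:E)%E &
    forall G, G \in weighted_L1 C -> Psi (components G) = pairing G k].
Proof.
move=> C0 K0 Plin Ple.
pose lam : {sigma_finite_measure set (conf R d) -> \bar R} :=
  lebesgue_poisson_fun.
have Ce (eta : conf R d) : C ^+ #|` eta| != 0 by rewrite gt_eqF// exprn_gt0.
pose scale f := fun eta : conf R d => f eta * C ^- #|` eta| : R.
have sL f : lam.-integrable setT (EFin \o f) -> scale f \in weighted_L1 C.
  move=> If; rewrite /weighted_L1 inE/=; apply/Lfun1_integrable.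
  have -> : (fun eta => scale f eta * C ^+ #|` eta|) = f => //.
  by apply/funext => eta; rewrite /scale mulfVK.
have PL : L1_functional lam K (fun f => Psi (components (scale f))).
  split=> [a f g If Ig|f If].
    have -> : scale (fun x => a * f x + g x) = fun eta => a * scale f eta + scale g eta.
      by apply/funext => eta; rewrite /scale mulrDl mulrA.
    rewrite (componentsP d_gt0 _ C0 (sL _ If) (sL _ Ig)) (Plin _ _ _ _ _
      (weighted_L1_wbound d_gt0 C0 (sL _ If)) (weighted_L1_wbound d_gt0 C0 (sL _ Ig))) //.
  have := Ple _ _ (weighted_L1_wbound d_gt0 C0 (sL _ If)).
  rewrite (_ : (fun eta => _) = fun eta => `|f eta|)//.
  apply/funext => eta; rewrite /scale normrM normfV normrX (gtr0_norm C0) mulfVK//.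
have [h [mh hK hE]] := L1_dual K0 PL.
pose k eta := h eta * C ^+ #|` eta|.
have [kC nk] : k \in weighted_Linfty C /\ (weighted_Linfty_norm C k <= K%:E)%E.
  apply: weighted_Linfty_le => //.
    by apply: measurable_funM => //; exact: (@measurable_card R d (fun n => C ^+ n)).
  by move=> eta; rewrite /k normrM normrX (gtr0_norm C0) ler_wpM2r// exprn_ge0// ltW.
exists k; split=> // G GC.
have IG : lam.-integrable setT (EFin \o (fun eta => G eta * C ^+ #|` eta|)).
  by apply/Lfun1_integrable; move: GC; rewrite /weighted_L1 inE.
have := hE _ IG; have -> : scale (fun eta => G eta * C ^+ #|` eta|) = G.
  by apply/funext => eta; rewrite /scale mulfK.
move=> ->; apply: eq_Rintegral => eta _; rewrite /k.
by rewrite mulrAC mulrA.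
Qed.

End conf_duality.

(** * Dissipativity of contraction generators, and calculus in the time variable *)

Section operators.
Context (R : realType).

Lemma operator_norm_le (V W : normedModType R) (f : {linear V -> W}) (c : R) :
  (operator_norm f <= c%:E)%E -> forall u, `|f u| <= c * `|u|.
Proof.
move=> fc u; have [->|u0] := eqVneq u 0; first by rewrite linear0 !normr0 mulr0.
have nu : 0 < `|u| by rewrite normr_gt0.
have : (`|f (`|u|^-1 *: u)|%:E <= c%:E)%E.
  apply: le_trans fc; apply: ereal_sup_ubound; exists (`|u|^-1 *: u) => //=.
  by rewrite normrZ ger0_norm ?invr_ge0// mulVf// gt_eqF.
rewrite lee_fin linearZ normrZ ger0_norm ?invr_ge0// mulrC.
by rewrite ler_pdivrMr.
Qed.

(* [(h + d) u] is the combination [d (u - h L u) + h (u + d L u)], and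
   [`|u + d L u| <= `|u| + o(d)] because [u + d L u = S d u + o(d)]. *)
Lemma contraction_generator_dissipative (V : normedModType R) (L : V -> V) :
  contraction_generator L -> forall h u, 0 <= h -> `|u| <= `|u - h *: L u|.
Proof.
move=> [S cS gS] h u; rewrite le_eqVlt => /predU1P[<-|h0].
  by rewrite scale0r subr0.
apply/ler_addgt0Pr => e e0.
(* The tolerance [e / h] becomes exactly [e] after multiplication by [h * d] and division by [d]. *)
have := gS u; move=> /cvgrPdist_le/(_ (e / h) (divr_gt0 e0 h0)) near1.
near (0 : R)^'+ => d.
have d0 : 0 < d by near: d; exact: nbhs_right_gt.
have rd : `|L u - d^-1 *: (S d u - u)| <= e / h by near: d.
have Sd : `|u + d *: L u| <= `|u| + d * (e / h).
  have -> : u + d *: L u = S d u + d *: (L u - d^-1 *: (S d u - u)).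
    rewrite scalerBr scalerA divff ?gt_eqF// scale1r opprB addrA addrAC.
    by rewrite [S d u + _]addrC subrK.
  apply: le_trans (ler_normD _ _) _; apply: lerD.
    by apply: (semigroup_contraction cS); exact: ltW.
  by rewrite normrZ gtr0_norm// ler_wpM2l// ltW.
have H : (h + d) * `|u| <= d * `|u - h *: L u| + h * (`|u| + d * (e / h)).
  rewrite -[X in X * _]gtr0_norm ?addr_gt0// -normrZ.
  have -> : (h + d) *: u = d *: (u - h *: L u) + h *: (u + d *: L u).
    rewrite scalerBr scalerDr !scalerA [h * d]mulrC addrA addrAC.
    by rewrite subrK -scalerDl addrC.
  apply: le_trans (ler_normD _ _) _; rewrite !normrZ !gtr0_norm//.
  by rewrite lerD2l ler_wpM2l// ltW.
rewrite -(ler_pM2l d0); have : h * (d * (e / h)) = d * e by field; rewrite gt_eqF.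
by move: H; rewrite !mulrDr mulrDl => H E; move: H; rewrite E; lra.
Unshelve. all: by end_near. Qed.

Lemma is_derive_taylor (F : R -> R) (t l c r : R) : 0 < r ->
  (forall s, `|s - t| < r -> `|F s - F t - (s - t) * l| <= (s - t) ^+ 2 * c) ->
  is_derive t 1 F l.
Proof.
move=> r0 H.
have cv : (fun h => h^-1 *: ((F \o shift t) (h *: 1) - F t)) @ (0 : R)^' --> l.
  apply/cvgrPdist_le => e e0; near=> h.
  have h0 : h != 0 by near: h; exact: nbhs_dnbhs_neq.
  have hr : `|h| < r by near: h; apply: dnbhs0_lt.
  have hc : `|h| * `|c| <= e.
    have h1 : `|h| <= e / (`|c| + 1).
      by near: h; apply: dnbhs0_le; rewrite divr_gt0// ltr_wpDl.
    move: h1; rewrite ler_pdivlMr ?ltr_wpDl// => h1.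
    by apply: le_trans h1; rewrite ler_wpM2l// lerDl.
  have := H (h + t); rewrite addrK => /(_ hr) H1.
  have hh : 0 < `|h| by rewrite normr_gt0.
  rewrite /= /GRing.scale/= mulr1 distrC.
  have -> : h^-1 * (F (h + t) - F t) - l = h^-1 * (F (h + t) - F t - h * l).
    by rewrite [RHS]mulrBr mulKf.
  rewrite normrM normfV ler_pdivrMl//.
  apply: le_trans H1 _; apply: le_trans (ler_norm _) _.
  by rewrite normrM normrX expr2 -mulrA ler_pM2l.
apply: DeriveDef.
  by apply: cvgP cv.
exact: cvg_lim cv.
Unshelve. all: by end_near. Qed.

Lemma within_continuous_lipschitz (F : R -> R) (T : R) :
  (forall T1, 0 < T1 < T -> exists c, forall s t, 0 <= s <= T1 -> 0 <= t <= T1 ->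
    `|F t - F s| <= `|t - s| * c) ->
  {within `[0, T[, continuous F}.
Proof.
move=> H; apply/subspace_continuousP => t; rewrite /= in_itv/= => /andP[t0 tT].
(* Lying strictly above [t], also when [t = 0], [T1] leaves room for a relative neighbourhood of [t]
   in $[0, T_1]$. *)
pose T1 := (t + T) / 2.
have T1T : 0 < T1 < T by rewrite /T1; apply/andP; split; lra.
have tT1 : t < T1 by rewrite /T1; lra.
have [c Hc] := H _ T1T.
apply/cvgrPdist_le => e e0; near=> s.
have sA : `[0, T[%classic s by near: s; apply: withinT.
move: sA; rewrite /= in_itv/= => /andP[s0 sT].
have st : `|t - s| < T1 - t.
  by near: s; apply: cvg_within; apply: nbhsx_ballx; rewrite subr_gt0.
have h1 : `|t - s| <= e / (`|c| + 1).
  apply/ltW; near: s; apply: cvg_within; apply: nbhsx_ballx.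
  by rewrite divr_gt0// ltr_wpDl.
have sT1 : s <= T1 by move: st; rewrite distrC => /(le_lt_trans (ler_norm _)); lra.
have tI : 0 <= t <= T1 by rewrite t0 ltW.
have sI : 0 <= s <= T1 by rewrite s0.
apply: le_trans (Hc _ _ sI tI) _.
move: h1; rewrite ler_pdivlMr ?ltr_wpDl//; apply: le_trans.
by rewrite ler_wpM2l// (le_trans (ler_norm _))// lerDl.
Unshelve. all: by end_near. Qed.

End operators.

(** * Symmetry of components, and linearity of the evolution in the initial datum *)

Section symmetric_components.
Context (R : realType) (d : nat).

Lemma symmetric_class0 n : symmetric_class (0 : Xn R d n).
Proof. by exists 0. Qed.

Lemma symmetric_component_class (G : conf R d -> R) n :
  symmetric_class (component_class G n).
Proof.
rewrite /component_class; case: insubP => [f _ fE|_]; last exact: symmetric_class0.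
exists f => // s x; have -> : (f : _ -> R) = component G n := fE.
have ps : perm_eq [tuple tnth x (s i) | i < n] x.
  by apply/tuple_permP; exists s.
rewrite !componentE (perm_uniq ps); case: ifPn => // ux.
congr G; rewrite !tuple_confE//; last by rewrite /offdiag/= (perm_uniq ps).
by apply/fsetP => y; rewrite !inE/= (perm_mem ps).
Qed.

End symmetric_components.

Lemma evolutionB (R : realType) (X : nat -> normedModType R)
    (l : forall n, {linear X n -> X n}) (w : forall n, {linear X n -> X n.+1})
    (f g h : forall m, {scalar X m}) (e t : R) (y : forall n, X n) :
  (forall m u, h m u = f m u - g m u) ->
  (forall m, cvgn (pseries (ecoef l w f e m y) t)) ->
  (forall m, cvgn (pseries (ecoef l w g e m y) t)) ->
  cvgn (series (fun m => evo l w f e m t y)) ->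
  cvgn (series (fun m => evo l w g e m t y)) ->
  evolution l w h e t y = evolution l w f e t y - evolution l w g e t y.
Proof.
move=> hE cf cg Cf Cg; rewrite /evolution -lim_seriesB//; congr (limn (series _)).
apply/funext => m; rewrite !fctE /evo -lim_seriesB; [|exact: cf|exact: cg].
congr (limn (series _)); apply/funext => j.
by rewrite /= !fctE /ecoef hE mulrBl mulrBl.
Qed.

Lemma dual_functionalB (R : realType) (d : nat) (d_gt0 : (0 < d)%N) (C0 : R)
    (C0_gt0 : 0 < C0) (k1 k2 : conf R d -> R) (k1C : k1 \in weighted_Linfty C0)
    (k2C : k2 \in weighted_Linfty C0) (k3C : k1 - k2 \in weighted_Linfty C0)
    n (u : Xn R d n) :
  dual_functional d_gt0 C0_gt0 k3C n u =
    dual_functional d_gt0 C0_gt0 k1C n u - dual_functional d_gt0 C0_gt0 k2C n u.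
Proof.
rewrite /dual_functional/= /dual_component -mulrBr -RintegralB//; last 2 first.
- exact: integrable_XnM k1C _ _.
- exact: integrable_XnM k2C _ _.
by congr (_ * _); apply: eq_Rintegral => x _; rewrite -mulrBr.
Qed.

Lemma weighted_L1_le (R : realType) (d : nat) (d_gt0 : (0 < d)%N) (C C' : R)
    (G : conf R d -> R) : 0 < C -> C <= C' -> G \in weighted_L1 C' -> G \in weighted_L1 C.
Proof.
move=> C0 CC' GC'; have C'0 := lt_le_trans C0 CC'.
have [mG IG] := (weighted_L1P G C'0).1 GC'; apply/(weighted_L1P G C0); split=> //.
apply: ae_le_integrable IG.
  apply: measurable_funM; first exact: measurableT_comp.
  exact: (@measurable_card R d (fun n => C ^+ n)).
apply: aeW => eta; rewrite ger0_norm ?mulr_ge0 ?exprn_ge0 ?(ltW C0)//.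
by rewrite ler_wpM2l// lerXn2r ?nnegrE ?(ltW C0) ?(ltW C'0).
Qed.

(** * The operators of the theorem as a triangular hierarchy *)

Section hierarchy_operators.
Context (R : realType) (d : nat) (A B : R)
  (L : forall n, {linear Xn R d n -> Xn R d n})
  (W : forall n, {linear Xn R d n.-1 -> Xn R d n}).

(** [L 0] is unconstrained and is replaced by 0; below, [W 1] is replaced by 0 because $(WG)^{(1)} =
    0$, and indices shift since [level_w n] starts from level [n]. *)
Definition level_l n : {linear Xn R d n -> Xn R d n} :=
  match n return {linear Xn R d n -> Xn R d n} with
  | 0 => \0
  | n.+1 => L n.+1
  end.

Definition level_w n : {linear Xn R d n -> Xn R d n.+1} :=
  match n return {linear Xn R d n -> Xn R d n.+1} with
  | 0 => \0
  | n.+1 => W n.+2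
  end.

(** A majorant of $An(n-1)$ without subtraction; its growth rate is immaterial, as it only enters
    for a fixed cut-off level. *)
Definition level_bound n : R := A * n%:R ^+ 2.

Hypotheses (d_gt0 : (0 < d)%N) (A_gt0 : 0 < A) (B_ge1 : 1 <= B)
  (L_gen : forall n, (1 <= n)%N -> contraction_generator (L n))
  (L_norm : forall n, (1 <= n)%N ->
    (operator_norm (L n) <= (A * n%:R * (n%:R - 1))%:E)%E)
  (W_norm : forall n, (1 <= n)%N ->
    (operator_norm (W n) <= (B * n%:R * (n%:R - 1))%:E)%E)
  (L_sym : forall n u, (1 <= n)%N -> symmetric_class u -> symmetric_class (L n u))
  (W_sym : forall n u, (1 <= n)%N -> symmetric_class u -> symmetric_class (W n u)).

Lemma level_bound_ge0 n : 0 <= level_bound n.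
Proof. by rewrite mulr_ge0// ltW. Qed.

Lemma level_bound_nd : {homo level_bound : m n / (m <= n)%N >-> m <= n}.
Proof.
move=> m n mn; rewrite /level_bound ler_wpM2l ?(ltW A_gt0)//.
by rewrite lerXn2r ?nnegrE// ler_nat.
Qed.

Lemma B_ge0 : 0 <= B. Proof. exact: le_trans B_ge1. Qed.

Lemma level_l_le n (u : Xn R d n) : `|level_l n u| <= level_bound n * `|u|.
Proof.
case: n u => [|n] u /=; first by rewrite normr0 mulr_ge0// level_bound_ge0.
apply: le_trans (operator_norm_le (L_norm (ltn0Sn n)) u) _.
rewrite ler_wpM2r// /level_bound -mulrA ler_wpM2l ?(ltW A_gt0)//.
by rewrite expr2 ler_wpM2l// gerBl.
Qed.

Lemma level_w_le n (u : Xn R d n) :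
  `|level_w n u| <= B * n.+1%:R * n%:R * `|u|.
Proof.
case: n u => [|n] u /=; first by rewrite normr0 mulr0 mul0r.
have := operator_norm_le (W_norm (ltn0Sn n.+1)) u.
by rewrite -[n.+2%:R in X in _ <= _ * X * _ -> _]natr1 addrK.
Qed.

Lemma level_l_dissipative n (h : R) (u : Xn R d n) :
  0 <= h -> `|u| <= `|u - h *: level_l n u|.
Proof.
case: n u => [|n] u h0 /=; first by rewrite scaler0 subr0.
exact: (contraction_generator_dissipative (L_gen (ltn0Sn n))).
Qed.

Lemma opL0_components G : Bbs G -> has_components (fun n => level_l n (components G n)) (opL0 L G).
Proof.
move=> BG; have -> : (fun n => level_l n (components G n)) = fun n => match n return Xn R d n with
    | 0 => 0
    | m.+1 => L m.+1 (component_class G m.+1)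
    end by apply: functional_extensionality_dep => -[|n].
apply: of_componentsP => -[|n]; first exact: symmetric_class0.
by apply: L_sym => //; exact: symmetric_component_class.
Qed.

Lemma opW_components G : Bbs G -> has_components (hgen level_l level_w 0 (components G)) (opW W G).
Proof.
move=> BG; have -> : hgen level_l level_w 0 (components G) = fun n => match n return Xn R d n with
    | m.+2 => W m.+2 (component_class G m.+1)
    | _ => 0
    end.
  apply: functional_extensionality_dep => -[|[|n]] /=; first by rewrite scaler0.
    by rewrite addr0 scale0r.
  by rewrite scale0r add0r.
apply: of_componentsP => -[|[|n]]; [exact: symmetric_class0|exact: symmetric_class0|].
by apply: W_sym => //; exact: symmetric_component_class.
Qed.

Lemma hgen_support e (y : forall n, Xn R d n) N : (forall n, (N < n)%N -> y n = 0) ->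
  forall n, (N.+1 < n)%N -> hgen level_l level_w e y n = 0.
Proof.
move=> y0 [//|n] Nn /=; rewrite y0; last exact: ltnW.
by rewrite y0// !linear0 ?scaler0 addr0.
Qed.

(** [opL0] and [opW] are choices up to null sets, made possible by symmetry of the components.
    Finitely many levels are nonzero, so these choices lie in every weighted space and their
    components can be read off. *)
Lemma generator_components e C G : 0 < C -> Bbs G ->
  e *: opL0 L G + opW W G \in weighted_L1 C /\
  components (e *: opL0 L G + opW W G) = hgen level_l level_w e (components G).
Proof.
move=> C0 BG; have [N G0 _] := Bbs_components d_gt0 BG.
have l0 n : (N < n)%N -> level_l n (components G n) = 0.
  by move=> Nn; rewrite G0// linear0.
have w0 := hgen_support 0 G0.
have [IL EL] := has_components_weighted d_gt0 C0 (opL0_components BG) (wbound_support (ltW C0) l0).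
have [IW EW] := has_components_weighted d_gt0 C0 (opW_components BG) (wbound_support (ltW C0) w0).
have E := componentsP d_gt0 e C0 IL IW.
split; last first.
  rewrite [LHS]E EL EW; apply: functional_extensionality_dep => -[|n] /=.
    by rewrite !scaler0 addr0.
  by rewrite scale0r add0r.
have [mL I1] := (weighted_L1P _ C0).1 IL; have [mW I2] := (weighted_L1P _ C0).1 IW.
apply/(weighted_L1P _ C0); split.
  by apply: measurable_funD => //; exact: measurable_funM.
have mC := @measurable_card R d (fun n => C ^+ n).
have mS : measurable_fun setT (e *: opL0 L G + opW W G).
  by apply: measurable_funD => //; exact: measurable_funM.
apply: ae_le_integrable (integrable_lincomb `|e| I1 I2).
  by apply: measurable_funM => //; exact: measurableT_comp.
apply: aeW => eta; have Ce : 0 <= C ^+ #|` eta| by rewrite exprn_ge0// ltW.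
rewrite normrM normr_id (ger0_norm Ce) mulrA -mulrDl ler_wpM2r//.
by rewrite (le_trans (ler_normD _ _))// normrM.
Qed.

Local Notation Xs := (fun n : nat => Xn R d n : normedModType R).
Local Notation hgen := (hgen level_l level_w).
Local Notation evolution := (@evolution R Xs level_l level_w).

Variable C0 : R.
Hypothesis C0_gt0 : 0 < C0.
Let T := 1 / (B * C0).
Let C t := C0 / (1 - B * C0 * t).

Let BC0_gt0 : 0 < B * C0.
Proof. by rewrite mulr_gt0// (lt_le_trans ltr01). Qed.

Lemma lt_time t : t < T -> B * C0 * t < 1.
Proof. by rewrite /T ltr_pdivlMr// mulrC. Qed.

Lemma base_gt0 t : t < T -> 0 < C t.
Proof. by move=> /lt_time tT; rewrite divr_gt0// subr_gt0. Qed.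

Lemma base0 : C 0 = C0.
Proof. by rewrite /C mulr0 subr0 divr1. Qed.

Lemma base_le s t : s <= t -> t < T -> C s <= C t.
Proof.
move=> st tT; have sT := le_lt_trans st tT.
rewrite /C ler_pM2l// lef_pV2 ?posrE ?subr_gt0 ?lt_time//.
by rewrite lerD2l lerN2 ler_wpM2l// ltW.
Qed.

Lemma larger_base T1 : 0 < T1 < T -> exists2 C', C0 < C' & B * C' * T1 < 1.
Proof.
move=> /andP[T10 T1T]; have h := lt_time T1T.
have B0 : 0 < B by exact: lt_le_trans B_ge1.
(* The midpoint of [C0] and the critical base $1/(BT_1)$, which exceeds [C0] because [T1 < T]. *)
exists ((C0 + (B * T1)^-1) / 2).
  have : C0 < (B * T1)^-1.
    by rewrite -[ltRHS]mul1r ltr_pdivlMr ?mulr_gt0// mulrCA mulrA.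
  by move=> ?; lra.
have -> : B * ((C0 + (B * T1)^-1) / 2) * T1 = (B * C0 * T1 + 1) / 2.
  by field; rewrite !gt_eqF.
by lra.
Qed.

Section family.
Variables (e : R) (k0 : conf R d -> R).
Hypotheses (e_ge0 : 0 <= e) (k0C : k0 \in weighted_Linfty C0).
Let phi := dual_functional d_gt0 C0_gt0 k0C.
Let K := fine (weighted_Linfty_norm C0 k0).
Let K_ge0 : 0 <= K := weighted_Linfty_norm_ge0 C0 k0.
Let phi_le m (u : Xn R d m) : `|phi m u| <= K * (C0 ^+ m / m`!%:R) * `|u|.
Proof. exact: dual_functional_le. Qed.

(** The pairing is prescribed on the whole of $\mathcal{L}_{C_t}$, not just on [Bbs]: the
    generator's image in the derivative and the final limit need it. Including $t = 0$ serves
    continuity there. *)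
Definition dual_evolution (kt : R -> conf R d -> R) := kt 0 = k0 /\
  forall t, 0 <= t < T -> [/\ kt t \in weighted_Linfty (C t),
    (weighted_Linfty_norm (C t) (kt t) <= weighted_Linfty_norm C0 k0)%E &
    forall G, G \in weighted_L1 (C t) ->
      pairing G (kt t) = evolution phi e t (components G)].

Lemma exists_dual_evolution : exists kt, dual_evolution kt.
Proof.
have ex t : exists k, 0 < t < T -> [/\ k \in weighted_Linfty (C t),
    (weighted_Linfty_norm (C t) k <= weighted_Linfty_norm C0 k0)%E &
    forall G, G \in weighted_L1 (C t) ->
      pairing G k = evolution phi e t (components G)].
  have [/andP[t0 tT]|nt] := boolP (0 < t < T); last by exists k0.
  have BCt := lt_time tT.
  have [k [kC kn kE]] := @conf_dual R d d_gt0 (C t) K (evolution phi e t)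
    (base_gt0 tT) K_ge0
    (fun a y z P Q => @evolutionP _ _ _ _ _ _ level_bound_ge0 level_bound_nd B_ge0
      level_l_le level_w_le level_l_dissipative _ _ _ C0_gt0 K_ge0 phi_le e t a y z P Q
      e_ge0 (ltW t0) BCt)
    (fun y P => @evolution_le _ _ _ _ _ _ level_bound_ge0 level_bound_nd B_ge0
      level_l_le level_w_le level_l_dissipative _ _ _ C0_gt0 K_ge0 phi_le e t y P
      e_ge0 (ltW t0) BCt).
  exists k => _; split=> // [|G GC]; last by rewrite kE.
  by rewrite fineK// in kn; exact: weighted_Linfty_norm_fin.
pose f t := sval (cid (ex t)).
(* Duality determines a function up to null sets only, so the value at time 0 is set by hand. *)
exists (fun t => if t == 0 then k0 else f t); split; first by rewrite eqxx.
move=> t /andP[t0 tT]; case: eqVneq => [->|tn0].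
  rewrite base0; split=> // G GC.
  rewrite (pairingE d_gt0 C0_gt0 k0C GC); congr (limn (series _)).
  by apply/funext => n; rewrite evo0.
by apply: (svalP (cid (ex t))); rewrite lt0r tn0 t0.
Qed.

Variable kt : R -> conf R d -> R.
Hypothesis ktP : dual_evolution kt.

Lemma pairing_dual_evolution G t : Bbs G -> 0 <= t < T ->
  pairing G (kt t) = evolution phi e t (components G).
Proof.
move=> BG tT; have [_ _] := ktP.2 t tT; apply; apply: Bbs_weighted_L1 => //.
by case/andP: tT => _; exact: base_gt0.
Qed.

Lemma dual_evolution_continuous G : Bbs G ->
  {within `[0, T[, continuous (fun t => pairing G (kt t))}.
Proof.
move=> BG; apply: within_continuous_lipschitz => T1 /[dup] T1T /larger_base[C' C0C' BC'].
have [N G0 _] := Bbs_components d_gt0 BG.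
have C'0 : 0 <= C' / (1 - B * C' * T1).
  by rewrite divr_ge0 ?(ltW (lt_trans C0_gt0 C0C'))// ltW// subr_gt0.
have lip := @evolution_lipschitz _ _ _ _ _ _ level_bound_ge0 level_bound_nd B_ge0
  level_l_le level_w_le level_l_dissipative _ _ _ C0_gt0 K_ge0 phi_le C' T1 e
  C0C' BC' e_ge0.
eexists => s t sT1 tT1; case/andP: T1T => T10 T1T.
have sT : 0 <= s < T by case/andP: sT1 => -> /le_lt_trans ->.
have tT : 0 <= t < T by case/andP: tT1 => -> /le_lt_trans ->.
rewrite !pairing_dual_evolution//.
exact: (lip s t _ _ _ sT1 tT1 (wbound_support C'0 G0)
  (wbound_support C'0 (hgen_support e G0))).
Qed.

Lemma dual_evolution_is_derive G t : Bbs G -> 0 < t < T ->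
  is_derive t 1 (fun s => pairing G (kt s)) (pairing (e *: opL0 L G + opW W G) (kt t)).
Proof.
move=> BG /andP[t0 tT].
have [N G0 _] := Bbs_components d_gt0 BG.
pose T1 := (t + T) / 2.
have T1T : 0 < T1 < T by rewrite /T1; apply/andP; split; lra.
have tT1 : t < T1 by rewrite /T1; lra.
have [C' C0C' BC'] := larger_base T1T.
have C'0 : 0 <= C' / (1 - B * C' * T1).
  by rewrite divr_ge0 ?(ltW (lt_trans C0_gt0 C0C'))// ltW// subr_gt0.
have tay := @evolution_taylor _ _ _ _ _ _ level_bound_ge0 level_bound_nd B_ge0
  level_l_le level_w_le level_l_dissipative _ _ _ C0_gt0 K_ge0 phi_le C' T1 e
  C0C' BC' e_ge0.
have tI : 0 <= t <= T1 by rewrite !ltW.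
have tT' : 0 <= t < T by rewrite ltW.
have [HC HE] := generator_components e (base_gt0 tT) BG.
have -> : pairing (e *: opL0 L G + opW W G) (kt t) =
    evolution phi e t (hgen e (components G)).
  by have [_ _ E] := ktP.2 t tT'; rewrite -HE; exact: (E _ HC).
(* This radius keeps [s] inside $[0, T_1]$, where the Taylor bound is uniform. *)
apply: (@is_derive_taylor _ _ _ _ _ (Num.min t (T1 - t))).
  by rewrite lt_min t0 subr_gt0.
move=> s; rewrite lt_min => /andP[st1 st2].
have sI : 0 <= s <= T1.
  move: st1 st2; rewrite !ltr_norml => /andP[? ?] /andP[? ?].
  by apply/andP; split; lra.
have sT : 0 <= s < T.
  by case/andP: sI => -> /le_lt_trans ->//; case/andP: T1T.
rewrite !pairing_dual_evolution//.
exact: (tay t s _ _ _ _ tI sI (wbound_support C'0 G0)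
  (wbound_support C'0 (hgen_support e G0))
  (wbound_support C'0 (hgen_support e (hgen_support e G0)))).
Qed.

End family.

(** The evolution is linear in the functional, so the difference is the evolution with datum
    [k1 - k2]. *)
Lemma dual_evolution_sub_le e k1 k2 (k1C : k1 \in weighted_Linfty C0)
    (k2C : k2 \in weighted_Linfty C0) (k12C : k1 - k2 \in weighted_Linfty C0) t y P :
  0 <= e -> 0 <= t < T -> wbound (C t) y P ->
  `|evolution (dual_functional d_gt0 C0_gt0 k1C) e t y -
    evolution (dual_functional d_gt0 C0_gt0 k2C) e t y| <=
  fine (weighted_Linfty_norm C0 (k1 - k2)) * P.
Proof.
move=> e0 /andP[t0 tT] yP; have BCt := lt_time tT.
have cs k (kC : k \in weighted_Linfty C0) m :=
  @is_cvg_evo _ Xs _ _ _ _ level_bound_ge0 level_bound_nd B_ge0 level_l_le level_w_le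
  _ _ (dual_functional d_gt0 C0_gt0 kC) C0_gt0 (weighted_Linfty_norm_ge0 C0 k)
  (dual_functional_le d_gt0 C0_gt0 kC) e m t y e0.
have ce k (kC : k \in weighted_Linfty C0) :=
  @is_cvg_evolution _ Xs _ _ _ _ level_bound_ge0 level_bound_nd B_ge0 level_l_le level_w_le
  level_l_dissipative _ _ (dual_functional d_gt0 C0_gt0 kC) C0_gt0
  (weighted_Linfty_norm_ge0 C0 k) (dual_functional_le d_gt0 C0_gt0 kC) e t y P e0 t0 BCt yP.
rewrite -(evolutionB (dual_functionalB d_gt0 C0_gt0 k1C k2C k12C)
  (cs _ k1C) (cs _ k2C) (ce _ k1C) (ce _ k2C)).
exact: (@evolution_le _ Xs _ _ _ _ level_bound_ge0 level_bound_nd B_ge0 level_l_le level_w_le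
  level_l_dissipative _ _ _ C0_gt0 (weighted_Linfty_norm_ge0 C0 (k1 - k2))
  (dual_functional_le d_gt0 C0_gt0 k12C) e t y P e0 t0 BCt yP).
Qed.

(** The evolution of the limiting datum [kV0] under parameter [e] is inserted: one difference then
    concerns the initial data only, the other one the generator only. *)
Lemma pairing_sub_cvg0 kV0 k0 (kVC : kV0 \in weighted_Linfty C0)
    (kC : forall e, 0 < e -> k0 e \in weighted_Linfty C0) kV k :
  dual_evolution 0 kVC kV ->
  (forall e (e0 : 0 < e), dual_evolution e (kC e e0) (k e)) ->
  weighted_Linfty_norm C0 (k0 e - kV0) @[e --> 0^'+] --> 0%E ->
  forall T' r0 G0, 0 < T' < T -> C T' < r0 -> G0 \in weighted_L1 r0 ->
    ereal_sup [set `|pairing G0 (k e t - kV t)|%:E | t in `[0, T']]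
      @[e --> 0^'+] --> 0%E.
Proof.
move=> kVE kE nk T' r0 G0 /andP[T'0 T'T] Cr GC.
have BCT' := lt_time T'T.
have CT'0 := base_gt0 T'T.
have r00 : 0 < r0 by exact: lt_trans Cr.
have yP := weighted_L1_wbound d_gt0 r00 GC.
set y := components G0 in yP; set P := \int[_]_x _ in yP.
have P0 := wbound_ge0 yP.
have B0 : 0 < B by exact: lt_le_trans B_ge1.
(* The solution of $C' = BC^2$ followed backwards from [r0] over the time [T']; it stays above [C0]
   because [r0] exceeds $C_{T'}$. *)
pose C' := r0 / (1 + B * r0 * T').
have q0 : 0 < 1 + B * r0 * T' by rewrite ltr_wpDr// !mulr_ge0// ltW.
have C0C' : C0 < C'.
  rewrite /C' ltr_pdivlMr//; move: Cr; rewrite /C ltr_pdivrMr ?subr_gt0// mulrBr mulr1.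
  have -> : C0 * (1 + B * r0 * T') = C0 + r0 * (B * C0 * T') by ring.
  by move=> h; lra.
have BC' : B * C' * T' < 1.
  have -> : B * C' * T' = (B * r0 * T') / (1 + B * r0 * T') by rewrite /C'; field; rewrite gt_eqF.
  by rewrite ltr_pdivrMr// mul1r ltrDr.
have DE : C' / (1 - B * C' * T') = r0.
  have -> : 1 - B * C' * T' = (1 + B * r0 * T')^-1 by rewrite /C'; field; rewrite gt_eqF.
  by rewrite invrK /C' divfK// gt_eqF.
have CtC t : 0 <= t <= T' -> C t <= r0.
  by move=> /andP[t0 tT]; apply: le_trans (ltW Cr); exact: base_le.
have GCt t : 0 <= t <= T' -> G0 \in weighted_L1 (C t).
  move=> tT; apply: weighted_L1_le GC => //; last exact: CtC.
  by apply: base_gt0; case/andP: tT => _ /le_lt_trans; apply.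
have yPt t : 0 <= t <= T' -> wbound (C t) y P.
  move=> tT M; apply: le_trans (yP M); apply: wnorm_le; last exact: CtC.
  by apply/ltW/base_gt0; case/andP: tT => _ /le_lt_trans; apply.
have main d' : 0 < d' -> \forall e \near 0^'+,
    (0 <= ereal_sup [set `|pairing G0 (k e t - kV t)|%:E | t in `[0%R, T']] <= d'%:E)%E.
  move=> d'0.
  have [e0 e0_gt0 He0] : exists2 e0, 0 < e0 & forall e t, 0 <= e <= e0 -> 0 <= t <= T' ->
      `|evolution (dual_functional d_gt0 C0_gt0 kVC) e t y -
        evolution (dual_functional d_gt0 C0_gt0 kVC) 0 t y| <= d' / 2.
    apply: (@evolution_cvg0 _ Xs _ _ _ _ level_bound_ge0 level_bound_nd B_ge0 level_l_le
      level_w_le level_l_dissipative _ _ _ C0_gt0 (weighted_Linfty_norm_ge0 C0 kV0)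
      (dual_functional_le d_gt0 C0_gt0 kVC) C' T' y P (d' / 2) C0C' (ltW T'0) BC').
      by rewrite DE.
    by rewrite divr_gt0.
  move: nk => /fine_cvgP[nfin ncvg].
  have ncvg' : \forall e \near 0^'+,
      `|0 - fine (weighted_Linfty_norm C0 (k0 e - kV0))| <= d' / 2 / (P + 1).
    by move/cvgrPdist_le : ncvg; apply; rewrite !divr_gt0// ltr_wpDl.
  near=> e.
  have e_gt0 : 0 < e by near: e; exact: nbhs_right_gt.
  have ee0 : e <= e0 by near: e; exact: nbhs_right_ltW.
  have nf : weighted_Linfty_norm C0 (k0 e - kV0) \is a fin_num by near: e.
  have nle : `|0 - fine (weighted_Linfty_norm C0 (k0 e - kV0))| <= d' / 2 / (P + 1).
    by near: e.
  have keC := kC e e_gt0.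
  have dC : k0 e - kV0 \in weighted_Linfty C0.
    apply/andP; split; rewrite inE/=; last by rewrite /finite_norm ltey_eq nf.
    apply: measurable_funM; last exact: (@measurable_card R d (fun n => C0 ^- n)).
    apply: measurable_funB.
      exact: weighted_Linfty_measurable keC.
    exact (weighted_Linfty_measurable C0_gt0 kVC).
  apply/andP; split.
    (* The supremum is nonnegative because the value at [t = 0] belongs to the set. *)
    apply: le_trans (ereal_sup_ubound _); last first.
      by exists 0 => //=; rewrite in_itv/= lexx ltW.
    by rewrite lee_fin.
  apply: ge_ereal_sup => _ [t /= tI <-]; rewrite in_itv/= in tI.
  have tT : 0 <= t < T by case/andP: tI => -> /le_lt_trans ->.
  have Ct0 : 0 < C t by apply: base_gt0; case/andP: tT.
  have [kVt _ EV] := kVE.2 t tT; have [ket _ Ek] := (kE e e_gt0).2 t tT.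
  rewrite lee_fin.
  have -> : pairing G0 (k e t - kV t) = pairing G0 (k e t) - pairing G0 (kV t).
    rewrite /pairing -RintegralB//; last 2 first.
    - exact: (integrable_pairing Ct0 ket (GCt _ tI)).
    - exact: (integrable_pairing Ct0 kVt (GCt _ tI)).
    by apply: eq_Rintegral => eta _; rewrite -mulrBr.
  rewrite (EV _ (GCt _ tI)) (Ek _ (GCt _ tI)) -/y.
  rewrite -(subrKA (evolution (dual_functional d_gt0 C0_gt0 kVC) e t y)).
  apply: le_trans (ler_normD _ _) _; rewrite [leRHS](splitr d'); apply: lerD.
    apply: le_trans (dual_evolution_sub_le keC kVC dC (ltW e_gt0) tT (yPt _ tI)) _.
    move: nle; rewrite sub0r normrN ger0_norm ?weighted_Linfty_norm_ge0//.
    rewrite ler_pdivlMr ?ltr_wpDl//; apply: le_trans.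
    by rewrite ler_wpM2l ?weighted_Linfty_norm_ge0// lerDl.
  by apply: He0 => //; rewrite ltW.
apply/fine_cvgP; split.
  apply: filterS (main 1 ltr01) => e /andP[h0 h1].
  by rewrite ge0_fin_numE// (le_lt_trans h1)// ltry.
apply/cvgrPdist_le => d' d'0; apply: filterS (main d' d'0) => e /andP[h0 h1] /=.
rewrite sub0r normrN ger0_norm ?fine_ge0//.
by rewrite -lee_fin fineK// ge0_fin_numE// (le_lt_trans h1)// ltry.
Unshelve. all: by end_near. Qed.

End hierarchy_operators.

Theorem proposition4p4 (R : realType) (d : nat) (A B : R)
  (L : forall n, {linear Xn R d n -> Xn R d n})
  (W : forall n, {linear Xn R d n.-1 -> Xn R d n})
  (C0 : R) (k0V : conf R d -> R) (k0 : R -> conf R d -> R) :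
  (0 < d)%N ->
  0 < A ->
  1 <= B ->
  (forall n, (1 <= n)%N -> contraction_generator (L n)) ->
  (forall n, (1 <= n)%N ->
    (operator_norm (L n) <= (A * n%:R * (n%:R - 1))%:E)%E) ->
  (forall n, (1 <= n)%N ->
    (operator_norm (W n) <= (B * n%:R * (n%:R - 1))%:E)%E) ->
  (forall n u, (1 <= n)%N -> symmetric_class u -> symmetric_class (L n u)) ->
  (forall n u, (1 <= n)%N -> symmetric_class u -> symmetric_class (W n u)) ->
  0 < C0 ->
  k0V \in weighted_Linfty C0 ->
  (forall e, 0 < e -> k0 e \in weighted_Linfty C0) ->
  let T := 1 / (B * C0) in
  let C t := C0 / (1 - B * C0 * t) in
  exists (kV : R -> conf R d -> R) (k : R -> R -> conf R d -> R),
    [/\ (kV 0 = k0V /\ forall e, 0 < e -> k e 0 = k0 e),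
        (forall t, 0 < t < T -> kV t \in weighted_Linfty (C t) /\
           forall e, 0 < e -> k e t \in weighted_Linfty (C t)),
        (forall G, Bbs G ->
           [/\ {within `[0, T[, continuous (fun t => pairing G (kV t))},
               (forall t, 0 < t < T ->
                  is_derive t 1 (fun s => pairing G (kV s)) (pairing (opW W G) (kV t))) &
               forall e, 0 < e ->
                 {within `[0, T[, continuous (fun t => pairing G (k e t))} /\
                 forall t, 0 < t < T ->
                   is_derive t 1 (fun s => pairing G (k e s))
                     (pairing (e *: opL0 L G + opW W G) (k e t))]),
        (forall t, 0 < t < T ->
           (weighted_Linfty_norm (C t) (kV t) <=
              weighted_Linfty_norm C0 k0V)%E /\
           forall e, 0 < e ->
             (weighted_Linfty_norm (C t) (k e t) <=
                weighted_Linfty_norm C0 (k0 e))%E) &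
        (weighted_Linfty_norm C0 (k0 e - k0V) @[e --> 0^'+] --> 0%E ->
         forall T' r0 G0, 0 < T' < T -> C T' < r0 -> G0 \in weighted_L1 r0 ->
           ereal_sup [set `|pairing G0 (k e t - kV t)|%:E | t in `[0, T']]
             @[e --> 0^'+] --> 0%E)].
Proof.
move=> d0 A0 B1 LG LN WN LS WS C00 k0VC k0C T C.
(* The limiting equation is the case [e = 0] of the hierarchy. *)
have [kV kVE] := exists_dual_evolution d0 A0 B1 LG LN WN C00 (lexx 0) k0VC.
(* [dual_evolution] mentions the proof that the datum lies in $\mathcal{K}_{C_0}$, available for
   [0 < e] only; the choice is made for all [e] and all such proofs, which coincide since the
   condition is boolean. *)
have ex e : exists kt, forall e0 : 0 < e,
    dual_evolution B L W d0 C00 e (k0C e e0) kt.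
  have [e0|ne] := pselect (0 < e); last first.
    by exists (fun=> point) => e0; case: (ne e0).
  have [kt ktE] := exists_dual_evolution d0 A0 B1 LG LN WN C00 (ltW e0) (k0C e e0).
  by exists kt => e0'; rewrite (bool_irrelevance e0' e0).
pose k e := sval (cid (ex e)).
have kE e (e0 : 0 < e) := svalP (cid (ex e)) e0.
exists kV, k; split.
- by split=> [|e e0]; [exact: kVE.1|exact: (kE e e0).1].
- move=> t /andP[t0 tT]; have tT' : 0 <= t < T by rewrite ltW.
  have [kVC _ _] := kVE.2 t tT'; split=> // e e0.
  by have [kC _ _] := (kE e e0).2 t tT'.
- move=> G BG; split.
  + exact: (dual_evolution_continuous A0 B1 LG LN WN (lexx 0) kVE BG).
  + move=> t tT.
    have := dual_evolution_is_derive A0 B1 LG LN WN LS WS (lexx 0) kVE BG tT.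
    by rewrite scale0r add0r.
  + move=> e e0; split.
      exact: (dual_evolution_continuous A0 B1 LG LN WN (ltW e0) (kE e e0) BG).
    move=> t tT.
    exact: (dual_evolution_is_derive A0 B1 LG LN WN LS WS (ltW e0) (kE e e0) BG tT).
- move=> t /andP[t0 tT]; have tT' : 0 <= t < T by rewrite ltW.
  have [_ kVn _] := kVE.2 t tT'; split=> // e e0.
  by have [_ kn _] := (kE e e0).2 t tT'.
- exact: (pairing_sub_cvg0 A0 B1 LG LN WN kVE kE).
Qed.
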